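(* Let $p$ be a prime with $p\geq 3$ and let $G$ be a semi-simple, simply connected, split Chevalley group over $\mathbb{Z}_p$. Suppose that $G$ is of one of the following Lie types: $A_{\ell}\ (\ell\geq 1)$, $B_{\ell}\ (\ell\geq 2)$, $C_{\ell}\ (\ell\geq 2)$, $D_{\ell}\ (\ell\geq 3)$, $E_6$, $E_7$, $E_8$, $F_4$, $G_2$. Let $G(1)=\ker\big(G(\mathbb{Z}_p)\to G(\mathbb{Z}_p/p\mathbb{Z}_p)\big)$ and let $\Omega_{G(1)}$ be its mod-$p$ Iwasawa algebra over $\mathbb{F}_p$. Then the center of $\Omega_{G(1)}$ is trivial; that is, if $r$ is a central element of $\Omega_{G(1)}$, then $r\in\mathbb{F}_p$.
   Context: For a compact $p$-adic analytic group $H$, the mod-$p$ Iwasawa algebra is $\Omega_H=\varprojlim_{N}\mathbb{F}_p[H/N]$, the limit being over open normal subgroups $N$ of $H$; $\mathbb{F}_p$ is regarded as a subring of $\Omega_H$ via the scalars. *)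

(* Defs.v *)
From HB Require Import structures.
(* The notations of monalg clash with those of mpoly. *)
From mathcomp Require Import -(notations) monalg.
From mathcomp Require Import mpoly.
From mathcomp Require Import all_boot all_order all_algebra all_field finmap.
From mathcomp Require Import boolp classical_sets topology.
From mathcomp Require Import ring.

Set Implicit Arguments.
Unset Strict Implicit.
Unset Printing Implicit Defensive.

Import GRing.Theory Num.Theory.
Local Open Scope ring_scope.
Local Open Scope quotient_scope.

Record normal_subgroup (G : groupType) := NormalSubgroup {
  nsub_set :> G -> Prop;
  nsub1 : nsub_set 1%g;
  nsubM : forall x y, nsub_set x -> nsub_set y -> nsub_set (x * y)%g;
  nsubV : forall x, nsub_set x -> nsub_set (x^-1)%g;
  nsubJ : forall x y, nsub_set x -> nsub_set (x ^ y)%g }.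

Section Quotient.
Variables (G : groupType) (N : normal_subgroup G).

Definition coset_rel : rel G := fun x y => `[< N (x^-1 * y)%g >].

Lemma coset_rel_refl : reflexive coset_rel.
Proof. by move=> x; apply/asboolP; rewrite mulVg; exact: nsub1. Qed.

Lemma coset_rel_sym : symmetric coset_rel.
Proof.
by move=> x y; apply/asboolP/asboolP => /nsubV; rewrite invgM invgK.
Qed.

Lemma coset_rel_trans : transitive coset_rel.
Proof.
move=> y x z /asboolP h1 /asboolP h2; apply/asboolP.
by have := nsubM h1 h2; rewrite -mulgA mulVKg.
Qed.

Canonical coset_equiv :=
  EquivRel coset_rel coset_rel_refl coset_rel_sym coset_rel_trans.

Definition quotg := {eq_quot coset_rel}.
HB.instance Definition _ := Choice.on quotg.
HB.instance Definition _ := EqQuotient.on quotg.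

Definition cosetg (x : G) : quotg := \pi x.

Lemma cosetg_eq x y : (cosetg x = cosetg y) <-> N (x^-1 * y)%g.
Proof. by split=> [/eqquotP/asboolP|h]; last exact/eqquotP/asboolP. Qed.

Lemma cosetgP (a : quotg) : exists x, a = cosetg x.
Proof. by exists (repr a); rewrite /cosetg reprK. Qed.

Definition quotg_mul (a b : quotg) := cosetg (repr a * repr b)%g.
Definition quotg_inv (a : quotg) := cosetg (repr a)^-1%g.

Lemma repr_cosetg x : N (x^-1 * repr (cosetg x))%g.
Proof. by apply/cosetg_eq; rewrite /cosetg reprK. Qed.

Lemma cosetgM x y : cosetg (x * y)%g = quotg_mul (cosetg x) (cosetg y).
Proof.
apply/cosetg_eq; set x' := repr _; set y' := repr _.
have hx : N (x^-1 * x')%g := repr_cosetg x.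
have hy : N (y^-1 * y')%g := repr_cosetg y.
have -> : ((x * y)^-1 * (x' * y') = (x^-1 * x') ^ y * (y^-1 * y'))%g.
  by rewrite conjgE invgM !mulgA mulgK.
by apply: nsubM => //; apply: nsubJ.
Qed.

Lemma cosetgV x : cosetg (x^-1)%g = quotg_inv (cosetg x).
Proof.
apply/cosetg_eq; set x' := repr _.
have hx : N (x^-1 * x')%g := repr_cosetg x.
rewrite invgK; have := nsubJ (x^-1)%g (nsubV hx).
by rewrite conjgE invgM !invgK -!mulgA mulgV mulg1.
Qed.

Lemma quotg_mulA : associative quotg_mul.
Proof.
move=> a b c; have [x ->] := cosetgP a; have [y ->] := cosetgP b.
by have [z ->] := cosetgP c; rewrite -!cosetgM mulgA.
Qed.

Lemma quotg_mul1 : left_id (cosetg 1%g) quotg_mul.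
Proof. by move=> a; have [x ->] := cosetgP a; rewrite -cosetgM mul1g. Qed.

Lemma quotg_1mul : right_id (cosetg 1%g) quotg_mul.
Proof. by move=> a; have [x ->] := cosetgP a; rewrite -cosetgM mulg1. Qed.

Lemma quotg_mulV : left_inverse (cosetg 1%g) quotg_inv quotg_mul.
Proof.
by move=> a; have [x ->] := cosetgP a; rewrite -cosetgV -cosetgM mulVg.
Qed.

Lemma quotg_Vmul : right_inverse (cosetg 1%g) quotg_inv quotg_mul.
Proof.
by move=> a; have [x ->] := cosetgP a; rewrite -cosetgV -cosetgM mulgV.
Qed.

HB.instance Definition _ := isGroup.Build quotg
  quotg_mulA quotg_mul1 quotg_1mul quotg_mulV quotg_Vmul.

End Quotient.

Section QuotientMap.
Variables (G : groupType) (N N' : normal_subgroup G).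

(* The projection G / N -> G / N', meaningful when N is contained in N' *)
Definition quotg_map (a : quotg N) : quotg N' := cosetg N' (repr a).

Hypothesis sNN' : forall x, N x -> N' x.

Lemma quotg_mapE x : quotg_map (cosetg N x) = cosetg N' x.
Proof.
apply/esym/cosetg_eq/sNN'; exact: repr_cosetg.
Qed.

Lemma quotg_map1 : quotg_map 1%g = 1%g.
Proof. exact: quotg_mapE. Qed.

Lemma quotg_mapM : {morph quotg_map : a b / (a * b)%g}.
Proof.
move=> a b; have [x ->] := cosetgP a; have [y ->] := cosetgP b.
by rewrite -[(_ * _)%g]cosetgM !quotg_mapE cosetgM.
Qed.

End QuotientMap.

Section GroupAlgebra.
Variables (R : nzRingType) (Q : groupType).

(* malg is only a ring over a monoid without non-trivial units, so the
   convolution product is supplied here. *)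
Definition galg : Type := monalg.malg Q R.
HB.instance Definition _ := GRing.Zmodule.copy galg (monalg.malg Q R).

Definition gcoef (k : Q) (a : galg) : R := monalg.mcoeff k a.
Definition gsupp (a : galg) : {fset Q} := monalg.msupp a.
Definition gmono (c : R) (k : Q) : galg := monalg.mkmalgU k c.

Lemma gcoefP (a b : galg) : (forall k, gcoef k a = gcoef k b) <-> a = b.
Proof. exact: monalg.malgP. Qed.

Lemma gcoef_gmono c k k' : gcoef k' (gmono c k) = c *+ (k == k').
Proof. exact: monalg.mcoeffU. Qed.

Lemma gcoef_sum I (r : seq I) (P : pred I) F k :
  gcoef k (\sum_(i <- r | P i) F i) = \sum_(i <- r | P i) gcoef k (F i).
Proof. exact: (raddf_sum (monalg.mcoeff k)). Qed.

Lemma gmonoD k : {morph gmono^~ k : c d / c + d}.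
Proof. exact: monalg.monalgUD. Qed.

Lemma gmono0 k : gmono 0 k = 0.
Proof. exact: monalg.monalgU0. Qed.


Lemma galgE (a : galg) : a = \sum_(x <- gsupp a) gmono (gcoef x a) x.
Proof. exact: monalg.monalgE. Qed.

Definition gext (V : nmodType) (F : R -> Q -> V) (a : galg) : V :=
  \sum_(x <- gsupp a) F (gcoef x a) x.

Section Ext.
Variables (V : nmodType) (F : R -> Q -> V).
Hypothesis F0 : forall k, F 0 k = 0.
Hypothesis FD : forall k, {morph F^~ k : c d / c + d}.

Lemma gext_wide (E : {fset Q}) a : (gsupp a `<=` E)%fset ->
  gext F a = \sum_(x <- E) F (gcoef x a) x.
Proof.
move=> le; rewrite /gext (big_fset_incl _ le) //= => x xE xa.
by rewrite /gcoef monalg.mcoeff_outdom.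
Qed.

Lemma gextD : {morph gext F : a b / a + b}.
Proof.
move=> a b; pose E := (gsupp a `|` gsupp b)%fset.
rewrite (@gext_wide E (a + b)) ?(@gext_wide E a) ?(@gext_wide E b) //.
- by rewrite -big_split; apply: eq_bigr => x _; rewrite /gcoef monalg.mcoeffD FD.
- exact: fsubsetUr.
- exact: fsubsetUl.
- exact: monalg.msuppD_le.
Qed.

Lemma gext0 : gext F 0 = 0.
Proof. by rewrite /gext /gsupp monalg.msupp0 big_seq_fset0. Qed.

Lemma gext_gmono c k : gext F (gmono c k) = F c k.
Proof.
rewrite (@gext_wide [fset k]%fset) ?big_seq_fset1 ?gcoef_gmono ?eqxx //.
exact: monalg.msuppU_le.
Qed.

Lemma gext_sum I (r : seq I) (P : pred I) G :
  gext F (\sum_(i <- r | P i) G i) = \sum_(i <- r | P i) gext F (G i).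
Proof. exact: (big_morph _ gextD gext0). Qed.

End Ext.

Lemma eq_gadd (V : nmodType) (f g : galg -> V) :
    f 0 = 0 -> {morph f : a b / a + b} -> g 0 = 0 -> {morph g : a b / a + b} ->
  (forall c k, f (gmono c k) = g (gmono c k)) -> f =1 g.
Proof.
move=> f0 fD g0 gD fg a; rewrite (galgE a) (big_morph f fD f0) (big_morph g gD g0).
exact: eq_bigr.
Qed.

Definition gone : galg := gmono 1 1%g.
Definition gmul (a b : galg) : galg :=
  \sum_(x <- gsupp a) \sum_(y <- gsupp b)
     gmono (gcoef x a * gcoef y b) (x * y)%g.

Let F2 (b : galg) (c : R) (x : Q) : galg :=
  gext (fun d y => gmono (c * d) (x * y)%g) b.

Let gmulE a b : gmul a b = gext (F2 b) a.
Proof. by []. Qed.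

Let F20 b k : F2 b 0 k = 0.
Proof. by rewrite /F2 /gext big1 // => y _; rewrite mul0r gmono0. Qed.

Let F2D b k : {morph (F2 b)^~ k : c d / c + d}.
Proof.
move=> c d; rewrite /F2 /gext -big_split; apply: eq_bigr => y _ /=.
by rewrite mulrDl gmonoD.
Qed.

Lemma gmul0g b : gmul 0 b = 0. Proof. exact: (gext0 (F2 b)). Qed.

Lemma gmulDl : left_distributive gmul +%R.
Proof. by move=> a b c; rewrite !gmulE (gextD (F20 _) (F2D _)). Qed.

Let F2r0 c k : F2 0 c k = 0.
Proof. exact: (gext0 (fun d y => gmono (c * d) (k * y)%g)). Qed.

Let F2rD a b c k : F2 (a + b) c k = F2 a c k + F2 b c k.
Proof.
rewrite /F2 gextD // => [x|x d e]; first by rewrite mulr0 gmono0.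
by rewrite mulrDr gmonoD.
Qed.

Lemma gmulg0 a : gmul a 0 = 0.
Proof. by rewrite gmulE /gext big1. Qed.

Lemma gmulDr : right_distributive gmul +%R.
Proof.
move=> a b c; rewrite !gmulE /gext -big_split; apply: eq_bigr => x _ /=.
exact: F2rD.
Qed.

Lemma gmul_gmono c d x y : gmul (gmono c x) (gmono d y) = gmono (c * d) (x * y)%g.
Proof.
rewrite gmulE (gext_gmono (F20 _)) /F2 gext_gmono // => k.
by rewrite mulr0 gmono0.
Qed.

Lemma gmulA : associative gmul.
Proof.
move=> a b c.
apply: (eq_gadd (f := fun a => gmul a (gmul b c))
  (g := fun a => gmul (gmul a b) c)); rewrite ?gmul0g //.
- by move=> u v; rewrite gmulDl.
- by move=> u v; rewrite !gmulDl.
move=> r x; apply: (eq_gadd (f := fun b => gmul (gmono r x) (gmul b c))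
  (g := fun b => gmul (gmul (gmono r x) b) c)); rewrite ?(gmul0g, gmulg0) //.
- by move=> u v; rewrite gmulDl gmulDr.
- by move=> u v; rewrite gmulDr gmulDl.
move=> s y; apply: (eq_gadd (f := fun c => gmul (gmono r x) (gmul (gmono s y) c))
  (g := gmul (gmul (gmono r x) (gmono s y)))); rewrite ?(gmul0g, gmulg0) //.
- by move=> u v; rewrite !gmulDr.
- by move=> u v; rewrite gmulDr.
by move=> t z; rewrite !gmul_gmono mulrA mulgA.
Qed.

Lemma gmul1g : left_id gone gmul.
Proof.
apply: (eq_gadd (f := gmul gone) (g := id)) => [|u v|||c k] //; first exact: gmulg0.
  exact: gmulDr.
by rewrite gmul_gmono mul1r mul1g.
Qed.

Lemma gmulg1 : right_id gone gmul.
Proof.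
apply: (eq_gadd (f := gmul^~ gone) (g := id)) => [|u v|||c k] //; first exact: gmul0g.
  exact: gmulDl.
by rewrite gmul_gmono mulr1 mulg1.
Qed.

Lemma gone_neq0 : gone != 0.
Proof.
apply/eqP => /(congr1 (gcoef 1%g)); rewrite gcoef_gmono eqxx mulr1n.
by rewrite /gcoef monalg.mcoeff0 => /eqP; rewrite oner_eq0.
Qed.

HB.instance Definition _ := GRing.Zmodule_isNzRing.Build galg
  gmulA gmul1g gmulg1 gmulDl gmulDr gone_neq0.

Lemma gmonoM c d x y : gmono c x * gmono d y = gmono (c * d) (x * y)%g :> galg.
Proof. exact: gmul_gmono. Qed.

End GroupAlgebra.

Section GroupAlgebraMap.
Variables (R : nzRingType) (Q Q' : groupType) (phi : Q -> Q').
Hypothesis phi1 : phi 1%g = 1%g.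
Hypothesis phiM : {morph phi : x y / (x * y)%g}.

Definition galg_map (a : galg R Q) : galg R Q' :=
  \sum_(x <- gsupp a) gmono (gcoef x a) (phi x).

Lemma galg_map0 : galg_map 0 = 0.
Proof. exact: (gext0 (fun c x => gmono c (phi x))). Qed.

Lemma galg_mapD : {morph galg_map : a b / a + b}.
Proof.
by move=> a b; apply: (gextD (F := fun c x => gmono c (phi x))) => k; [exact: gmono0 | exact: gmonoD].
Qed.

Lemma galg_map_gmono c k : galg_map (gmono c k) = gmono c (phi k).
Proof. by apply: (gext_gmono (F := fun c x => gmono c (phi x))) => x; exact: gmono0. Qed.

Lemma galg_map1 : galg_map 1 = 1.
Proof. by rewrite galg_map_gmono phi1. Qed.

Lemma galg_mapM : {morph galg_map : a b / a * b}.
Proof.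
move=> a b; apply: (eq_gadd (f := fun a => galg_map (a * b))
  (g := fun a => galg_map a * galg_map b)); rewrite ?(mul0r, galg_map0) //.
- by move=> u v; rewrite mulrDl galg_mapD.
- by move=> u v; rewrite galg_mapD mulrDl.
move=> r x; apply: (eq_gadd (f := fun b => galg_map (gmono r x * b))
  (g := fun b => galg_map (gmono r x) * galg_map b));
  rewrite ?(mulr0, galg_map0) //.
- by move=> u v; rewrite mulrDr galg_mapD.
- by move=> u v; rewrite galg_mapD mulrDr.
by move=> s y; rewrite gmonoM !galg_map_gmono gmonoM phiM.
Qed.

End GroupAlgebraMap.

Section InverseLimit.
Variables (I : Type) (le : I -> I -> Prop) (R : I -> nzRingType).
Variable (tr : forall i j, le i j -> {rmorphism R j -> R i}).

Record invlim := InvLim {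
  invlim_val :> forall i, R i;
  _ : `[< forall i j (h : le i j), tr h (invlim_val j) = invlim_val i >] }.

HB.instance Definition _ := [isSub for invlim_val].
HB.instance Definition _ := [Choice of invlim by <:].

Lemma invlimP (x : invlim) i j (h : le i j) : tr h (x j) = x i.
Proof. by case: x => x /= /asboolP. Qed.

Lemma eq_invlim (x y : invlim) : (forall i, x i = y i) -> x = y.
Proof. by move=> xy; apply/val_inj/functional_extensionality_dep. Qed.

Program Definition invlim0 := @InvLim (fun i => 0) _.
Next Obligation. by apply/asboolP => i j h; rewrite rmorph0. Qed.
Program Definition invlim1 := @InvLim (fun i => 1) _.
Next Obligation. by apply/asboolP => i j h; rewrite rmorph1. Qed.
Program Definition invlim_opp (x : invlim) := @InvLim (fun i => - x i) _.
Next Obligation.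
by move=> x; apply/asboolP => i j h; rewrite rmorphN invlimP. Qed.
Program Definition invlim_add (x y : invlim) := @InvLim (fun i => x i + y i) _.
Next Obligation.
by move=> x y; apply/asboolP => i j h; rewrite rmorphD !invlimP. Qed.
Program Definition invlim_mul (x y : invlim) := @InvLim (fun i => x i * y i) _.
Next Obligation.
by move=> x y; apply/asboolP => i j h; rewrite rmorphM !invlimP. Qed.

Lemma invlim_addA : associative invlim_add.
Proof. by move=> x y z; apply: eq_invlim => i; rewrite /= addrA. Qed.
Lemma invlim_addC : commutative invlim_add.
Proof. by move=> x y; apply: eq_invlim => i; rewrite /= addrC. Qed.
Lemma invlim_add0 : left_id invlim0 invlim_add.
Proof. by move=> x; apply: eq_invlim => i; rewrite /= add0r. Qed.
Lemma invlim_addN : left_inverse invlim0 invlim_opp invlim_add.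
Proof. by move=> x; apply: eq_invlim => i; rewrite /= addNr. Qed.

HB.instance Definition _ := GRing.isZmodule.Build invlim
  invlim_addA invlim_addC invlim_add0 invlim_addN.

Lemma invlim_mulA : associative invlim_mul.
Proof. by move=> x y z; apply: eq_invlim => i; rewrite /= mulrA. Qed.
Lemma invlim_mul1 : left_id invlim1 invlim_mul.
Proof. by move=> x; apply: eq_invlim => i; rewrite /= mul1r. Qed.
Lemma invlim_1mul : right_id invlim1 invlim_mul.
Proof. by move=> x; apply: eq_invlim => i; rewrite /= mulr1. Qed.
Lemma invlim_mulDl : left_distributive invlim_mul +%R.
Proof. by move=> x y z; apply: eq_invlim => i; rewrite /= mulrDl. Qed.
Lemma invlim_mulDr : right_distributive invlim_mul +%R.
Proof. by move=> x y z; apply: eq_invlim => i; rewrite /= mulrDr. Qed.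

HB.instance Definition _ := GRing.Zmodule_isPzRing.Build invlim
  invlim_mulA invlim_mul1 invlim_1mul invlim_mulDl invlim_mulDr.

Section Projection.
Variable i : I.
Definition invlim_proj (x : invlim) : R i := x i.

Lemma invlim_proj_is_zmod_morphism : zmod_morphism invlim_proj.
Proof. by []. Qed.
Lemma invlim_proj_is_monoid_morphism : monoid_morphism invlim_proj.
Proof. by []. Qed.
HB.instance Definition _ := GRing.isZmodMorphism.Build invlim (R i) invlim_proj
  invlim_proj_is_zmod_morphism.
HB.instance Definition _ := GRing.isMonoidMorphism.Build invlim (R i)
  invlim_proj invlim_proj_is_monoid_morphism.
End Projection.

End InverseLimit.

(* With 'Z_m the modulus is max(m, 2), so Zred is a ring morphism for every p,
   but 'Z_(p ^ i.+1) is Z/p^(i+1) only for p > 1. *)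
Section Zred.
Variables (p i j : nat).
Hypothesis ij : (i <= j)%N.

(* Reduction Z/p^(j+1) -> Z/p^(i+1) *)
Definition Zred (_ : (i <= j)%N) (a : 'Z_(p ^ j.+1)) : 'Z_(p ^ i.+1) :=
  (a : nat)%:R.

Lemma Zp_trunc_dvd : ((Zp_trunc (p ^ i.+1)).+2 %| (Zp_trunc (p ^ j.+1)).+2)%N.
Proof.
case: p => [|[|q]]; rewrite ?exp0n ?exp1n //.
have P k : (1 < q.+2 ^ k.+1)%N by rewrite -[X in (X < _)%N](expn0 q.+2) ltn_exp2l.
by rewrite !Zp_cast //; apply: dvdn_exp2l.
Qed.

Let redE (a : nat) : ((a %% (Zp_trunc (p ^ j.+1)).+2)%N%:R : 'Z_(p ^ i.+1)) = a%:R.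
Proof.
have [k ->] := dvdnP Zp_trunc_dvd.
rewrite [in RHS](divn_eq a (k * (Zp_trunc (p ^ i.+1)).+2)) natrD natrM.
suff -> : ((k * (Zp_trunc (p ^ i.+1)).+2)%:R : 'Z_(p ^ i.+1)) = 0.
  by rewrite mulr0 add0r.
by apply: val_inj; rewrite /= Zp_nat /= modnMl.
Qed.

Lemma Zred_is_zmod_morphism : zmod_morphism (Zred ij).
Proof.
move=> x y; apply/eqP; rewrite eq_sym subr_eq /Zred; apply/eqP.
rewrite -natrD -[RHS]redE; congr (_%:R).
by rewrite -[in LHS](subrK y x).
Qed.

Lemma Zred_is_monoid_morphism : monoid_morphism (Zred ij).
Proof.
split; first by rewrite /Zred -[RHS](redE 1).
by move=> x y; rewrite /Zred -natrM -[RHS]redE.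
Qed.

HB.instance Definition _ := GRing.isZmodMorphism.Build _ _ (Zred ij) Zred_is_zmod_morphism.
HB.instance Definition _ :=
  GRing.isMonoidMorphism.Build _ _ (Zred ij) Zred_is_monoid_morphism.
End Zred.

Section PadicIntegers.
Variable p : nat.

Definition padic_int : Type :=
  invlim (R := fun n => 'Z_(p ^ n.+1)) (le := fun i j => (i <= j)%N : Prop)
    (fun i j h => @Zred p i j h : {rmorphism _ -> _}).

HB.instance Definition _ := GRing.PzRing.on padic_int.

Lemma padic_mulC : commutative (@GRing.mul padic_int).
Proof. by move=> x y; apply: eq_invlim => i; exact: mulrC. Qed.

Lemma padic_oner_neq0 : (1 : padic_int) != 0.
Proof.
apply/eqP => /(congr1 (fun x : padic_int => x 0%N)) /eqP; exact/negP/oner_neq0.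
Qed.

HB.instance Definition _ := GRing.PzRing_hasCommutativeMul.Build padic_int padic_mulC.
HB.instance Definition _ := GRing.PzSemiRing_isNonZero.Build padic_int padic_oner_neq0.

(* The p-adic topology: the coarsest one making all the reductions continuous *)
Definition padic_to_prod (x : padic_int) :
  prod_topology (fun n => discrete_topology 'Z_(p ^ n.+1)) := fun n => x n.
HB.instance Definition _ := Topological.copy padic_int (initial_topology padic_to_prod).

(* The residue ring Z_p / p Z_p is Z/p *)
Definition padic_modp : padic_int -> 'Z_(p ^ 1) := fun x => invlim_proj 0 x.
HB.instance Definition _ := GRing.RMorphism.copy padic_modp (@invlim_proj _ _ _ _ 0%N).

End PadicIntegers.
#[short(type="preTopologicalGroupType")]
HB.structure Definition PreTopologicalGroup :=
  {G of Topological G & Group G}.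

Section Iwasawa.
Variables (k : nzRingType) (H : preTopologicalGroupType).

Record open_normal_subgroup := OpenNormalSubgroup {
  ons_group :> normal_subgroup H;
  ons_open : open (ons_group : set H) }.

Section Transition.
Variables N N' : open_normal_subgroup.

(* k[H / N'] -> k[H / N] for N' contained in N *)
Definition iwasawa_tr (_ : (N' `<=` N)%classic) : galg k (quotg N') -> galg k (quotg N) :=
  galg_map (@quotg_map H N' N).

Hypothesis sN : (N' `<=` N)%classic.

Lemma iwasawa_tr_is_zmod_morphism : zmod_morphism (iwasawa_tr sN).
Proof.
move=> a b; apply/eqP; rewrite eq_sym subr_eq; apply/eqP.
by rewrite /iwasawa_tr -galg_mapD subrK.
Qed.

Lemma iwasawa_tr_is_monoid_morphism : monoid_morphism (iwasawa_tr sN).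
Proof.
split; first exact/galg_map1/quotg_map1.
exact/galg_mapM/quotg_mapM.
Qed.

HB.instance Definition _ := GRing.isZmodMorphism.Build _ _ (iwasawa_tr sN)
  iwasawa_tr_is_zmod_morphism.
HB.instance Definition _ := GRing.isMonoidMorphism.Build _ _ (iwasawa_tr sN)
  iwasawa_tr_is_monoid_morphism.
End Transition.

Definition iwasawa : Type :=
  invlim (R := fun N : open_normal_subgroup => galg k (quotg N))
    (le := fun N N' : open_normal_subgroup => (N' `<=` N)%classic)
    (fun N N' h => iwasawa_tr h : {rmorphism _ -> _}).
HB.instance Definition _ := GRing.PzRing.on iwasawa.

Program Definition iwasawa_scalar (c : k) : iwasawa :=
  @InvLim _ _ _ _ (fun N => gmono c 1%g) _.
Next Obligation.
by move=> c; apply/asboolP => N N' h; rewrite /= /iwasawa_tr galg_map_gmono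
  (quotg_map1 h).
Qed.

End Iwasawa.

Inductive cartan_type :=
  | TypeA of nat | TypeB of nat | TypeC of nat | TypeD of nat
  | TypeE6 | TypeE7 | TypeE8 | TypeF4 | TypeG2.

Definition rank (X : cartan_type) : nat :=
  match X with
  | TypeA l | TypeB l | TypeC l | TypeD l => l
  | TypeE6 => 6 | TypeE7 => 7 | TypeE8 => 8 | TypeF4 => 4 | TypeG2 => 2
  end.

Definition proper_type (X : cartan_type) : bool :=
  match X with
  | TypeA l => 1 <= l
  | TypeB l | TypeC l => 2 <= l
  | TypeD l => 3 <= l
  | _ => true
  end%N.

(* Edges i -- j, i < j, of the Dynkin diagram; nodes numbered as in Bourbaki,
   but from 0. *)
Definition dynkin_edge (X : cartan_type) (i j : nat) : bool :=
  match X with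
  | TypeD l => ((j == i.+1) && (j < l.-1)) || ((j == l.-1) && (i == l - 3))
  | TypeE6 | TypeE7 | TypeE8 =>
      [|| (i == 0) && (j == 2), (i == 1) && (j == 3) | (2 <= i) && (j == i.+1)]
  | _ => j == i.+1
  end%N.

(* cartan_entry X i j is alpha_j(h_i): the pairing of the simple coroot i with
   the simple root j. *)
Definition cartan_entry (X : cartan_type) (i j : nat) : int :=
  if i == j then 2 else
  if dynkin_edge X i j || dynkin_edge X j i then
    match X with
    | TypeB l => if (i == l.-1) && (j == l.-2) then -2 else -1
    | TypeC l => if (i == l.-2) && (j == l.-1) then -2 else -1
    | TypeF4 => if (i == 2%N) && (j == 1%N) then -2 else -1
    | TypeG2 => if (i == 0%N) && (j == 1%N) then -3 else -1
    | _ => -1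
    end
  else 0.

Definition cartan (X : cartan_type) : 'M[int]_(rank X) :=
  \matrix_(i, j) cartan_entry X i j.

Definition lie_bracket (n : nat) (x y : 'M[rat]_n) : 'M[rat]_n := x * y - y * x.

(* A representation on Q^n of the split semisimple Lie algebra over Q with
   Cartan matrix A, the latter given by the Chevalley generators and Serre's
   relations. *)
Record serre_rep (l : nat) (A : 'M[int]_l) (n : nat) := SerreRep {
  rep_e : 'I_l -> 'M[rat]_n;
  rep_f : 'I_l -> 'M[rat]_n;
  rep_h : 'I_l -> 'M[rat]_n;
  rep_hh : forall i j, lie_bracket (rep_h i) (rep_h j) = 0;
  rep_ef : forall i j,
    lie_bracket (rep_e i) (rep_f j) = if i == j then rep_h i else 0;
  rep_he : forall i j,
    lie_bracket (rep_h i) (rep_e j) = (A i j)%:~R *: rep_e j;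
  rep_hf : forall i j,
    lie_bracket (rep_h i) (rep_f j) = - (A i j)%:~R *: rep_f j;
  rep_ee : forall i j, i != j ->
    iter `|1 - A i j|%N (lie_bracket (rep_e i)) (rep_e j) = 0;
  rep_ff : forall i j, i != j ->
    iter `|1 - A i j|%N (lie_bracket (rep_f i)) (rep_f j) = 0 }.

Section Representation.
Variables (l : nat) (A : 'M[int]_l) (n : nat) (V : serre_rep A n).

(* lambda is recorded by its values on the simple coroots, i.e. by its
   coordinates on the fundamental weights. *)
Definition is_weight (lambda : 'rV[int]_l) : Prop :=
  exists2 v : 'cV[rat]_n, v != 0 &
    forall i, rep_h V i *m v = (lambda 0 i)%:~R *: v.

(* The weights of V generate the full weight lattice, here Z^l. *)
Definition simply_connected : Prop :=
  forall mu : 'rV[int]_l, exists (k : nat) (ws : k.-tuple 'rV[int]_l),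
    {in ws, forall lambda, is_weight lambda} /\ inIntSpan ws mu.

(* Z^n is stable under Kostant's Z-form, which is generated by the divided
   powers of the e_i and the f_i. *)
Definition admissible : Prop := forall i m,
  (m`!%:R^-1 *: rep_e V i ^+ m \is a mxOver Num.int) /\
  (m`!%:R^-1 *: rep_f V i ^+ m \is a mxOver Num.int).

Inductive in_lie_algebra : 'M[rat]_n -> Prop :=
  | lie_e i : in_lie_algebra (rep_e V i)
  | lie_f i : in_lie_algebra (rep_f V i)
  | lie_lin a x y : in_lie_algebra x -> in_lie_algebra y ->
      in_lie_algebra (a *: x + y)
  | lie_br x y : in_lie_algebra x -> in_lie_algebra y ->
      in_lie_algebra (lie_bracket x y).

Definition root_vector (x : 'M[rat]_n) : Prop :=
  in_lie_algebra x /\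
  exists2 alpha : 'rV[int]_l, alpha != 0 &
    forall i, lie_bracket (rep_h V i) x = (alpha 0 i)%:~R *: x.

(* The exponential series may stop at n because root vectors are nilpotent. *)
Definition expmx (x : 'M[rat]_n) : 'M[rat]_n :=
  \sum_(m < n) m`!%:R^-1 *: x ^+ m.

(* Chevalley's group over Q. A root subgroup is the set of the exponentials of
   the vectors of a root space. *)
Inductive elementary : 'M[rat]_n -> Prop :=
  | elementary1 : elementary 1
  | elementaryM x g : root_vector x -> elementary g ->
      elementary (expmx x * g).

Definition mx_eval (R : comNzRingType) (F : {mpoly int[n * n]})
  (g : 'M[R]_n) : R := mmap intr (fun k => mxvec g 0 k) F.

Definition vanishing (F : {mpoly int[n * n]}) : Prop :=
  forall g, elementary g -> mx_eval F g = 0.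

(* The R-points of the Zariski closure over Z of the group over Q. When V is
   admissible and simply connected, this closure is the simply connected
   Chevalley group scheme: its coordinate ring is generated over Z by the matrix
   coefficients of Z^n. The determinant is 1 on it, so it is closed in all
   n x n matrices. *)
Definition is_point (R : comNzRingType) (g : 'M[R]_n) : Prop :=
  forall F, vanishing F -> mx_eval F g = 0.

End Representation.

Arguments mx_eval {n R} F g.
Arguments is_point {l A n} V {R} g.

Section Nilpotent.

Lemma char_poly_nilp_closed (F : closedFieldType) n (x : 'M[F]_n) m :
  x ^+ m = 0 -> char_poly x = 'X^n.
Proof.
move=> xm; have [r Dr] := closed_field_poly_normal (char_poly x).
have mon := char_poly_monic x; move: Dr; rewrite (monicP mon) scale1r => Dr.
have r0 z : z \in r -> z = 0.
  move=> zr; have : root (char_poly x) z by rewrite Dr root_prod_XsubC.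
  rewrite -eigenvalue_root_char => /eigenvalueP [v vx v0].
  have vxk k : v *m (x ^+ k) = z ^+ k *: v.
    elim: k => [|k IHk]; first by rewrite !expr0 mulmx1 scale1r.
    by rewrite exprS -mulmxE mulmxA vx -scalemxAl IHk scalerA exprS.
  have := vxk m; rewrite xm mulmx0 => /esym/eqP.
  by rewrite scaler_eq0 (negPf v0) orbF expf_eq0 => /andP [_ /eqP].
have -> : char_poly x = 'X^(size r).
  rewrite Dr; elim: (r) r0 => [|z s IHs] r0; first by rewrite big_nil.
  rewrite big_cons (r0 z) ?mem_head // subr0 IHs ?exprS // => y ys.
  by apply: r0; rewrite inE ys orbT.
by have := size_char_poly x; rewrite Dr size_prod_XsubC => -[->].
Qed.

Lemma char_poly_nilp n (x : 'M[rat]_n) m : x ^+ m = 0 -> char_poly x = 'X^n.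
Proof.
move=> xm; apply: (map_poly_inj (ratr : {rmorphism rat -> algC})).
rewrite map_char_poly map_polyXn; apply: (@char_poly_nilp_closed _ _ _ m).
have mapX k : map_mx (ratr : rat -> algC) (x ^+ k) = (map_mx ratr x) ^+ k.
  elim: k => [|k IHk]; first by rewrite !expr0 map_mx1.
  by rewrite !exprS -mulmxE map_mxM IHk.
by rewrite -mapX xm map_mx0.
Qed.

Lemma nilp_dim n (x : 'M[rat]_n) m : x ^+ m = 0 -> x ^+ n = 0.
Proof.
case: n x => [|n] x xm; first by apply/matrixP => - [].
have := Cayley_Hamilton x; rewrite (char_poly_nilp xm).
by rewrite rmorphXn /= horner_mx_X.
Qed.

Lemma det_unipotent n (x : 'M[rat]_n) m : x ^+ m = 0 -> \det (1 + x) = 1.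
Proof.
move=> xm; have : (- x) ^+ m = 0 by rewrite exprNn xm mulr0.
move/char_poly_nilp/(congr1 (fun p => p.[1])); rewrite hornerXn expr1n => <-.
rewrite /char_poly -horner_evalE -det_map_mx; congr (\det _).
apply/matrixP => i j; rewrite !mxE /=.
by rewrite /horner_eval !hornerE opprK hornerMn hornerX.
Qed.

Lemma nilp_bracket n (h x : 'M[rat]_n) (c : rat) :
  c != 0 -> lie_bracket h x = c *: x -> x ^+ n = 0.
Proof.
move=> c0 hx; pose P := char_poly (lin_mulmx h - lin_mulmxr h).
case: (pselect (exists m, x ^+ m = 0)) => [[m /nilp_dim //]|nx].
have nxk k : x ^+ k != 0 by apply/eqP => xk; apply: nx; exists k.
have hxk k : lie_bracket h (x ^+ k) = (k%:R * c) *: x ^+ k.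
  elim: k => [|k IHk].
    by rewrite expr0 /lie_bracket mulr1 mul1r subrr mul0r scale0r.
  have -> : lie_bracket h (x ^+ k.+1)
            = lie_bracket h x * x ^+ k + x * lie_bracket h (x ^+ k).
    by rewrite /lie_bracket exprS mulrBl mulrBr !mulrA addrA subrK.
  rewrite hx IHk -!mulmxE -scalemxAl -scalemxAr !mulmxE -exprS -scalerDl.
  by rewrite -natr1 mulrDl mul1r addrC.
have rP k : root P (k%:R * c).
  rewrite -eigenvalue_root_char; apply/eigenvalueP.
  exists (mxvec (x ^+ k)); last by rewrite mxvec_eq0.
  by rewrite mulmxBr !mul_vec_lin -linearB -linearZ -hxk.
have P0 : P != 0 := monic_neq0 (char_poly_monic _).
have := max_poly_roots P0 (rs := [seq k%:R * c | k <- iota 0 (size P)]).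
rewrite size_map size_iota ltnn => H; exfalso.
suff: false by []. apply: H; first by apply/allP => _ /mapP [k _ ->].
rewrite map_inj_uniq ?iota_uniq // => i j /(mulIf c0)/eqP.
by rewrite eqr_nat => /eqP.
Qed.

End Nilpotent.

Section Exponential.
Variable n : nat.

Let q (s : rat) : {poly rat} := \poly_(m < n) (s ^+ m / m`!%:R).

Lemma expK : exists r, q 1 * q (-1) = (0 < n)%N%:R + r * 'X^n.
Proof.
exists (drop_poly n (q 1 * q (-1))).
rewrite -[LHS](poly_take_drop n) ; congr (_ + _).
apply/polyP => k; rewrite coef_take_poly.
case: ltnP => kn; last first.
  by case: (n) kn => [|n'] kn; rewrite ?coef0 //= coef1; case: (k) kn.
rewrite (leq_ltn_trans _ kn) // coef1 coefM.
have fk : k`!%:R != 0 :> rat by rewrite pnatr_eq0 -lt0n fact_gt0.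
apply: (mulfI fk).
transitivity ((-1 + 1 : rat) ^+ k).
  rewrite exprDn mulr_sumr; apply: eq_bigr => -[i /= ik] _.
  have ik' : (i <= k)%N by rewrite -ltnS.
  rewrite !coef_poly (leq_ltn_trans ik' kn) (leq_ltn_trans (leq_subr _ _) kn).
  rewrite !expr1n mulr1 mul1r -[in LHS](bin_fact ik') !natrM -mulr_natr.
  field.
  by rewrite !pnatr_eq0 -!lt0n !fact_gt0.
rewrite addNr; case: (k) => [|k']; first by rewrite mulr1.
by rewrite exprS mul0r mulr0.
Qed.


End Exponential.

Lemma expmxN n (x : 'M[rat]_n) : x ^+ n = 0 -> expmx x * expmx (- x) = 1.
Proof.
case: n x => [|n] x xn; first by apply/matrixP => -[].
have exE s : expmx (s *: x) = horner_mx x (\poly_(m < n.+1) (s ^+ m / m`!%:R)).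
  rewrite /expmx poly_def rmorph_sum; apply: eq_bigr => m _ /=.
  rewrite exprZn scalerA -mul_polyC rmorphM /= horner_mx_C rmorphXn /=.
  by rewrite horner_mx_X -mulmxE mul_scalar_mx mulrC.
rewrite -[x in expmx x]scale1r -scaleN1r !exE -rmorphM.
have [r ->] := expK n.+1.
by rewrite rmorphD rmorphM /= rmorph1 rmorphXn /= horner_mx_X xn mulr0 addr0.
Qed.

Lemma det_expmx n (x : 'M[rat]_n) : x ^+ n = 0 -> \det (expmx x) = 1.
Proof.
case: n x => [|n] x xn; first by rewrite det_mx00.
have -> : expmx x = 1 + x * (\sum_(m < n) m.+1`!%:R^-1 *: x ^+ m).
  rewrite /expmx big_ord_recl /= fact0 invr1 expr0 scale1r mulr_sumr.
  by congr (_ + _); apply: eq_bigr => m _; rewrite exprS -scalerAr.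
apply: (@det_unipotent _ _ n.+1); rewrite exprMn_comm ?xn ?mul0r //.
apply: commr_sum => m _; rewrite /GRing.comm -scalerAl -scalerAr.
by rewrite -exprS -exprSr.
Qed.

Section ElementaryGroup.
Variables (l : nat) (A : 'M[int]_l) (n : nat) (V : serre_rep A n).

Lemma root_vector_nilp x : root_vector V x -> x ^+ n = 0.
Proof.
move=> [_ [alpha a0 xa]].
have [i ai] : exists i, alpha 0 i != 0.
  apply: contrapT => /forallNP na; case/eqP: a0; apply/rowP => i.
  by rewrite mxE; apply: contrapT => /eqP /na.
by apply: nilp_bracket (xa i); rewrite intr_eq0.
Qed.

Lemma root_vectorN x : root_vector V x -> root_vector V (- x).
Proof.
move=> [xL [alpha a0 xa]]; split; last first.
  exists alpha => // i; rewrite scalerN -xa /lie_bracket mulrN mulNr.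
  by rewrite opprK opprB addrC.
have -> : - x = (-2) *: x + x.
  by rewrite -[X in _ + X]scale1r -scalerDl -scaleN1r; congr (_ *: _).
exact: lie_lin.
Qed.

Lemma elementary_expmx x : root_vector V x -> elementary V (expmx x).
Proof.
by move=> xr; rewrite -[expmx x]mulr1; apply: elementaryM => //; constructor.
Qed.

Lemma elementary_mul g g' : elementary V g -> elementary V g' ->
  elementary V (g * g').
Proof.
move=> gE g'E; elim: gE => [|x h xr _ IH]; first by rewrite mul1r.
by rewrite -mulrA; apply: elementaryM.
Qed.

Lemma elementary_inv g : elementary V g ->
  exists2 g', elementary V g' & g * g' = 1.
Proof.
elim=> [|x h xr _ [h' h'E hh']].
  by exists 1; rewrite ?mulr1 //; constructor.
exists (h' * expmx (- x)).
  exact/elementary_mul/elementary_expmx/root_vectorN.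
by rewrite mulrA -(mulrA _ h) hh' mulr1 expmxN // root_vector_nilp.
Qed.

Lemma elementary_det g : elementary V g -> \det g = 1.
Proof.
elim=> [|x h xr _ IH]; first exact: det1.
by rewrite det_mulmx IH mulr1 det_expmx // root_vector_nilp.
Qed.

Lemma elementary_adj g : elementary V g -> elementary V (\adj g).
Proof.
move=> gE; have [g' g'E gg'] := elementary_inv gE.
suff -> : \adj g = g' by [].
have := mul_adj_mx g; rewrite elementary_det // => /(congr1 (mulmx^~ g')).
by rewrite -mulmxA [g *m g']gg' mulmx1 mul1mx.
Qed.

End ElementaryGroup.

Section Evaluation.
Variable n : nat.
Notation poly := {mpoly int[n * n]}.

Lemma mx_evalB (R : comNzRingType) (g : 'M[R]_n) :
  zmod_morphism (fun F : poly => mx_eval F g).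
Proof. exact: (rmorphB (mmap intr (fun k => mxvec g 0 k))). Qed.

Lemma mx_evalM (R : comNzRingType) (g : 'M[R]_n) :
  monoid_morphism (fun F : poly => mx_eval F g).
Proof.
split; first exact: (rmorph1 (mmap intr (fun k => mxvec g 0 k))).
exact: (rmorphM (mmap intr (fun k => mxvec g 0 k))).
Qed.

Definition mx_ev (R : comNzRingType) (g : 'M[R]_n) (F : poly) := mx_eval F g.
HB.instance Definition _ (R : comNzRingType) (g : 'M[R]_n) :=
  GRing.isZmodMorphism.Build poly R (mx_ev g) (mx_evalB g).
HB.instance Definition _ (R : comNzRingType) (g : 'M[R]_n) :=
  GRing.isMonoidMorphism.Build poly R (mx_ev g) (mx_evalM g).

Lemma mx_evE (R : comNzRingType) (g : 'M[R]_n) F : mx_eval F g = mx_ev g F.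
Proof. by []. Qed.

Lemma rmorph_mx_eval (R S : comNzRingType) (f : {rmorphism R -> S})
    (F : poly) (g : 'M[R]_n) :
  f (mx_eval F g) = mx_eval F (map_mx f g).
Proof.
rewrite /mx_eval /mmap rmorph_sum; apply: eq_bigr => m _.
rewrite rmorphM rmorph_int; congr (_ * _).
rewrite /mmap1 rmorph_prod; apply: eq_bigr => k _.
by rewrite rmorphXn -map_mxvec mxE.
Qed.

Definition generic_mx : 'M[poly]_n := \matrix_(i, j) 'X_(mxvec_index i j).

Lemma map_generic_mx (R : comNzRingType) (g : 'M[R]_n) :
  map_mx (mx_ev g) generic_mx = g.
Proof.
by apply/matrixP => i j; rewrite !mxE /mx_ev /mx_eval mmapX mmap1U mxvecE.
Qed.

Lemma mx_eval_subst (R : comNzRingType) (g : 'M[R]_n) (F : poly) (P : 'M[poly]_n) :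
  mx_eval (mx_eval F P) g = mx_eval F (map_mx (mx_ev g) P).
Proof. by rewrite -rmorph_mx_eval. Qed.

(* F(X Y) as a sum of products of polynomials in X and polynomials in Y *)
Lemma mx_eval_mul (F : poly) : exists k (a : 'I_k -> poly) (b : 'I_k -> poly),
  forall (R : comNzRingType) (g h : 'M[R]_n),
    mx_eval F (g * h) = \sum_(i < k) mx_eval (a i) g * mx_eval (b i) h.
Proof.
pose B := {mpoly poly[n * n]}.
pose Y : 'M[B]_n := \matrix_(i, j) 'X_(mxvec_index i j).
pose Q : B := mx_eval F (map_mx (@mpolyC _ _) generic_mx * Y).
pose s := msupp Q.
exists (size s), (fun i => Q@_(tnth (in_tuple s) i)), (fun i => 'X_[tnth (in_tuple s) i]).
move=> R g h.
pose ev : {rmorphism B -> R} := mmap (mx_ev g) (fun k => mxvec h 0 k).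
transitivity (ev Q).
  rewrite rmorph_mx_eval; congr mx_eval.
  rewrite -mulmxE map_mxM mulmxE; congr (_ * _).
    rewrite -[LHS](map_generic_mx g); apply/matrixP => i j.
    by rewrite !mxE /ev /= mmapC.
  by apply/matrixP => i j; rewrite !mxE /ev /= mmapX mmap1U mxvecE.
rewrite /ev /= /mmap -/s (big_tnth _ _ s); apply: eq_bigr => i _.
by rewrite /mx_eval mmapX.
Qed.

End Evaluation.

Section SpanLemma.
Lemma span_set m (S : 'rV[rat]_m -> Prop) :
  exists k (B : 'M[rat]_(k, m)), (forall i, S (row i B)) /\
    forall v, S v -> (v <= B)%MS.
Proof.
pose P r := `[< exists k (B : 'M[rat]_(k, m)),
                (forall i, S (row i B)) /\ \rank B = r >].
have P0 : exists r, P r.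
  by exists 0; apply/asboolP; exists 0, 0; split=> [[]//|]; rewrite mxrank0.
have Pm r : P r -> (r <= m)%N.
  by move/asboolP => [k [B [_ <-]]]; exact: rank_leq_col.
case: (ex_maxnP P0 Pm) => r /asboolP [k [B [SB rB]]] max.
exists k, B; split=> // v Sv.
have : (\rank (col_mx B v) <= \rank B)%N.
  rewrite rB; apply: max; apply/asboolP; exists (k + 1)%N, (col_mx B v).
  split=> // i; case: (splitP i) => j ij.
    by have -> : i = lshift 1 j; [exact: val_inj | rewrite rowKu].
  by have -> : i = rshift k j; [exact: val_inj | rewrite rowKd row_id].
move=> le; have eqB : (B == col_mx B v)%MS.
  rewrite -(geq_leqif (mxrank_leqif_eq _)) //.
  by rewrite -addsmxE addsmxSl.
rewrite (eqmxP eqB) -addsmxE; exact: addsmxSr.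
Qed.

Lemma int_scaling k m (B : 'M[rat]_(k, m)) :
  exists2 d : rat, d != 0 & exists K : 'M[int]_(k, m), map_mx intr K = d *: B.
Proof.
pose d : int := \prod_i \prod_j denq (B i j).
have d0 : d != 0.
  by apply/prodf_neq0 => i _; apply/prodf_neq0 => j _; exact: denq_neq0.
exists d%:~R; first by rewrite intr_eq0.
exists (\matrix_(i, j) Num.floor (d%:~R * B i j)); apply/matrixP => i j.
rewrite !mxE; apply: floorK.
rewrite /d (bigD1 i) //= (bigD1 j) //= !rmorphM /=.
set z := (X in _ * X * _); set w := (X in _ * X * z * _).
have -> : (denq (B i j))%:~R * w * z * B i j = (numq (B i j))%:~R * w * z.
  by rewrite numqE; ring.
by rewrite -!rmorphM; exact: intr_int.
Qed.
End SpanLemma.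

Section Points.
Variables (l : nat) (A : 'M[int]_l) (n : nat) (V : serre_rep A n).
Notation poly := {mpoly int[n * n]}.

Lemma bilinear_vanishing k (a : 'rV[poly]_k) (b : 'cV[poly]_k) :
    (forall x y, elementary V x -> elementary V y ->
       map_mx (mx_ev x) a *m map_mx (mx_ev y) b = 0) ->
  forall (R : comNzRingType) (g h : 'M[R]_n), is_point V g -> is_point V h ->
    map_mx (mx_ev g) a *m map_mx (mx_ev h) b = 0.
Proof.
move=> ab0 R g h gP hP.
have [m [B [SB spanB]]] :=
  span_set (fun v => exists2 x, elementary V x & v = map_mx (mx_ev x) a).
have [d d0 [K KE]] := int_scaling B.
have [L Lu [U Uu [s _ Ks]]] := int_Smith_normal_form K.
set D := \matrix_(i, j) _ in Ks.
have D0 (r : 'I_m) (c : 'I_k) : (r : nat) != c -> D r c = 0 by move=> /negPf rc; rewrite mxE rc.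
clearbody D.
pose toP (M : 'M[int]_k) : 'M[poly]_k := map_mx intr M.
have evP (S : comNzRingType) (z : 'M[S]_n) M : map_mx (mx_ev z) (toP M) = map_mx intr M.
  by apply/matrixP => i j; rewrite !mxE rmorph_int.
pose a' := a *m toP (invmx U); pose b' := toP U *m b.
have -> : map_mx (mx_ev g) a *m map_mx (mx_ev h) b
        = map_mx (mx_ev g) a' *m map_mx (mx_ev h) b'.
  rewrite /a' /b' !map_mxM !evP -mulmxA [X in _ = _ *m X]mulmxA -map_mxM mulVmx //.
  by rewrite map_mx1 mul1mx.
apply/matrixP => i j; rewrite !ord1 !mxE big1 // => {i j} j _.
case: (pselect (exists i, D i j != 0)) => [[i Dij]|nD].
  rewrite [X in _ * X]mxE -mx_evE hP ?mulr0 // => y yE.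
  have Kb : map_mx intr K *m map_mx (mx_ev y) b = 0 :> 'cV[rat]_m.
    rewrite KE -scalemxAl; apply/eqP; rewrite scaler_eq0 (negPf d0) /=; apply/eqP.
    apply/row_matrixP => r; rewrite row_mul row0.
    by have [x xE ->] := SB r; apply: ab0.
  have : map_mx intr D *m map_mx (mx_ev y) b' = 0 :> 'cV[rat]_m.
    rewrite /b' map_mxM evP mulmxA -map_mxM.
    have -> : D *m U = invmx L *m K by rewrite Ks -mulmxA mulKmx.
    by rewrite map_mxM -mulmxA Kb mulmx0.
  have ij : (i : nat) = j by apply/eqP; apply: contraNT Dij => /D0 ->.
  move/matrixP/(_ i 0); rewrite !mxE (bigD1 j) //= big1 => [|j' j'j].
    rewrite addr0 !mxE => /eqP; rewrite mulf_eq0 intr_eq0 (negPf Dij).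
    by move/eqP.
  by rewrite [X in X * _]mxE D0 ?mul0r // ij eq_sym.
rewrite [X in X * _]mxE -mx_evE gP ?mul0r // => x xE.
have /submxP [c cE] : (map_mx (mx_ev x) a <= B)%MS by apply: spanB; exists x.
have : map_mx (mx_ev x) a' = (d^-1 *: c) *m map_mx intr L *m map_mx intr D.
  have Bd : B = d^-1 *: map_mx intr K by rewrite KE scalerA mulVf // scale1r.
  rewrite /a' map_mxM evP cE Bd Ks -scalemxAr -!scalemxAl !map_mxM -!mulmxA.
  by rewrite -[map_mx _ U *m _]map_mxM mulmxV // map_mx1 mulmx1.
move/matrixP/(_ 0 j); rewrite [LHS]mxE mx_evE => ->; rewrite mxE big1 // => i _.
rewrite [X in _ * X]mxE; case: (eqVneq (D i j) 0) => [->|Dij].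
  by rewrite mulr0.
by case: nD; exists i.
Qed.

Section Group.
Variable R : comNzRingType.
Implicit Types g h : 'M[R]_n.

Lemma is_point1 : is_point V (1 : 'M[R]_n).
Proof.
move=> F /(_ _ (elementary1 V)).
have E (S : comNzRingType) : mx_eval F (1 : 'M[S]_n) = (mx_eval F (1 : 'M[int]_n))%:~R.
  by rewrite (rmorph_mx_eval (intmul 1)) map_mx1.
by rewrite (E rat) (E R) => /eqP; rewrite intr_eq0 => /eqP ->.
Qed.

Lemma is_pointM g h : is_point V g -> is_point V h -> is_point V (g * h).
Proof.
move=> gP hP F F0; have [k [a [b E]]] := mx_eval_mul F.
pose ra : 'rV[poly]_k := \row_i a i; pose cb : 'cV[poly]_k := \col_i b i.
have E' (S : comNzRingType) (x y : 'M[S]_n) :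
    map_mx (mx_ev x) ra *m map_mx (mx_ev y) cb = (mx_eval F (x * y))%:M.
  apply/matrixP => i j; rewrite !ord1 !mxE eqxx mulr1n E.
  by apply: eq_bigr => r _; rewrite !mxE.
have H x y : elementary V x -> elementary V y ->
    map_mx (mx_ev x) ra *m map_mx (mx_ev y) cb = 0.
  by move=> xE yE; rewrite E' F0 ?raddf0 //; exact: elementary_mul.
have := bilinear_vanishing H gP hP; rewrite E' => /matrixP/(_ 0 0).
by rewrite !mxE eqxx.
Qed.

Lemma is_point_det g : is_point V g -> \det g = 1.
Proof.
have E (S : comNzRingType) (x : 'M[S]_n) :
    mx_eval (\det (generic_mx n) - 1) x = \det x - 1.
  by rewrite mx_evE rmorphB rmorph1 -det_map_mx map_generic_mx.
move=> /(_ (\det (generic_mx n) - 1)); rewrite E => H; apply/eqP.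
rewrite -subr_eq0; apply/eqP/H => x xE.
by rewrite E (elementary_det xE) subrr.
Qed.

Lemma is_point_adj g : is_point V g -> is_point V (\adj g).
Proof.
have E (S : comNzRingType) (x : 'M[S]_n) F :
    mx_eval (mx_eval F (\adj (generic_mx n))) x = mx_eval F (\adj x).
  by rewrite mx_eval_subst map_mx_adj map_generic_mx.
move=> gP F F0; rewrite -E; apply: gP => x xE; rewrite E; apply: F0.
exact: elementary_adj.
Qed.

Record chevalley_point := ChevalleyPoint {
  point_mx :> 'M[R]_n;
  _ : `[< is_point V point_mx >] }.

HB.instance Definition _ := [isSub for point_mx].
HB.instance Definition _ := [Choice of chevalley_point by <:].

Lemma pointP (g : chevalley_point) : is_point V g.
Proof. by case: g => g /= /asboolP. Qed.

Definition point_one := ChevalleyPoint (asboolT is_point1).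
Definition point_mul (g h : chevalley_point) :=
  ChevalleyPoint (asboolT (is_pointM (pointP g) (pointP h))).
Definition point_inv (g : chevalley_point) :=
  ChevalleyPoint (asboolT (is_point_adj (pointP g))).

Lemma point_mulA : associative point_mul.
Proof. by move=> g h k; apply: val_inj; rewrite /= mulrA. Qed.
Lemma point_mul1 : left_id point_one point_mul.
Proof. by move=> g; apply: val_inj; rewrite /= mul1r. Qed.
Lemma point_1mul : right_id point_one point_mul.
Proof. by move=> g; apply: val_inj; rewrite /= mulr1. Qed.
Lemma point_mulV : left_inverse point_one point_inv point_mul.
Proof.
move=> g; apply: val_inj; rewrite /= -mulmxE mul_adj_mx.
by rewrite (is_point_det (pointP g)).
Qed.
Lemma point_Vmul : right_inverse point_one point_inv point_mul.
Proof.
move=> g; apply: val_inj; rewrite /= -mulmxE mul_mx_adj.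
by rewrite (is_point_det (pointP g)).
Qed.

HB.instance Definition _ := isGroup.Build chevalley_point
  point_mulA point_mul1 point_1mul point_mulV point_Vmul.

End Group.

Section Functoriality.
Variables (R S : comNzRingType) (f : {rmorphism R -> S}).

Lemma is_point_map (g : 'M[R]_n) : is_point V g -> is_point V (map_mx f g).
Proof. by move=> gP F /gP F0; rewrite -rmorph_mx_eval F0 rmorph0. Qed.

Definition point_map (g : chevalley_point R) : chevalley_point S :=
  ChevalleyPoint (asboolT (is_point_map (pointP g))).

Lemma point_map1 : point_map 1%g = 1%g.
Proof. by apply: val_inj; rewrite /= map_mx1. Qed.

Lemma point_mapM : {morph point_map : g h / (g * h)%g}.
Proof. by move=> g h; apply: val_inj; rewrite /= -!mulmxE map_mxM. Qed.

HB.instance Definition _ := isMultiplicative.Build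
  (chevalley_point R) (chevalley_point S) point_map point_mapM.
HB.instance Definition _ := Multiplicative_isUMagmaMorphism.Build
  (chevalley_point R) (chevalley_point S) point_map point_map1.

End Functoriality.
End Points.

Record sc_chevalley_group (X : cartan_type) := ScChevalleyGroup {
  chev_dim : nat;
  chev_rep : serre_rep (cartan X) chev_dim;
  chev_admissible : admissible chev_rep;
  chev_simply_connected : simply_connected chev_rep }.

Section CongruenceKernel.
Variables (X : cartan_type) (G : sc_chevalley_group X) (p : nat).

Definition in_congruence_kernel :
    pred (chevalley_point (chev_rep G) (padic_int p)) :=
  fun g => point_map (@padic_modp p) g == 1%g.

Record congruence_kernel := CongruenceKernel {
  ck_val :> chevalley_point (chev_rep G) (padic_int p);
  _ : in_congruence_kernel ck_val }.

HB.instance Definition _ := [isSub for ck_val].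
HB.instance Definition _ := [Choice of congruence_kernel by <:].

Lemma in_congruence_kernel_closed : group_closed in_congruence_kernel.
Proof.
split; first by rewrite unfold_in /in_congruence_kernel gmulf1.
move=> g h; rewrite !unfold_in /in_congruence_kernel => /eqP g1 /eqP h1.
suff -> : point_map (@padic_modp p) (g / h)%g =
  (point_map (@padic_modp p) g / point_map (@padic_modp p) h)%g
  by rewrite g1 h1 divg1.
exact: (gmulfF (point_map (@padic_modp p))).
Qed.

HB.instance Definition _ := SubChoice_isSubGroup.Build _ _ congruence_kernel
  in_congruence_kernel_closed.

Definition ck_mx (g : congruence_kernel) : 'M[padic_int p]_(chev_dim G) := g.
HB.instance Definition _ :=
  Topological.copy congruence_kernel (initial_topology ck_mx).

End CongruenceKernel.

(* Main.v *)
(* A central element r has components r_N in F_p[G(1)/N] that are constant on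
   conjugacy classes. Let K_j <= N and K_m be congruence subgroups with m large.
   The coefficient of r_N at y is the sum of the coefficients of its lift modulo
   K_m over the fibre of y, and the p-group K_j / K_m acts by conjugation on that
   fibre, so only the fixed points count modulo p. They are the classes of the z
   commuting with K_j modulo p^(m+1), and such a z lies in K_j if m is large; so
   there are none when y <> 1, and r is scalar.

   The last claim is quantitative. The integral polynomials vanishing, up to
   integral multiples, at level m on the points commuting with K_j at level m
   generate an ideal of Q[x_ij]; over the quotient the generic matrix z is a point
   of the group commuting with all e_i and f_i. It is enough to show z^(n!) = 1
   there: after clearing denominators this bounds z^(n!) - 1, hence z - 1 since
   p >= 3 and z = 1 mod p.

   To see that z^(n!) = 1, choose a weight basis, ordered by the values of a
   coweight positive on the simple roots. Then z respects the heights, and the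
   minor of a point on the rows {height > k} + a and the columns {height > k} + b,
   a <> b of height k, is a highest weight vector in the coordinate ring which
   vanishes at 1; by the triangular decomposition of the enveloping algebra it
   vanishes on the group. So z is diagonal. Its eigenvalues are constant on the
   components of the graph of the e_i and f_i, on which it has determinant 1. *)
From HB Require Import structures.
From mathcomp Require Import -(notations) monalg.
From mathcomp Require Import mpoly.
From mathcomp Require Import all_boot all_order all_algebra all_fingroup all_solvable finmap.
From mathcomp Require Import mathcomp_extra boolp classical_sets topology.
From mathcomp Require Import ring zify.
Require Import Defs.

Set Implicit Arguments.
Unset Strict Implicit.
Unset Printing Implicit Defensive.

Import Order.TTheory GRing.Theory Num.Theory.
Local Open Scope ring_scope.

(** * Representations of sl2 *)

Lemma mulmxnAl (R : pzRingType) m n p (A : 'M[R]_(m, n)) (B : 'M_(n, p)) k :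
  (A *+ k) *m B = (A *m B) *+ k.
Proof. exact: (raddfMn (mulmxr B)). Qed.

Lemma mulmxnAr (R : pzRingType) m n p (A : 'M[R]_(m, n)) (B : 'M_(n, p)) k :
  A *m (B *+ k) = (A *m B) *+ k.
Proof. exact: (raddfMn (mulmx A)). Qed.

Lemma mulmxM (R : pzRingType) m n (v : 'M[R]_(m, n)) (A B : 'M_n) :
  v *m (A * B) = v *m A *m B.
Proof. exact: mulmxA. Qed.

Section Semisimple.
Variables (F : fieldType) (n : nat) (H : 'M[F]_n.+1).

Lemma horner_XsubC c : horner_mx H ('X - c%:P) = H - c%:M.
Proof. by rewrite rmorphB /= horner_mx_X horner_mx_C. Qed.

Hypothesis ss : forall (v : 'rV[F]_n.+1) c,
  v *m (H - c%:M) *m (H - c%:M) = 0 -> v *m (H - c%:M) = 0.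

Lemma semisimple_undup rs (q : {poly F}) :
  horner_mx H (q * \prod_(r <- rs) ('X - r%:P)) = 0 ->
  horner_mx H (q * \prod_(r <- undup rs) ('X - r%:P)) = 0.
Proof.
elim: rs q => [|r rs IH] q //=; rewrite big_cons.
case: ifP => rin; last by rewrite big_cons !mulrA; apply: IH.
rewrite (big_rem r rin) /= => Hq; apply: IH; rewrite (big_rem r rin) /=.
move: Hq; set P := \prod_(_ <- _) _.
have -> : q * (('X - r%:P) * (('X - r%:P) * P))
  = (q * P) * ('X - r%:P) * ('X - r%:P) by ring.
have -> : q * (('X - r%:P) * P) = (q * P) * ('X - r%:P) by ring.
rewrite !rmorphM /= horner_XsubC -!mulmxE => Hq.
by apply/row_matrixP => i; rewrite row_mul row0; apply: ss; rewrite -!row_mul Hq row0.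
Qed.

Lemma semisimple_diagonalizable rs :
  horner_mx H (\prod_(r <- rs) ('X - r%:P)) = 0 -> diagonalizable H.
Proof.
move=> Hrs; apply/diagonalizableP; exists (undup rs); first exact: undup_uniq.
apply: mxminpoly_min; rewrite -[X in horner_mx _ X]mul1r.
by apply: semisimple_undup; rewrite mul1r.
Qed.
End Semisimple.

(* Row vectors are acted on from the right, so E raises and F lowers weights:
   v H = c v implies (v E) H = (c + 2) (v E). *)
Section Sl2.
Variables (n : nat) (E F H : 'M[rat]_n.+1).
Hypothesis FE : F * E = E * F + H.
Hypothesis EH : E * H = H * E + E *+ 2.
Hypothesis FH : F * H = H * F - F *+ 2.
Hypothesis En : E ^+ n.+1 = 0.
Hypothesis Fn : F ^+ n.+1 = 0.

Lemma sl2_expE_H k : E ^+ k * H = H * E ^+ k + E ^+ k *+ (2 * k).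
Proof.
elim: k => [|k IH]; first by rewrite !expr0 mul1r mulr1 mulr0n addr0.
rewrite exprSr -mulrA EH mulrDr mulrA IH mulrDl -mulrA -exprSr.
rewrite mulrnAr mulrnAl -exprSr -addrA -mulrnDr; congr (_ + _ *+ _); lia.
Qed.

Lemma sl2_F_expE m :
  F * E ^+ m.+1 = E ^+ m.+1 * F + ((H + m%:R) * E ^+ m) *+ m.+1.
Proof.
elim: m => [|m IH]; first by rewrite !expr1 expr0 mulr1 addr0 FE.
rewrite exprSr mulrA IH mulrDl -mulrA FE mulrDr mulrA -exprSr -addrA.
congr (_ + _); rewrite sl2_expE_H mulrnAl -mulrA -exprSr !mulrDl !mulr_natl.
rewrite !mulrnDl -!mulrnA addrACA -mulrS -mulrnDr; congr (_ + _ *+ _); nia.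
Qed.

Lemma sl2_poly_F p : horner_mx H p * F = F * horner_mx H (p \Po ('X + 2%:P)).
Proof.
have HF : H * F = F * (H + 2%:M).
  by rewrite -scalemx1 scaler_nat mulrDr FH mulr_natr addrNK.
have: horner_mx H ('X + 2%:P) = H + 2%:M.
  by rewrite rmorphD /= horner_mx_X horner_mx_C.
move: ('X + 2%:P) => q Hq.
elim/poly_ind: p => [|p c IH]; first by rewrite comp_poly0 !rmorph0 mul0r mulr0.
rewrite comp_poly_MXaddC !rmorphD !rmorphM /= !horner_mx_X !horner_mx_C Hq.
rewrite mulrDr mulrDl -mulrA HF [X in _ = X + _]mulrA -IH -mulrA.
by congr (_ + _); rewrite -!mulmxE scalar_mxC.
Qed.

(** Induction lowers the power of [E], starting from [En]. If [P] in [H] kills [E ^+ k.+1], multiply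
    the commutation formula for [F * E ^+ k.+1] by [P * P2], where [P2] is [P] shifted so that it
    becomes [P] after passing [F]. Two terms vanish and [P * P2 * ('X + k)] kills [E ^+ k]. *)
Lemma sl2_annihilator m : (m <= n.+1)%N ->
  exists rs, horner_mx H (\prod_(r <- rs) ('X - r%:P)) * E ^+ (n.+1 - m) = 0.
Proof.
elim: m => [|m IH] mn; first by exists [::]; rewrite subn0 En mulr0.
have [rs Hrs] := IH (ltnW mn); set k := (n.+1 - m.+1)%N.
have kS : (n.+1 - m = k.+1)%N by rewrite /k; lia.
rewrite kS in Hrs; set P := \prod_(_ <- _) _ in Hrs.
pose P2 := \prod_(r <- rs) ('X - (r + 2)%:P) : {poly rat}.
have P2E : P2 \Po ('X + 2%:P) = P.
  rewrite /P2 /P rmorph_prod; apply: eq_bigr => r _ /=.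
  by rewrite comp_polyB comp_polyX comp_polyC -addrA -polyCB [r + 2]addrC opprD addrA subrr
    add0r polyCN.
exists (- k%:R :: rs ++ [seq r + 2 | r <- rs]).
rewrite big_cons big_cat /= big_map -/P -/P2.
have H1 : horner_mx H (P * P2) * E ^+ k.+1 = 0.
  by rewrite mulrC rmorphM /= -mulrA Hrs mulr0.
have H2 : horner_mx H ((P * P2) \Po ('X + 2%:P)) * E ^+ k.+1 = 0.
  by rewrite rmorphM /= P2E rmorphM /= -mulrA Hrs mulr0.
have := congr1 (fun x => horner_mx H (P * P2) * x) (sl2_F_expE k).
rewrite /= mulrDr [X in X = _]mulrA sl2_poly_F -[X in X = _]mulrA H2 mulr0.
rewrite [X in _ = X + _]mulrA H1 mul0r add0r => /esym/eqP.
rewrite mulrnAr -scaler_nat scaler_eq0 pnatr_eq0 /= => /eqP.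
move=> HP; rewrite [_ * (P * P2)]mulrC [X in X * _]rmorphM /= horner_XsubC -mulrA.
by rewrite raddfN opprK /= -scalemx1 scaler_nat.
Qed.

Lemma sl2_expF_H k : F ^+ k * H = H * F ^+ k - F ^+ k *+ (2 * k).
Proof.
elim: k => [|k IH]; first by rewrite !expr0 mul1r mulr1 subr0.
rewrite exprSr -mulrA FH mulrBr [F ^+ k * (H * F)]mulrA IH mulrBl -mulrA.
by rewrite mulrnAl mulrnAr -exprSr -addrA -opprD -mulrnDr; congr (_ - _ *+ _); lia.
Qed.

Lemma sl2_expF_E k (v : 'rV_n.+1) : v *m E = 0 ->
  v *m (F ^+ k.+1 * E) = v *m ((H - k%:R) * F ^+ k) *+ k.+1.
Proof.
move=> vE; elim: k => [|k IH].
  by rewrite expr1 subr0 expr0 mulr1 FE mulmxDr -mulmxE mulmxA vE mul0mx add0r.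
rewrite exprSr -mulrA FE mulrDr mulrA mulmxDr -[in X in X + _]mulmxE mulmxA.
rewrite mulmxE IH sl2_expF_H mulmxnAl -mulmxA mulmxE -mulrA -exprSr.
rewrite !mulrBl !mulr_natl -!mulmxnAr -mulmxDr; congr (_ *m _).
rewrite !mulrnBl -!mulrnA addrACA -opprD -mulrSr -mulrnDr.
by congr (_ - _ *+ _); nia.
Qed.

Lemma sl2_highest k (v : 'rV_n.+1) : v *m E = 0 ->
  v *m (F ^+ k * E ^+ k) =
  v *m horner_mx H (\prod_(j < k) ('X - j%:R%:P)) *+ k`!.
Proof.
elim: k v => [|k IH] v vE.
  by rewrite !expr0 mul1r big_ord0 rmorph1.
rewrite [E ^+ _]exprS mulrA mulmxM sl2_expF_E //.
rewrite mulmxnAl mulmxM -mulmxA mulmxE IH; last first.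
  rewrite -mulmxM mulrBl mulr_natl -[H * E](addrK (E *+ 2)) -EH.
  by rewrite -addrA -opprD -mulrnDr mulmxBr mulmxM mulmxnAr vE mul0mx mul0rn subr0.
rewrite big_ord_recr /= [_ * ('X - _)]mulrC rmorphM /= horner_XsubC -mulrnA factS mulnC.
by rewrite mulmxM -scalemx1 scaler_nat.
Qed.

(** As [F ^+ n.+1 = 0], [sl2_highest] shows that [v] is killed by the polynomial [P] in [H] with the
    simple roots 0, ..., n. On the eigenvector [v *m (H - c%:M)] a polynomial in [H] acts by its
    value at [c]. Use [P] if [c] is not a root, and [P / ('X - c)] otherwise. *)
Lemma sl2_highest_semisimple (v : 'rV_n.+1) c : v *m E = 0 ->
  v *m (H - c%:M) *m (H - c%:M) = 0 -> v *m (H - c%:M) = 0.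
Proof.
move=> vE vHH; pose P := \prod_(j < n.+1) ('X - j%:R%:P) : {poly rat}.
have vP : v *m horner_mx H P = 0.
  have := sl2_highest n.+1 vE; rewrite Fn mul0r mulmx0 => /esym/eqP.
  by rewrite -scaler_nat scaler_eq0 pnatr_eq0 eqn0Ngt fact_gt0 /= => /eqP.
have vHc : v *m (H - c%:M) *m H = c *: (v *m (H - c%:M)).
  by rewrite -[X in _ *m X = _](subrK c%:M) mulmxDr vHH add0r mul_mx_scalar.
have hw (q : {poly rat}) : v *m (H - c%:M) *m horner_mx H q = q.[c] *: (v *m (H - c%:M)).
  elim/poly_ind: q => [|q a IH]; first by rewrite rmorph0 mulmx0 horner0 scale0r.
  rewrite rmorphD rmorphM /= horner_mx_X horner_mx_C mulmxDr mulmxM IH.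
  by rewrite -scalemxAl vHc mul_mx_scalar scalerA -scalerDl !hornerE.
have [Pc|/eqP Pc] := eqVneq P.[c] 0; last first.
  have := hw P; rewrite -mulmxM -horner_XsubC -rmorphM mulrC rmorphM mulmxM vP mul0mx.
  by move/esym/eqP; rewrite scaler_eq0 (negPf (introN eqP Pc)) /= => /eqP.
move: Pc; rewrite horner_prod => /eqP/prodf_eq0 [j _].
rewrite !hornerE subr_eq0 => /eqP cj.
pose Q := \prod_(i < n.+1 | i != j) ('X - i%:R%:P) : {poly rat}.
have PQ : P = ('X - c%:P) * Q by rewrite /P (bigD1 j) //= cj.
have := hw Q; rewrite -mulmxM -horner_XsubC -rmorphM -PQ vP => /esym/eqP.
rewrite scaler_eq0 => /orP[|/eqP //]; rewrite horner_prod => /prodf_eq0 [i ij].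
by rewrite !hornerE cj subr_eq0 eqr_nat => /eqP/val_inj ji; rewrite ji eqxx in ij.
Qed.

(** The weight is a root of the same product, so it is one of 0, ..., n. *)
Lemma sl2_highest_weight (v : 'rV_n.+1) c : v != 0 -> v *m E = 0 ->
  v *m H = c *: v -> 0 <= c.
Proof.
move=> v0 vE vH; pose P := \prod_(j < n.+1) ('X - j%:R%:P) : {poly rat}.
have hw (q : {poly rat}) : v *m horner_mx H q = q.[c] *: v.
  elim/poly_ind: q => [|q a IH]; first by rewrite rmorph0 mulmx0 horner0 scale0r.
  rewrite rmorphD rmorphM /= horner_mx_X horner_mx_C mulmxDr mulmxM IH.
  by rewrite -scalemxAl vH mul_mx_scalar scalerA -scalerDl !hornerE.
have := sl2_highest n.+1 vE; rewrite Fn mul0r mulmx0 hw => /esym/eqP.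
rewrite -scaler_nat !scaler_eq0 pnatr_eq0 eqn0Ngt fact_gt0 (negPf v0) orbF /=.
rewrite horner_prod => /prodf_eq0 [j _]; rewrite !hornerE subr_eq0 => /eqP ->.
exact: ler0n.
Qed.

(** Applied to [u], the commutation formula for [F * E ^+ m.+1] leaves the nonzero multiple (m +
    1)(c + m) of [u *m E ^+ m] once [u *m E ^+ m.+1 = 0]. Descend from [E ^+ n.+1 = 0]. *)
Lemma sl2_raise_lower (u : 'rV_n.+1) c : 0 < c ->
  u *m H = c *: u -> u *m F *m E = 0 -> u = 0.
Proof.
move=> c0 uH uFE.
have P m : u *m E ^+ m.+1 = 0 -> u *m E ^+ m = 0.
  move=> uEm; have := congr1 (mulmx u) (sl2_F_expE m).
  rewrite mulmxDr mulmxnAr {1}exprS !mulmxM uFE mul0mx uEm mul0mx add0r.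
  rewrite mulmxDr uH mulmxnAr mulmx1 -[u *+ m]scaler_nat -scalerDl -scalemxAl.
  move/esym/eqP; rewrite -scaler_nat !scaler_eq0 pnatr_eq0 /= paddr_eq0 ?ler0n ?(ltW c0) //.
  by rewrite (gt_eqF c0) /= => /eqP.
have Q k : u *m E ^+ (n.+1 - k) = 0.
  elim: k => [|k IH]; first by rewrite subn0 En mulmx0.
  have [kn|kn] := ltnP k n.+1; last by rewrite (_ : n.+1 - k.+1 = n.+1 - k)%N //; lia.
  by apply: P; rewrite (_ : (n.+1 - k.+1).+1 = n.+1 - k)%N //; lia.
by have := Q n.+1; rewrite subnn expr0 mulmx1.
Qed.

(** The case of a highest weight vector is known. In general, a power of [E] moves [v] to [v1], for
    which [v1 *m (H - a%:M)] is a nonzero highest weight vector. Then [v1 *m E] has weight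
    [a + 2 > 0], and [F * E] is bijective on that weight space, so a vector [y *m F] of weight [a]
    can be subtracted from [v1] to obtain a vector killed by [E], without changing its image under
    [H - a%:M]. *)
Lemma sl2_semisimple (v : 'rV_n.+1) c :
  v *m (H - c%:M) *m (H - c%:M) = 0 -> v *m (H - c%:M) = 0.
Proof.
move=> vHH; apply/eqP/negPn/negP => w0.
have EHc k : (H - c%:M) * E ^+ k = E ^+ k * (H - (c + (2 * k)%:R)%:M).
  rewrite mulrBl mulrBr sl2_expE_H -!mulmxE mul_scalar_mx mul_mx_scalar scalerDl.
  by rewrite scaler_nat opprD addrACA addrA addrK.
have [m wm] : exists m, (v *m (H - c%:M) *m E ^+ m != 0)
                     && (v *m (H - c%:M) *m E ^+ m.+1 == 0).
  case: (ex_minnP (P := fun m => v *m (H - c%:M) *m E ^+ m == 0)).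
    by exists n.+1; rewrite En mulmx0.
  case=> [|m] wm min; first by rewrite expr0 mulmx1 (negPf w0) in wm.
  exists m; rewrite wm andbT; apply/negP => /min; by rewrite ltnn.
case/andP: wm => w1 /eqP w2.
move: (c + (2 * m)%:R) (EHc m) => {EHc} a EHa; move: w1 w2.
rewrite exprSr mulmxM -[v *m _ *m E ^+ m]mulmxM EHa mulmxM.
set v1 := v *m E ^+ m => w1 w1E.
have v1Ha (u : 'rV_n.+1) : u *m E ^+ m *m (H - a%:M) = u *m (H - c%:M) *m E ^+ m.
  by rewrite -[RHS]mulmxM EHa mulmxM.
have v1HH : v1 *m (H - a%:M) *m (H - a%:M) = 0 by rewrite !v1Ha vHH mul0mx.
have v1H : v1 *m (H - a%:M) *m H = a *: (v1 *m (H - a%:M)).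
  by rewrite -[X in _ *m X = _](subrK a%:M) mulmxDr v1HH add0r mul_mx_scalar.
have a0 : 0 <= a := sl2_highest_weight w1 w1E v1H.
have HaE : (H - a%:M) * E = E * (H - (a + 2)%:M).
  rewrite mulrBl mulrBr EH -!mulmxE mul_scalar_mx mul_mx_scalar scalerDl scaler_nat.
  by rewrite opprD addrACA addrA addrK.
set U := eigenspace H (a + 2).
have vU : (v1 *m E <= U)%MS.
  apply/eigenspaceP/eqP; rewrite -subr_eq0 -mul_mx_scalar -mulmxBr -mulmxM -HaE.
  by rewrite mulmxM w1E.
have UH (u : 'rV_n.+1) : (u <= U)%MS -> u *m H = (a + 2) *: u by move/eigenspaceP.
have UFE : (U *m (F * E) <= U)%MS.
  have FEH : F * E * H = H * (F * E).
    by rewrite -mulrA EH mulrDr mulrA FH mulrBl mulrnAl mulrnAr subrK mulrA.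
  have /eigenspaceP UH' : (U <= eigenspace H (a + 2))%MS by [].
  by apply/eigenspaceP; rewrite -mulmxM FEH mulmxM UH' -scalemxAl.
have rk : \rank (U *m (F * E)) = \rank U.
  apply/mxrank_injP/rowV0P => u; rewrite sub_capmx => /andP [/UH uH /sub_kermxP].
  rewrite mulmxM; apply: sl2_raise_lower uH.
  by apply: ltr_wpDl.
have eqU : (U *m (F * E) == U)%MS by rewrite -(geq_leqif (mxrank_leqif_eq UFE)) rk.
move: vU; rewrite -(eqmxP eqU) => /submxP [d]; rewrite mulmxA; set y := d *m U => yE.
have yH : y *m H = (a + 2) *: y by apply: UH; exact: submxMl.
have yF : y *m F *m (H - a%:M) = 0.
  rewrite mulmxBr mul_mx_scalar -mulmxM FH mulmxBr mulmxM yH -scalemxAl scalerDl.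
  by rewrite mulmxnAr scaler_nat addrK subrr.
case/negP: w1; apply/eqP.
have v2E : (v1 - y *m F) *m E = 0 by rewrite mulmxBl yE mulmxM subrr.
have := sl2_highest_semisimple (c := a) v2E.
rewrite mulmxBl yF subr0 v1HH; exact.
Qed.

Theorem sl2_diagonalizable : diagonalizable H.
Proof.
have [rs] := sl2_annihilator (leqnn _); rewrite subnn expr0 mulr1.
exact/semisimple_diagonalizable/sl2_semisimple.
Qed.
End Sl2.

(** * A coweight positive on the simple roots *)

Lemma sum_ord_delta l (D : nat -> int) k :
  \sum_(i < l) D i * (i == k :> nat)%:R = if (k < l)%N then D k else 0.
Proof.
rewrite -(big_ord1_eq +%R D) [RHS]big_mkcond /=; apply: eq_bigr => i _.
by case: eqP; rewrite ?mulr1 ?mulr0.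
Qed.

(** In the infinite families a column meets the diagonal, its two neighbours and at most one further
    node [k], needed at the fork of type D. For [j = 0] one has [j.-1 = j], and [a] is taken to be
    0. *)
Lemma cartan_column_gt0 l (D : nat -> int) (E : nat -> nat -> int) j
    (a b c : int) (k : nat) : (j < l)%N -> (k < l)%N ->
  (forall i, (i < l)%N -> E i j = (i == j)%:R * 2 - (i == j.-1)%:R * a
    - (i == j.+1)%:R * b - (i == k)%:R * c) ->
  0 < D j * 2 - D j.-1 * a - (if (j.+1 < l)%N then D j.+1 else 0) * b - D k * c ->
  0 < \sum_(i < l) D i * E i j.
Proof.
move=> jl kl EE pos.
rewrite (eq_bigr (fun i : 'I_l => D i * (i == j :> nat)%:R * 2
    - D i * (i == j.-1 :> nat)%:R * a - D i * (i == j.+1 :> nat)%:R * b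
    - D i * (i == k :> nat)%:R * c)) => [|i _].
  by rewrite !sumrB -!mulr_suml !sum_ord_delta jl kl (leq_ltn_trans (leq_pred j) jl).
by rewrite EE // !mulrBr !mulrA.
Qed.

Lemma cartan_height X : proper_type X -> exists d : 'I_(rank X) -> int,
  forall j, 0 < \sum_i d i * cartan X i j.
Proof.
move=> Xp.
suff [D HD] : exists D : nat -> int, forall j : nat,
    (j < rank X)%N -> 0 < \sum_(i < rank X) D i * cartan_entry X i j.
  exists (fun i => D i) => j; rewrite (eq_bigr (fun i : 'I__ => D i * cartan_entry X i j)).
    exact: HD.
  by move=> i _; rewrite mxE.
(* The coefficients are those of the sum of the positive coroots in types A, E and F4 and of twice
   this sum in type B; types C, D and G2 use other coefficients with positive column sums. *)
case: X Xp => [l|l|l|l|||||] /= Xp.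
- pose D (i : nat) : int := i.+1%:Z * (l%:Z - i%:Z); exists D => j jl.
  apply: (@cartan_column_gt0 l D (cartan_entry (TypeA l)) j (0 < j)%N%:R 1 0 0) => // [|].
    move=> i il; rewrite /cartan_entry /dynkin_edge.
    by do 5?case: eqP => //=; case: (posnP j) => //=; lia.
  rewrite /D; have -> : (if (j.+1 < l)%N then j.+2%:Z * (l%:Z - j.+1%:Z) else 0)
            = j.+2%:Z * (l%:Z - j.+1%:Z).
    by case: ltnP => // jl'; rewrite (_ : l = j.+1) ?subrr ?mulr0; lia.
  by case: j jl => [|j] jl /=; nia.
- case: l Xp => [|[|m]] // _.
  pose D (i : nat) : int := if i == m.+1 then m.+2%:Z * m.+3%:Z
    else 2 * i.+1%:Z * (2 * m.+2%:Z - i%:Z); exists D.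
  move=> j jl; apply: (@cartan_column_gt0 m.+2 D (cartan_entry (TypeB m.+2)) j (0 < j)%N%:R
    (if j == m then 2 else 1) 0 0) => // [|].
    move=> i il; rewrite /cartan_entry /dynkin_edge /=.
    by do 7?case: eqP => //=; case: (posnP j) => //=; lia.
  rewrite mulr0 subr0 /D; case: (ltngtP j m) => jm.
  + have -> : (j == m.+1) = false by lia.
    have -> : (j.-1 == m.+1) = false by lia.
    have -> : (j.+1 == m.+1) = false by lia.
    have -> : (j.+1 < m.+2)%N by lia.
    by case: j jl jm => [|j] jl jm /=; nia.
  + have -> : j = m.+1 by lia.
    by rewrite eqxx ltnn (_ : (m.+1.-1 == m.+1) = false) /=; [nia | lia].
  + rewrite jm eqxx ltnSn (_ : (m == m.+1) = false); last by lia.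
    rewrite (_ : (m.-1 == m.+1) = false); last by lia.
    by by case: (m) => [|m'] /=; nia.
- case: l Xp => [|[|m]] // _.
  pose D (i : nat) : int := i.+1%:Z * (2 * m.+2%:Z - i%:Z); exists D.
  move=> j jl; apply: (@cartan_column_gt0 m.+2 D (cartan_entry (TypeC m.+2)) j
    ((0 < j)%N%:R * (if j == m.+1 then 2 else 1)) 1 0 0) => // [|].
    move=> i il; rewrite /cartan_entry /dynkin_edge /=.
    by do 7?case: eqP => //=; case: (posnP j) => //=; lia.
  rewrite mulr0 subr0 /D; case: (ltngtP j m.+1) => jm; last 2 first.
  + lia.
  + by rewrite jm ltnn /=; nia.
  rewrite ltnS jm.
  by case: j jl jm => [|j] jl jm /=; nia.
- case: l Xp => [|[|[|m]]] // _.
  pose D (i : nat) : int := if (i <= m)%N then 2 * i.+1%:Z * (2 * m.+3%:Z - i%:Z)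
    else m.+2%:Z * (m%:Z + 5); exists D.
  move=> j jl; apply: (@cartan_column_gt0 m.+3 D (cartan_entry (TypeD m.+3)) j
    ((0 < j) && (j < m.+2))%N%:R (j <= m)%N%:R ((j == m) || (j == m.+2))%:R
    (if j == m then m.+2 else m)) => // [||].
  + by case: ifP => _; lia.
  + move=> i il; rewrite /cartan_entry /dynkin_edge /= subSS subSS subSS subn0.
    by do 9?case: eqP => //=; do 2?case: ltnP => //=; case: (posnP j) => //=; lia.
  rewrite /D; case: (ltngtP j m) => jm.
  + have -> : (j == m.+2) = false by lia.
    have -> : (j < m.+2)%N by lia.
    have -> : (j.-1 <= m)%N by lia.
    have -> : (j.+1 < m.+3)%N by lia.
    rewrite mulr0 subr0.
    by case: j jl jm => [|j] jl jm /=; nia.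
  + have [-> |->] : j = m.+1 \/ j = m.+2 by lia.
      rewrite (_ : (m.+1 == m.+2) = false) /=; last by lia.
      by rewrite ltnSn leqnn /=; nia.
    rewrite /= !ltnn eqxx leqnn. nia.
  + rewrite jm (_ : (m.+1 < m)%N = false) ?ltnn ?leqnn ?leq_pred; last by lia.
    have -> : (m < m.+2)%N by lia.
    rewrite andbT (_ : (m.+1 < m.+3)%N) ?ltnS /=; last by lia.
    by case: (m) => [|m'] /=; nia.
- exists (fun i => nth 0 [:: 16; 22; 30; 42; 30; 16]%Z i) => j.
  rewrite !big_ord_recl big_ord0.
  by do 6?case: j => [//|j].
- exists (fun i => nth 0 [:: 34; 49; 66; 96; 75; 52; 27]%Z i) => j.
  rewrite !big_ord_recl big_ord0.
  by do 7?case: j => [//|j].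
- exists (fun i => nth 0 [:: 92; 136; 182; 270; 220; 168; 114; 58]%Z i) => j.
  rewrite !big_ord_recl big_ord0.
  by do 8?case: j => [//|j].
- exists (fun i => nth 0 [:: 22; 42; 30; 16]%Z i) => j.
  rewrite !big_ord_recl big_ord0.
  by do 4?case: j => [//|j].
- exists (fun i => nth 0 [:: 4; 7]%Z i) => j.
  rewrite !big_ord_recl big_ord0.
  by do 2?case: j => [//|j].
Qed.

(** * Invariant derivations of polynomials on matrices *)

Section Derivations.
Variables (n : nat) (R S : comNzRingType).
Notation pol := {mpoly R[n]}.

Lemma mpoly_alg_ind (P : pol -> Prop) :
  (forall c, P c%:MP) -> (forall k, P 'X_k) ->
  (forall F G, P F -> P G -> P (F + G)) ->
  (forall F G, P F -> P G -> P (F * G)) -> forall F, P F.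
Proof.
move=> PC PX PD PM; have P1 : P 1 := PC 1.
apply: mpolyind => [|c m F _ _ PF]; first exact: PC.
apply: PD => //; rewrite -mul_mpolyC; apply: (PM) => //.
rewrite mpolyXE_id; apply: (big_ind P) => [|F1 F2 P1F P2F|i _]; [by [] | exact: PM |].
by elim: (m i) => [|k IH]; rewrite ?expr0 // exprS; apply: PM.
Qed.

Lemma derivation_eq (phi d1 d2 : pol -> S) :
  {morph d1 : F G / F + G} -> {morph d2 : F G / F + G} ->
  (forall F G, d1 (F * G) = d1 F * phi G + phi F * d1 G) ->
  (forall F G, d2 (F * G) = d2 F * phi G + phi F * d2 G) ->
  (forall c, d1 c%:MP = d2 c%:MP) -> (forall k, d1 'X_k = d2 'X_k) ->
  d1 =1 d2.
Proof.
move=> D1 D2 M1 M2 dC dX ; apply: mpoly_alg_ind => // F G dF dG.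
  by rewrite D1 D2 dF dG.
by rewrite M1 M2 dF dG.
Qed.
End Derivations.

Section DetDerivation.
Variables (R : comNzRingType) (d : R -> R).
Hypothesis dD : {morph d : x y / x + y}.
Hypothesis dM : forall x y, d (x * y) = d x * y + x * d y.

Let d0 : d 0 = 0.
Proof. by apply: (addrI (d 0)); rewrite -dD !addr0. Qed.
Let dN x : d (- x) = - d x.
Proof. by apply: (addrI (d x)); rewrite -dD !subrr d0. Qed.
Let d1 : d 1 = 0.
Proof. by apply: (addrI (d 1)); rewrite addr0 -{3}[1]mulr1 dM mulr1 mul1r. Qed.

Lemma derivation_prod (I : finType) (a : I -> R) :
  d (\prod_i a i) = \sum_i d (a i) * \prod_(j | j != i) a j.
Proof.
suff H (r : seq I) : uniq r -> d (\prod_(i <- r) a i)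
    = \sum_(i <- r) d (a i) * \prod_(j <- r | j != i) a j.
  by rewrite H /index_enum -?enumT ?enum_uniq.
elim: r => [|i r IH] /= => [_|/andP [ir ur]]; first by rewrite !big_nil d1.
rewrite !big_cons dM IH // eqxx /=; congr (_ * _ + _).
  rewrite big_seq [RHS]big_seq_cond; apply: eq_bigl => j.
  by case: eqP => [->|_]; rewrite ?(negPf ir) ?andbT.
rewrite mulr_sumr big_seq [RHS]big_seq; apply: eq_bigr => j jr.
rewrite big_cons ifT; first by rewrite mulrCA.
by apply: contraNneq ir => ->.
Qed.

(** Jacobi's formula: differentiating one row at a time gives the trace of [M *m N *m \adj M], and
    the trace is cyclic. Invertibility of [M] is not assumed. *)
Lemma derivation_det s (M N : 'M[R]_s) :
  map_mx d M = M *m N -> d (\det M) = \tr N * \det M.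
Proof.
move=> MN.
pose A i := \matrix_(a, b) (if a == i then (M *m N) a b else M a b).
transitivity (\sum_i \det (A i)).
  rewrite /determinant (big_morph d dD d0) exchange_big; apply: eq_bigr => u _ /=.
  transitivity ((-1) ^+ u * d (\prod_i M i (u i))).
    by rewrite -signr_odd; case: (odd u); rewrite ?expr1 ?expr0 ?mulN1r ?mul1r.
  rewrite derivation_prod mulr_sumr; apply: eq_bigr => i _; congr (_ * _).
  rewrite [RHS](bigD1 i) //= mxE eqxx -MN mxE; congr (_ * _).
  by apply: eq_bigr => j ji; rewrite mxE (negPf ji).
have -> : \tr N * \det M = \tr ((M *m N) *m \adj M).
  rewrite -mulmxA mxtrace_mulC -mulmxA mul_adj_mx mul_mx_scalar mxtraceZ.
  exact: mulrC.
rewrite /mxtrace; apply: eq_bigr => i _.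
rewrite (expand_det_row _ i) [RHS]mxE; apply: eq_bigr => j _.
rewrite [A i i j]mxE eqxx [\adj M j i]mxE; congr (_ * ((-1) ^+ _ * \det _)).
by apply/matrixP => a b; rewrite !mxE eq_sym (negPf (neq_lift _ _)).
Qed.

Lemma derivation_det_tr s (M N : 'M[R]_s) :
  map_mx d M = N *m M -> d (\det M) = \tr N * \det M.
Proof.
move=> MN; rewrite -det_tr -mxtrace_tr; apply: derivation_det.
by rewrite -matrix.map_trmx MN trmx_mul.
Qed.
End DetDerivation.

(** The exponential series at parameter 0, with [0 ^+ 0 = 1]; for [n = 0] the empty sum is the only
    matrix. *)
Lemma expmx_sum0 n (x : 'M[rat]_n) :
  \sum_(m < n) (0 ^+ m / m`!%:R) *: x ^+ m = 1.
Proof.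
case: n x => [|n] x; first by apply/matrixP => -[].
rewrite big_ord_recl !expr0 fact0 divr1 scale1r big1 ?addr0 // => i _.
by rewrite expr0n mul0r scale0r.
Qed.

Section MatrixPolynomials.
Variable n : nat.
Notation pol := {mpoly rat[n * n]}.

Section Evaluation.
Variables (S : comNzRingType) (iota : {rmorphism rat -> S}) (z : 'M[S]_n).

Definition rat_ev (F : pol) : S := mmap iota (fun k => mxvec z 0 k) F.

Lemma rat_ev_is_zmod_morphism : zmod_morphism rat_ev.
Proof. exact: (rmorphB (mmap iota (fun k => mxvec z 0 k))). Qed.
Lemma rat_ev_is_monoid_morphism : monoid_morphism rat_ev.
Proof.
split; first exact: (rmorph1 (mmap iota (fun k => mxvec z 0 k))).
exact: (rmorphM (mmap iota (fun k => mxvec z 0 k))).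
Qed.
HB.instance Definition _ := GRing.isZmodMorphism.Build pol S rat_ev
  rat_ev_is_zmod_morphism.
HB.instance Definition _ := GRing.isMonoidMorphism.Build pol S rat_ev
  rat_ev_is_monoid_morphism.

Lemma rat_evC c : rat_ev c%:MP = iota c.
Proof. exact: mmapC. Qed.

Definition gen_mx : 'M[pol]_n := \matrix_(i, j) 'X_(mxvec_index i j).

Lemma rat_ev_gen : map_mx rat_ev gen_mx = z.
Proof.
by apply/matrixP => i j; rewrite !mxE /rat_ev mmapX mmap1U mxvecE.
Qed.

Lemma rat_ev_unique (g : {rmorphism pol -> S}) :
  (forall c, g c%:MP = iota c) -> map_mx g gen_mx = z -> g =1 rat_ev.
Proof.
move=> gC gX; apply: mpoly_alg_ind => [c|k|F G gF gG|F G gF gG].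
- by rewrite gC rat_evC.
- case/mxvec_indexP: k => i j.
  have /matrixP/(_ i j) : map_mx g gen_mx = map_mx rat_ev gen_mx by rewrite gX rat_ev_gen.
  by rewrite !mxE.
- by rewrite !rmorphD gF gG.
- by rewrite !rmorphM gF gG.
Qed.

Lemma rat_ev_const m k (x : 'M[rat]_(m, k)) :
  map_mx rat_ev (map_mx (@mpolyC (n * n) rat) x) = map_mx iota x.
Proof. by apply/matrixP => i j; rewrite !mxE rat_evC. Qed.
End Evaluation.

(** The polynomial vector field [v], that is, the derivation sending the generic matrix to [v]. *)
Definition der (v : 'M[pol]_n) (F : pol) : pol :=
  \sum_k mxvec v 0 k * F^`M(k).

Lemma derD v : {morph der v : F G / F + G}.
Proof.
by move=> F G; rewrite -big_split; apply: eq_bigr => k _; rewrite mderivD mulrDr.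
Qed.

Lemma derM v F G : der v (F * G) = der v F * G + F * der v G.
Proof.
rewrite mulr_suml mulr_sumr -big_split; apply: eq_bigr => k _.
by rewrite mderivM mulrDr [F * (_ * _)]mulrCA -[mxvec v 0 k * _ * G]mulrA.
Qed.

Lemma derC v c : der v c%:MP = 0.
Proof. by rewrite /der big1 // => k _; rewrite mderivC mulr0. Qed.

Lemma der0 v : der v 0 = 0.
Proof. exact: (derC v 0). Qed.

Lemma derB v F G : der v (F - G) = der v F - der v G.
Proof. by apply/eqP; rewrite eq_sym subr_eq -derD subrK. Qed.

Lemma derZ v c F : der v (c *: F) = c *: der v F.
Proof. by rewrite -!mul_mpolyC derM derC mul0r add0r. Qed.

Lemma der_gen v : map_mx (der v) gen_mx = v.
Proof.
apply/matrixP => i j; rewrite !mxE /der (bigD1 (mxvec_index i j)) //=.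
rewrite mxvecE mderivX mnm1E eqxx big1 => [|k kij].
  by rewrite scale1r (_ : (U_(_) - U_(_))%MM = 0%MM) ?mpolyX0 ?mulr1 ?addr0 //;
    apply/mnmP => k; rewrite mnmBE mnm0E subnn.
by rewrite mderivX mnm1E eq_sym (negPf kij) scale0r mulr0.
Qed.

Lemma der_lin v w c F : der (c *: v + w) F = c * der v F + der w F.
Proof.
rewrite /der mulr_sumr -big_split; apply: eq_bigr => k _ /=.
case/mxvec_indexP: k => i j.
by rewrite !mxvecE !mxE mulrDl mulrA.
Qed.

Notation const := (map_mx (@mpolyC (n * n) rat)).

Lemma der_mulmxr v m k (M : 'M[pol]_(m, n)) (x : 'M[rat]_(n, k)) :
  map_mx (der v) (M *m const x) = map_mx (der v) M *m const x.
Proof.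
apply/matrixP => i j; rewrite !mxE (big_morph _ (derD v) (der0 v)).
by apply: eq_bigr => l _; rewrite !mxE derM derC mulr0 addr0.
Qed.

Lemma der_mulmxl v m k (M : 'M[pol]_(n, k)) (x : 'M[rat]_(m, n)) :
  map_mx (der v) (const x *m M) = const x *m map_mx (der v) M.
Proof.
apply/matrixP => i j; rewrite !mxE (big_morph _ (derD v) (der0 v)).
by apply: eq_bigr => l _; rewrite !mxE derM derC mul0r add0r.
Qed.

(** A commutator of derivations is a derivation, so it suffices to compare both sides on the
    coordinates. *)
Lemma der_bracket v w u : map_mx (der v) w - map_mx (der w) v = u ->
  forall F, der v (der w F) - der w (der v F) = der u F.
Proof.
move=> E F; apply: (derivation_eq (phi := idfun)
  (d1 := fun F => der v (der w F) - der w (der v F))) => [G K|G K|G K|G K|c|k].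
- by rewrite !derD opprD addrACA.
- exact: derD.
- by rewrite !derM !derD !derM /=; ring.
- exact: derM.
- by rewrite !derC ?der0 subrr.
case/mxvec_indexP: k => i j.
have X t : der t 'X_(mxvec_index i j) = t i j.
  by rewrite -[in RHS](der_gen t) !mxE.
by rewrite !X -E !mxE.
Qed.

(** Infinitesimal translations: [rder x F] is the derivative at t = 0 of F(X exp(t x)), and
    [lder x F] that of F(exp(t x) X). *)
Definition rder (x : 'M[rat]_n) := der (gen_mx *m const x).
Definition lder (x : 'M[rat]_n) := der (const x *m gen_mx).

Lemma rder_bracket x y F :
  rder x (rder y F) - rder y (rder x F) = rder (lie_bracket x y) F.
Proof.
have E (u v : 'M[rat]_n) : map_mx (der (gen_mx *m const u)) (gen_mx *m const v) =
  gen_mx *m const (u * v).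
  by rewrite (der_mulmxr (gen_mx *m const u) gen_mx v) der_gen -mulmxA -map_mxM.
rewrite /rder /lie_bracket; apply: der_bracket.
by rewrite (E x y) (E y x) -mulmxBr -map_mxB.
Qed.

Lemma lder_rder x y F : lder x (rder y F) = rder y (lder x F).
Proof.
apply/eqP; rewrite -subr_eq0 (@der_bracket _ _ 0); last first.
  apply/eqP; rewrite subr_eq0; apply/eqP.
  apply: etrans (der_mulmxr (const x *m gen_mx) gen_mx y) _.
  apply: etrans _ (esym (der_mulmxl (gen_mx *m const y) gen_mx x)).
  rewrite (der_gen (const x *m gen_mx)) (der_gen (gen_mx *m const y)).
  exact: esym (mulmxA _ _ _).
by rewrite /der big1 // => k _; rewrite linear0 mxE mul0r.
Qed.

Lemma rder_lin a x y F : rder (a *: x + y) F = a *: rder x F + rder y F.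
Proof.
rewrite -mul_mpolyC -der_lin; congr (der _ F).
rewrite map_mxD mulmxDr; congr (_ + _).
apply/matrixP => i j; rewrite !mxE mulr_sumr; apply: eq_bigr => k _.
by rewrite !mxE /= mpolyCM mulrCA.
Qed.

Lemma rder0 F : rder 0 F = 0.
Proof.
rewrite /rder map_mx0 mulmx0 /der big1 // => k _.
by rewrite linear0 mxE mul0r.
Qed.

Lemma rderZ a x F : rder (a *: x) F = a *: rder x F.
Proof. by rewrite -[a *: x]addr0 rder_lin rder0 addr0. Qed.

Lemma ev1_der v F : rat_ev idfun 1 (der v F)
  = \sum_k mxvec (map_mx (rat_ev idfun 1) v) 0 k * rat_ev idfun 1 (F^`M(k)).
Proof.
rewrite rmorph_sum; apply: eq_bigr => k _; rewrite rmorphM; congr (_ * _).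
by case/mxvec_indexP: k => i j; rewrite !mxvecE mxE.
Qed.

(** Left and right translations have the same tangent vector [x] at the identity. *)
Lemma ev1_lder x F : rat_ev idfun 1 (rder x F) = rat_ev idfun 1 (lder x F).
Proof.
apply: etrans (ev1_der _ _) _; apply: etrans _ (esym (ev1_der _ _)).
have -> : map_mx (rat_ev idfun 1) (gen_mx *m const x) = x.
  by rewrite map_mxM rat_ev_gen rat_ev_const mul1mx map_mx_id.
have -> : map_mx (rat_ev idfun 1) (const x *m gen_mx) = x.
  by rewrite map_mxM rat_ev_gen rat_ev_const mulmx1 map_mx_id.
by [].
Qed.

Lemma mxtrace_const s (N : 'M[rat]_s) : \tr (const N) = (\tr N)%:MP.
Proof.
rewrite /mxtrace (big_morph _ (@mpolyCD _ _) (mpolyC0 _ rat)).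
by apply: eq_bigr => i _; rewrite mxE.
Qed.

(** The columns of [B] span a space stable under [x], on which [x] acts by [N]; the derivative of
    the matrix is then the matrix times [N], and Jacobi's formula applies. *)
Lemma rder_det s (A : 'M[rat]_(s, n)) (B : 'M[rat]_(n, s)) (x : 'M[rat]_n) N :
  x *m B = B *m N ->
  rder x (\det (const A *m gen_mx *m const B))
    = (\tr N)%:MP * \det (const A *m gen_mx *m const B).
Proof.
move=> xB; rewrite /rder /lder (derivation_det (derD _) (derM _) (N := const N)).
  by rewrite mxtrace_const.
by rewrite der_mulmxr der_mulmxl der_gen -!mulmxA -!map_mxM xB.
Qed.

Lemma lder_det s (A : 'M[rat]_(s, n)) (B : 'M[rat]_(n, s)) (x : 'M[rat]_n) N :
  A *m x = N *m A ->
  lder x (\det (const A *m gen_mx *m const B))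
    = (\tr N)%:MP * \det (const A *m gen_mx *m const B).
Proof.
move=> xB; rewrite /rder /lder (derivation_det_tr (derD _) (derM _) (N := const N)).
  by rewrite mxtrace_const.
by rewrite der_mulmxr der_mulmxl der_gen !mulmxA -!map_mxM xB.
Qed.

(* F (y exp (t x)) is a polynomial in t whose derivatives at 0 are the values
   at y of the iterates of rder x. *)
Lemma rat_ev_expmx (P : pol -> Prop) (x y : 'M[rat]_n) : x ^+ n = 0 ->
  (forall F, P F -> P (rder x F)) -> (forall F, P F -> rat_ev idfun y F = 0) ->
  forall F, P F -> rat_ev idfun (y * expmx x) F = 0.
Proof.
move=> xn Px Py.
(* [g] is exp(t x) and [E] is y exp(t x), with entries polynomial in t; [a m] is the derivative of
   the m-th term of [g]. *)
pose g : 'M[{poly rat}]_n := \sum_(m < n) (m`!%:R^-1 *: 'X^m) *: map_mx polyC (x ^+ m).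
pose E := map_mx polyC y *m g.
pose a m : 'M[{poly rat}]_n := (m%:R / m`!%:R *: 'X^(m.-1)) *: map_mx polyC (x ^+ m).
have gx : map_mx (@deriv rat) g = g *m map_mx polyC x.
  transitivity (\sum_(m < n) a m).
    rewrite /g; apply/matrixP => i j; rewrite !mxE !summxE raddf_sum.
    apply: eq_bigr => m _; rewrite !mxE /= derivM derivC mulr0 addr0 derivZ derivXn.
    by rewrite -scaler_nat scalerA [_ / _]mulrC.
  (* Since [x ^+ n = 0], a term of index [n] may be added, so that the shift of indices ends at the
     right place. *)
  transitivity (\sum_(m < n.+1) a m).
    by rewrite [RHS]big_ord_recr /= [X in _ = _ + X]/a xn map_mx0 scaler0 addr0.
  rewrite big_ord_recl {1}/a mul0r !scale0r add0r mulmx_suml.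
  apply: eq_bigr => m _; rewrite /a /= -scalemxAl -map_mxM; congr (_ *: _).
    by rewrite factS natrM invfM mulrA mulfV ?mul1r // pnatr_eq0.
  by congr map_mx; rewrite exprSr.
pose phi : {rmorphism pol -> {poly rat}} := rat_ev polyC E.
have dphi F : (phi F)^`() = phi (rder x F).
  apply: (derivation_eq (phi := phi) (d1 := fun F => (phi F)^`())
    (d2 := fun F => phi (rder x F))) => [G K|G K|G K|G K|c|k].
  - by rewrite rmorphD derivD.
  - by rewrite /rder derD rmorphD.
  - by rewrite rmorphM derivM.
  - by rewrite /rder derM rmorphD !rmorphM.
  - by rewrite /= rat_evC derivC /rder derC rmorph0.
  case/mxvec_indexP: k => i j.
  have X (f : pol -> {poly rat}) : f 'X_(mxvec_index i j) = map_mx f gen_mx i j by rewrite !mxE.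
  rewrite (X (fun F => phi (rder x F))) (X (fun F => (phi F)^`())).
  have -> : map_mx (fun F => phi (rder x F)) gen_mx = map_mx phi (map_mx (rder x) gen_mx).
    by apply/matrixP => b c; rewrite !mxE.
  have -> : map_mx (fun F => (phi F)^`()) gen_mx = map_mx (@deriv rat) (map_mx phi gen_mx).
    by apply/matrixP => b c; rewrite !mxE.
  rewrite der_gen map_mxM /= !rat_ev_gen rat_ev_const /E -mulmxA -gx.
  by congr ((_ : 'M_n) i j); apply/matrixP => b c;
    rewrite !mxE raddf_sum; apply: eq_bigr => k _; rewrite !mxE /= derivM derivC mul0r add0r.
have phi_horner c F : (phi F).[c] = rat_ev idfun (map_mx (horner_eval c) E) F.
  apply: (@rat_ev_unique _ _ _ (horner_eval c \o phi)) => [d|].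
    by rewrite /= rat_evC /horner_eval hornerC.
  by rewrite map_mx_comp rat_ev_gen.
have gc c : map_mx (horner_eval c) g = \sum_(m < n) (c ^+ m / m`!%:R) *: x ^+ m.
  apply/matrixP => i j; rewrite !mxE !summxE /horner_eval horner_sum.
  by apply: eq_bigr => m _; rewrite !mxE !hornerE [_ / _]mulrC.
have yc c : map_mx (horner_eval c) (map_mx polyC y) = y.
  by apply/matrixP => i j; rewrite !mxE /horner_eval hornerC.
have iter_phi F k : P F -> (phi F)^`(k).[0] = 0.
  elim: k F => [|k IH] F PF; last by rewrite derivSn dphi; apply: IH; apply: Px.
  rewrite derivn0 phi_horner map_mxM yc gc -[RHS](Py F PF); congr (rat_ev _ _ _).
  by rewrite expmx_sum0 mulmx1.
move=> F PF; have F0 : phi F = 0.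
  apply/polyP => k; rewrite coef0; apply/eqP.
  have := iter_phi F k PF; rewrite horner_coef0 coef_derivn addn0 ffactnn => /eqP.
  by rewrite -mulr_natr mulf_eq0 pnatr_eq0 eqn0Ngt fact_gt0 orbF.
have := phi_horner 1 F; rewrite F0 horner0 map_mxM yc gc => ->.
congr (rat_ev _ (_ *m _) _); apply: eq_bigr => m _.
by rewrite expr1n mul1r.
Qed.
End MatrixPolynomials.

(** * Submatrices and products *)

Section SubMatrices.
Variable R : comNzRingType.

Lemma sum_codom (V : nmodType) s n (j : 'I_s -> 'I_n) (F : 'I_n -> V) : injective j ->
  (forall r, r \notin codom j -> F r = 0) -> \sum_r F r = \sum_c F (j c).
Proof.
move=> jI F0; rewrite (bigID (mem (codom j))) /= [X in _ + X]big1 // addr0.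
rewrite (eq_bigl (mem (j @: [set: 'I_s]))) => [|r /=].
  by rewrite big_imset => [|? ? _ _ /jI] //; apply: eq_bigl => c; rewrite inE.
by apply/codomP/imsetP => [[c ->]|[c _ ->]]; exists c; rewrite ?inE.
Qed.

Lemma rowsub_mulmx s n p (j : 'I_s -> 'I_n) (x : 'M[R]_n) (y : 'M[R]_(n, p)) :
  injective j -> (forall c r, r \notin codom j -> x (j c) r = 0) ->
  rowsub j (x *m y) = mxsub j j x *m rowsub j y.
Proof.
move=> jI x0; apply/matrixP => a b; rewrite !mxE (sum_codom jI) => [|r /x0 ->].
  by apply: eq_bigr => c _; rewrite !mxE.
by rewrite mul0r.
Qed.

Lemma colsub_mulmx s n p (j : 'I_s -> 'I_n) (x : 'M[R]_n) (y : 'M[R]_(p, n)) :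
  injective j -> (forall c r, r \notin codom j -> x r (j c) = 0) ->
  colsub j (y *m x) = colsub j y *m mxsub j j x.
Proof.
move=> jI x0; apply/matrixP => a b; rewrite !mxE (sum_codom jI) => [|r /x0 ->].
  by apply: eq_bigr => c _; rewrite !mxE.
by rewrite mulr0.
Qed.

Lemma mxsub_mul2 s t n (f : 'I_s -> 'I_n) (g : 'I_t -> 'I_n) (p z q : 'M[R]_n) :
  rowsub f p *m z *m colsub g q = mxsub f g (p *m z *m q).
Proof.
apply/matrixP => a b; rewrite !mxE; apply: eq_bigr => c _; rewrite !mxE.
by congr (_ * _); apply: eq_bigr => d _; rewrite !mxE.
Qed.
End SubMatrices.

(** * Polynomials vanishing on the elementary group *)

Section Vanishing.
Variables (l : nat) (A : 'M[int]_l) (n : nat) (V : serre_rep A n).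
Notation pol := {mpoly rat[n * n]}.

Definition rat_vanishing (F : pol) := forall g, elementary V g -> rat_ev idfun g F = 0.

(** Stability under the generators passes to brackets, hence to all root vectors, and [rat_ev_expmx]
    then propagates vanishing along each exponential factor. *)
Lemma stable_rat_vanishing (P : pol -> Prop) :
  (forall a F G, P F -> P G -> P (a *: F + G)) ->
  (forall i F, P F -> P (rder (rep_e V i) F)) ->
  (forall i F, P F -> P (rder (rep_f V i) F)) ->
  (forall F, P F -> rat_ev idfun 1 F = 0) ->
  forall F, P F -> rat_vanishing F.
Proof.
move=> Plin Pe Pf P1.
have PL x : in_lie_algebra V x -> forall F, P F -> P (rder x F).
  elim=> [i|i|a y u _ Py _ Pu|y u _ Py _ Pu] F PF; [exact: Pe|exact: Pf| |].
    by rewrite rder_lin; apply: Plin; [exact: Py|exact: Pu].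
  rewrite -rder_bracket addrC -scaleN1r.
  by apply: (Plin); [apply: (Pu); exact: Py|apply: (Py); exact: Pu].
(* The base point [y] is arbitrary because the induction moves the first factor of [g] into it. *)
suff H g : elementary V g -> forall y, (forall F, P F -> rat_ev idfun y F = 0) ->
    forall F, P F -> rat_ev idfun (y * g) F = 0.
  by move=> F PF g gE; rewrite -[g]mul1r; apply: H.
elim=> [|x {}g xr _ IH] y Py F PF; first by rewrite mulr1 Py.
rewrite mulrA; apply: IH PF => {}F PF.
by apply: (rat_ev_expmx (root_vector_nilp xr) _ Py PF); apply: PL; case: xr.
Qed.

Variable F : pol.
Variable chi : 'I_l -> rat.

Inductive lowered : pol -> Prop :=
  | lowered_base : lowered F
  | lowered_f i G : lowered G -> lowered (rder (rep_f V i) G)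
  | lowered_lin a G K : lowered G -> lowered K -> lowered (a *: G + K).

Lemma lowered0 : lowered 0.
Proof.
have := lowered_lin (-1) lowered_base lowered_base.
by rewrite scaleN1r addNr.
Qed.

Lemma loweredZ a G : lowered G -> lowered (a *: G).
Proof. by move=> GL; rewrite -[_ *: _]addr0; apply: lowered_lin => //; exact: lowered0. Qed.

Lemma loweredD G K : lowered G -> lowered K -> lowered (G + K).
Proof. by move=> GL KL; rewrite -[G]scale1r; apply: lowered_lin. Qed.

Lemma rder_br (x y : 'M[rat]_n) (G : pol) :
  rder x (rder y G) = rder y (rder x G) + rder (lie_bracket x y) G.
Proof. by rewrite -rder_bracket addrC subrK. Qed.

(* F is a highest weight vector for right translations, and the derivatives of
   F along words in the f_i vanish at 1: the span of these derivatives is stable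
   by the triangular decomposition. *)
Lemma highest_weight_vanishing :
  (forall i, rder (rep_e V i) F = 0) ->
  (forall i, rder (rep_h V i) F = chi i *: F) ->
  (forall i, lder (rep_f V i) F = 0) ->
  rat_ev idfun 1 F = 0 -> rat_vanishing F.
Proof.
move=> eF hF fF F1; apply: (stable_rat_vanishing (P := lowered)).
- exact: lowered_lin.
- have hG i G : lowered G -> lowered (rder (rep_h V i) G).
    elim=> [|j {}G LG IH|a {}G K _ IG _ IK].
    + by rewrite hF; apply: loweredZ; exact: lowered_base.
    + rewrite rder_br rep_hf rderZ; apply: loweredD; first exact: lowered_f.
      by apply: loweredZ; apply: lowered_f.
    + by rewrite /rder derD derZ; apply: lowered_lin.
  move=> i G; elim=> [|j {}G LG IH|a {}G K _ IG _ IK].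
  + by rewrite eF; exact: lowered0.
  + rewrite rder_br rep_ef; apply: loweredD; first exact: lowered_f.
    by case: eqP => _; [exact: hG | rewrite rder0; exact: lowered0].
  + by rewrite /rder derD derZ; apply: lowered_lin.
- exact: lowered_f.
(* Left derivatives commute with right ones, so those along the [rep_f V i] kill every lowered
   polynomial; at 1 they agree with the right ones, which gives the vanishing there. *)
- move=> G LG; suff [] : rat_ev idfun 1 G = 0 /\ forall i, lder (rep_f V i) G = 0 by [].
  elim: LG => [|j {}G _ [_ IH]|a {}G K _ [G1 GL] _ [K1 KL]]; first by [].
    split=> [|i]; last by rewrite lder_rder IH /rder der0.
    by apply: etrans (ev1_lder _ _) _; rewrite (IH j) rmorph0.
  split=> [|i]; last by rewrite /lder derD derZ -!/(lder _ _) GL KL scaler0 addr0.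
  by rewrite rmorphD -mul_mpolyC rmorphM /= G1 K1 mulr0 addr0.
- exact: lowered_base.
Qed.
End Vanishing.

(** * Central points of the group over a Q-algebra *)

Section Center.
Variables (l : nat) (A : 'M[int]_l) (n : nat) (V : serre_rep A n).
Notation pol := {mpoly rat[n * n]}.
Notation const := (map_mx (@mpolyC (n * n) rat)).
Hypothesis A2 : forall i, A i i = 2.

Lemma rep_h_codiagonalizable : exists2 P : 'M[rat]_n, P \in unitmx &
  forall i a b, a != b -> (P *m rep_h V i *m invmx P) a b = 0.
Proof.
have dg i : diagonalizable (rep_h V i).
  have := rep_ef V i i; have := rep_he V i i; have := rep_hf V i i.
  rewrite eqxx A2; move: (rep_e V i) (rep_f V i) (rep_h V i).
  case: (n) => [|n'] e f h hf he ef.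
    by exists 1%:M; rewrite ?unitmx1 //; apply/diagonalizable_forPp => - [].
  (* On row vectors [f] raises weights and [e] lowers them, hence the exchanged roles. *)
  apply: (@sl2_diagonalizable n' f e h).
  - by rewrite -ef /lie_bracket addrC subrK.
  - move: hf; rewrite /lie_bracket => /eqP; rewrite subr_eq => /eqP ->.
    by rewrite scaleNr addrAC -scaler_nat addNr add0r.
  - move: he; rewrite /lie_bracket => /eqP; rewrite subr_eq => /eqP ->.
    by rewrite addrAC -scaler_nat subrr add0r.
  - by apply: (@nilp_bracket _ h _ (-2)) => //; rewrite -hf.
  - by apply: (@nilp_bracket _ h _ 2) => //; rewrite he.
have [|P Pu] := proj1 (codiagonalizableP [seq rep_h V i | i <- enum 'I_l]).
  split=> [_ _ /mapP [i _ ->] /mapP [j _ ->]|_ /mapP [i _ ->]]; last exact: dg.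
  by apply/eqP; rewrite -subr_eq0; apply/eqP; exact: (rep_hh V i j).
move=> /allP Pd; exists P => // i a b ab.
have /= := Pd _ (map_f (rep_h V) (mem_enum _ i)).
by move=> /(diagonalizable_forP _ Pu); apply.
Qed.

Variable d : 'I_l -> int.
Hypothesis d_pos : forall j, 0 < \sum_i d i * A i j.

(** * Weight bases, heights and minors *)

Section Basis.
Variable P : 'M[rat]_n.
Hypothesis Pu : P \in unitmx.
Hypothesis Pdiag : forall i a b, a != b -> (P *m rep_h V i *m invmx P) a b = 0.

Definition conj_mx (x : 'M[rat]_n) := P *m x *m invmx P.

Lemma conj_mxM x y : conj_mx (x * y) = conj_mx x *m conj_mx y.
Proof. by rewrite /conj_mx !mulmxA mulmxKV. Qed.

Lemma conj_mxB x y : conj_mx (x - y) = conj_mx x - conj_mx y.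
Proof. by rewrite /conj_mx mulmxBr mulmxBl. Qed.

Lemma conj_mxZ a x : conj_mx (a *: x) = a *: conj_mx x.
Proof. by rewrite /conj_mx -scalemxAr -scalemxAl. Qed.

(** The value of the coweight [d] on the weight of the basis vector [a]. *)
Definition height a : rat := \sum_i (d i)%:~R * conj_mx (rep_h V i) a a.

Lemma diag_bracket i x c a b : lie_bracket (rep_h V i) x = c *: x ->
  (conj_mx (rep_h V i) a a - conj_mx (rep_h V i) b b) * conj_mx x a b
    = c * conj_mx x a b.
Proof.
move=> /(congr1 conj_mx)/matrixP/(_ a b); rewrite conj_mxZ conj_mxB !conj_mxM.
have : forall a b, a != b -> conj_mx (rep_h V i) a b = 0 := Pdiag i.
move: (conj_mx (rep_h V i)) (conj_mx x) => h y hd.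
rewrite !mxE (bigD1 a) //= big1 => [|k ka]; last by rewrite hd ?mul0r // eq_sym.
rewrite (bigD1 b) //= big1 => [|k kb]; last by rewrite hd ?mulr0.
by rewrite !addr0 => <-; rewrite mulrBl; congr (_ - _); rewrite mulrC.
Qed.

Lemma height_shift x (c : 'I_l -> rat) a b :
  (forall i, lie_bracket (rep_h V i) x = c i *: x) -> conj_mx x a b != 0 ->
  height a - height b = \sum_i (d i)%:~R * c i.
Proof.
move=> hx xab; rewrite -sumrB; apply: eq_bigr => i _.
by rewrite -mulrBr; congr (_ * _); apply: (mulIf xab); exact: diag_bracket.
Qed.

Lemma height_e j a b : conj_mx (rep_e V j) a b != 0 -> height b < height a.
Proof.
move=> /(height_shift (rep_he V ^~ j)) E; rewrite -subr_gt0 E.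
have -> : \sum_i (d i)%:~R * (A i j)%:~R = (\sum_i d i * A i j)%:~R :> rat.
  by rewrite rmorph_sum; apply: eq_bigr => i _; rewrite rmorphM.
by rewrite ltr0z d_pos.
Qed.

Lemma height_f j a b : conj_mx (rep_f V j) a b != 0 -> height a < height b.
Proof.
move=> /(height_shift (rep_hf V ^~ j)) E; rewrite -subr_lt0 E.
have -> : \sum_i (d i)%:~R * - (A i j)%:~R = - (\sum_i d i * A i j)%:~R :> rat.
  by rewrite rmorph_sum -sumrN; apply: eq_bigr => i _; rewrite rmorphM mulrN.
by rewrite oppr_lt0 ltr0z d_pos.
Qed.

(** A minor in the weight basis, written as a polynomial in the entries for the given basis. *)
Definition minor s (f g : 'I_s -> 'I_n) : pol :=
  \det (const (rowsub f P) *m gen_mx n *m const (colsub g (invmx P))).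

Lemma minor_ev (S : comNzRingType) (iota : {rmorphism rat -> S}) z s (f g : 'I_s -> 'I_n) :
  rat_ev iota z (minor f g)
    = \det (mxsub f g (map_mx iota P *m z *m map_mx iota (invmx P))).
Proof.
rewrite /minor -det_map_mx !map_mxM rat_ev_gen !rat_ev_const -mxsub_mul2.
by congr (\det (_ *m _ *m _)); apply/matrixP => a b; rewrite !mxE.
Qed.

Lemma rder_minor s (f g : 'I_s -> 'I_n) x : injective g ->
  (forall c r, r \notin codom g -> conj_mx x r (g c) = 0) ->
  rder x (minor f g) = (\sum_c conj_mx x (g c) (g c)) *: minor f g.
Proof.
move=> gI x0; rewrite -mul_mpolyC (rder_det _ (N := mxsub g g (conj_mx x))).
  by congr (_%:MP * _); apply: eq_bigr => c _; rewrite mxE.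
rewrite -(colsub_mulmx _ gI x0) /conj_mx !mulmxA mulVmx // mul1mx.
by apply/matrixP => a b; rewrite !mxE; apply: eq_bigr => c _; rewrite !mxE.
Qed.

Lemma lder_minor s (f g : 'I_s -> 'I_n) x : injective f ->
  (forall c r, r \notin codom f -> conj_mx x (f c) r = 0) ->
  lder x (minor f g) = (\sum_c conj_mx x (f c) (f c)) *: minor f g.
Proof.
move=> fI x0; rewrite -mul_mpolyC (lder_det _ (N := mxsub f f (conj_mx x))).
  by congr (_%:MP * _); apply: eq_bigr => c _; rewrite mxE.
rewrite -(rowsub_mulmx _ fI x0) /conj_mx mulmxKV //.
by apply/matrixP => a b; rewrite !mxE; apply: eq_bigr => c _; rewrite !mxE.
Qed.

Lemma conj_e_diag j a : conj_mx (rep_e V j) a a = 0.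
Proof. by apply/eqP/negPn/negP => /height_e; rewrite ltxx. Qed.

Lemma conj_f_diag j a : conj_mx (rep_f V j) a a = 0.
Proof. by apply/eqP/negPn/negP => /height_f; rewrite ltxx. Qed.


Section Level.
Variable k : rat.
Let above := [set c | k < height c].

Definition level_sel a (i : 'I_(#|above| + 1)) : 'I_n :=
  match split i with inl c => enum_val c | inr _ => a end.

Lemma level_sell a (c : 'I_#|above|) : level_sel a (lshift 1 c) = enum_val c.
Proof. by rewrite /level_sel -[lshift _ _]/(unsplit (inl _)) unsplitK. Qed.

Lemma level_selr a c : level_sel a (rshift _ c) = a.
Proof. by rewrite /level_sel -[rshift _ _]/(unsplit (inr _)) unsplitK. Qed.

Lemma above_enum (c : 'I_#|above|) : k < height (enum_val c).
Proof. by have := @enum_valP _ (mem above) c; rewrite inE. Qed.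

Lemma level_sel_inj a : height a = k -> injective (level_sel a).
Proof.
move=> ak i j; rewrite -(splitK i) -(splitK j).
case: (split i) => c; case: (split j) => c' /=; rewrite ?level_sell ?level_selr.
- by move=> /enum_val_inj ->.
- by move=> E; have := above_enum c; rewrite E ak ltxx.
- by move=> E; have := above_enum c'; rewrite -E ak ltxx.
- by rewrite !ord1.
Qed.

Lemma level_sel_height a i : height a = k -> k <= height (level_sel a i).
Proof.
move=> ak; rewrite -(splitK i); case: (split i) => c /=.
  by rewrite level_sell ltW // above_enum.
by rewrite level_selr ak.
Qed.

Lemma level_sel_codom a r : r \notin codom (level_sel a) -> height r <= k.
Proof.
rewrite leNgt; apply: contra => kr; have rS : r \in above by rewrite inE.
apply/codomP; exists (lshift 1 (enum_rank_in rS r)).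
by rewrite level_sell enum_rankK_in.
Qed.

(** A matrix respecting heights has no entry between the last row, of height [k], and the columns
    above [k], so the selected matrix is block triangular. *)
Lemma level_sel_block (S : comNzRingType) (w : 'M[S]_n) a b :
  (forall c e, height c != height e -> w c e = 0) -> height a = k -> height b = k ->
  \det (mxsub (level_sel a) (level_sel b) w)
    = \det (mxsub (fun c : 'I_#|above| => enum_val c)
      (fun c : 'I_#|above| => enum_val c) w) * w a b.
Proof.
move=> w0 ak bk; rewrite -[mxsub _ _ w in LHS]submxK.
rewrite (_ : dlsubmx _ = 0) ?det_ublock; last first.
  apply/matrixP => i j; rewrite !mxE level_sell level_selr w0 //.
  by rewrite ak lt_eqF ?above_enum.
rewrite [in X in _ * X]/mxsub det_mx11 !mxE !level_selr; congr (\det _ * _).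
by apply/matrixP => i j; rewrite !mxE !level_sell.
Qed.

(** The selection contains every index above [k] and only indices of height at least [k], and the
    generators shift heights strictly. So the columns are stable under the e_i and the rows under
    the f_i, with trace 0. At 1 the minor has the factor [(a == b)%:R = 0]. *)
Lemma level_minor_vanishing a b : a != b -> height a = k -> height b = k ->
  rat_vanishing V (minor (level_sel a) (level_sel b)).
Proof.
move=> ab ak bk.
pose chi i := \sum_c conj_mx (rep_h V i) (level_sel b c) (level_sel b c).
apply: (highest_weight_vanishing (chi := chi)) => [i|i|i|].
- rewrite rder_minor.
  + by rewrite big1 ?scale0r // => c _; exact: conj_e_diag.
  + exact: level_sel_inj.
  + move=> c r /level_sel_codom rk; apply/eqP/negPn/negP => /height_e.
    by rewrite ltNge (le_trans rk) // level_sel_height.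
- rewrite rder_minor //; first exact: level_sel_inj.
  by move=> c r rc; apply: Pdiag; apply: contraNneq rc => ->; exact: codom_f.
- rewrite lder_minor.
  + by rewrite big1 ?scale0r // => c _; exact: conj_f_diag.
  + exact: level_sel_inj.
  + move=> c r /level_sel_codom rk; apply/eqP/negPn/negP => /height_f.
    by rewrite ltNge (le_trans rk) // level_sel_height.
rewrite minor_ev level_sel_block // => [|c e ce].
  by rewrite mulmx1 -map_mxM mulmxV // map_mx1 mxE (negPf ab) mulr0.
rewrite mulmx1 -map_mxM mulmxV // map_mx1 mxE.
by case: (eqVneq c e) ce => [->|//]; rewrite eqxx.
Qed.
End Level.

Definition linked a b := [exists i, (conj_mx (rep_e V i) a b != 0)
  || (conj_mx (rep_f V i) a b != 0)].
Definition component a := [set b | connect (relU linked (fun x y => linked y x)) a b].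

(** The block of a component is stable under all e_i and f_i, which have trace 0 on it, so its
    determinant has zero derivatives along the group and keeps its value at 1. *)
Lemma component_minor_vanishing a (j := fun c : 'I_#|component a| => enum_val c) :
  rat_vanishing V (minor j j - 1).
Proof.
have jI : injective j := enum_val_inj.
have jC r : r \in component a -> r \in codom j.
  by move=> ra; apply/codomP; exists (enum_rank_in ra r); rewrite /j enum_rankK_in.
have linkC c r : r \notin codom j -> (linked r (j c) = false) /\ (linked (j c) r = false).
  move=> rj; have ca : j c \in component a by exact: enum_valP.
  split; apply: contraNF rj => lrc; apply: jC; rewrite inE in ca; rewrite inE.
    by apply: connect_trans ca _; apply: connect1; rewrite /= lrc orbT.
  by apply: connect_trans ca _; apply: connect1; rewrite /= lrc.
have e0 i c r : r \notin codom j -> conj_mx (rep_e V i) r (j c) = 0.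
  move=> /(linkC c) [+ _]; move/existsP => H; apply/eqP/negPn/negP => E.
  by apply: H; exists i; rewrite E.
have f0 i c r : r \notin codom j -> conj_mx (rep_f V i) r (j c) = 0.
  move=> /(linkC c) [+ _]; move/existsP => H; apply/eqP/negPn/negP => E.
  by apply: H; exists i; rewrite E orbT.
apply: (stable_rat_vanishing (P := fun F => [/\ forall i, rder (rep_e V i) F = 0,
   forall i, rder (rep_f V i) F = 0 & rat_ev idfun 1 F = 0])).
- move=> c F G [eF fF F1] [eG fG G1]; split=> [i|i|].
  + by rewrite /rder derD derZ -!/(rder _ _) eF eG scaler0 addr0.
  + by rewrite /rder derD derZ -!/(rder _ _) fF fG scaler0 addr0.
  + by rewrite rmorphD -mul_mpolyC rmorphM /= F1 G1 mulr0 addr0.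
- by move=> i F [-> _ _]; rewrite rmorph0; split=> // i'; rewrite /rder der0.
- by move=> i F [_ -> _]; rewrite rmorph0; split=> // i'; rewrite /rder der0.
- by move=> F [].
have d1 x : rder x (minor j j - 1) = rder x (minor j j).
  by rewrite /rder derB (derC _ 1) subr0.
split=> [i|i|].
- rewrite d1 rder_minor // ?big1 ?scale0r // => [c _|c r]; [exact: conj_e_diag|exact: e0].
- rewrite d1 rder_minor // ?big1 ?scale0r // => [c _|c r]; [exact: conj_f_diag|exact: f0].
rewrite rmorphB rmorph1 /= minor_ev mulmx1 -map_mxM mulmxV // map_mx1.
rewrite (_ : mxsub _ _ _ = 1%:M) ?det1 ?subrr //.
by apply/matrixP => c e; rewrite !mxE (inj_eq jI).
Qed.

(** * Points over a Q-algebra commuting with the generators *)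

Section Point.
Variables (S : comNzRingType) (iota : {rmorphism rat -> S}) (z : 'M[S]_n).
Hypothesis zV : forall F, rat_vanishing V F -> rat_ev iota z F = 0.
Hypothesis ze : forall i, z *m map_mx iota (rep_e V i) = map_mx iota (rep_e V i) *m z.
Hypothesis zf : forall i, z *m map_mx iota (rep_f V i) = map_mx iota (rep_f V i) *m z.

Let cz x := map_mx iota P *m x *m map_mx iota (invmx P).

Lemma iota_lreg q (s : S) : q != 0 -> iota q * s = 0 -> s = 0.
Proof.
move=> q0 /(congr1 ( *%R (iota q^-1))); rewrite mulrA -rmorphM mulVf // rmorph1.
by rewrite mul1r mulr0.
Qed.

Lemma det_z : \det z = 1.
Proof.
have : rat_ev iota z (\det (gen_mx n) - 1) = 0.
  apply: zV => g gE; rewrite rmorphB rmorph1 -det_map_mx rat_ev_gen.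
  by rewrite (elementary_det gE) subrr.
by rewrite rmorphB rmorph1 -det_map_mx rat_ev_gen => /eqP; rewrite subr_eq0 => /eqP.
Qed.

Lemma czM x y : cz (x *m y) = cz x *m cz y.
Proof.
rewrite /cz !mulmxA -[_ *m map_mx iota (invmx P) *m map_mx iota P]mulmxA.
by rewrite -map_mxM mulVmx // map_mx1 mulmx1.
Qed.

Lemma cz_iota x : cz (map_mx iota x) = map_mx iota (conj_mx x).
Proof. by rewrite /cz /conj_mx !map_mxM. Qed.

(** The [rep_h V i] are diagonal in the weight basis, so commuting with them makes the difference of
    heights kill the entry, and nonzero rationals are cancellable in [S]. *)
Lemma commute_height y :
  (forall i, y *m map_mx iota (rep_h V i) = map_mx iota (rep_h V i) *m y) ->
  forall a b, height a != height b -> cz y a b = 0.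
Proof.
move=> yh a b hab; have : (iota (height a - height b)) * cz y a b = 0; last first.
  by apply: iota_lreg; rewrite subr_eq0.
have E i : iota (conj_mx (rep_h V i) a a - conj_mx (rep_h V i) b b) * cz y a b = 0.
  have := congr1 cz (yh i); rewrite !czM cz_iota => /matrixP/(_ a b).
  have : forall a b, a != b -> conj_mx (rep_h V i) a b = 0 := Pdiag i.
  move: (conj_mx (rep_h V i)) (cz y) => h u hd.
  rewrite !mxE (bigD1 b) //= big1 => [|c cb]; last by rewrite !mxE hd ?rmorph0 ?mulr0.
  rewrite (bigD1 a) //= big1 => [|c ca]; last by rewrite !mxE hd ?rmorph0 ?mul0r // eq_sym.
  by rewrite !addr0 !mxE rmorphB mulrBl => <-; rewrite mulrC subrr.
rewrite -sumrB rmorph_sum mulr_suml big1 // => i _.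
by rewrite -mulrBr rmorphM -mulrA E mulr0.
Qed.

Lemma z_h i : z *m map_mx iota (rep_h V i) = map_mx iota (rep_h V i) *m z.
Proof.
have -> : rep_h V i = rep_e V i *m rep_f V i - rep_f V i *m rep_e V i.
  by have := rep_ef V i i; rewrite eqxx.
rewrite map_mxB !map_mxM mulmxBr mulmxBl !mulmxA ze zf -!mulmxA.
by rewrite ze zf.
Qed.

(** Different heights are excluded by commutation with the [rep_h V i]. For equal heights the
    vanishing minor is the product of this entry and the determinant of the block above it. *)
Lemma cz_diag a b : a != b -> cz z a b = 0.
Proof.
move=> ab; have [hab|hab] := eqVneq (height a) (height b); last exact: (commute_height z_h).
have zw : z *m \adj z = 1%:M by rewrite mul_mx_adj det_z.
have wz : \adj z *m z = 1%:M by rewrite mul_adj_mx det_z.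
have wh i : \adj z *m map_mx iota (rep_h V i) = map_mx iota (rep_h V i) *m \adj z.
  rewrite -[LHS]mulmx1 -zw !mulmxA -[\adj z *m _ *m z]mulmxA -z_h !mulmxA.
  by rewrite wz mul1mx.
have := zV (level_minor_vanishing ab erefl (esym hab)); rewrite minor_ev.
rewrite -/(cz z) level_sel_block //; last exact: (commute_height z_h).
set U := mxsub _ _ (cz z).
set j := fun c : 'I_#|[set c | height a < height c]| => enum_val c.
(* [S] may have zero divisors, so [\det U] must be a unit: the block of the inverse of [z] inverts
   [U], because [z] respects heights. *)
have UW : U *m mxsub j j (cz (\adj z)) = 1%:M.
  have jI : injective j := enum_val_inj.
  have rowE t (m : 'M[S]_(n, t)) : rowsub j (cz z *m m) = U *m rowsub j m.
    apply: rowsub_mulmx => // c r rj; apply: (commute_height z_h).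
    have hc := above_enum c; apply: contraNneq rj => E.
    have rS : r \in [set c | height a < height c] by rewrite inE -E.
    by apply/codomP; exists (enum_rank_in rS r); rewrite /j enum_rankK_in.
  have := congr1 (colsub j) (rowE _ (cz (\adj z))).
  rewrite -czM zw /cz mulmx1 -map_mxM mulmxV // map_mx1 => E.
  transitivity (colsub j (U *m rowsub j (cz (\adj z)))).
    by apply/matrixP => s t; rewrite !mxE; apply: eq_bigr => r _; rewrite !mxE.
  by rewrite -E; apply/matrixP => s t; rewrite !mxE (inj_eq jI).
move=> H; have := congr1 determinant UW; rewrite det_mulmx det1 => UW1.
by rewrite -[LHS]mul1r -UW1 mulrAC [\det U * _]H mul0r.
Qed.

Lemma cz_linked a b : linked a b -> cz z a a = cz z b b.
Proof.
have key x : z *m map_mx iota x = map_mx iota x *m z -> conj_mx x a b != 0 ->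
    cz z a a = cz z b b.
  move=> zx xab; have := congr1 cz zx; rewrite !czM cz_iota => /matrixP/(_ a b).
  have : forall a b, a != b -> cz z a b = 0 := cz_diag.
  move: xab; move: (conj_mx x) (cz z) => y u yab ud.
  rewrite !mxE (bigD1 a) //= big1 => [|c cb]; last by rewrite ud ?mul0r // eq_sym.
  rewrite (bigD1 b) //= big1 => [|c ca]; last by rewrite ud ?mulr0.
  rewrite !addr0 !mxE mulrC => /eqP; rewrite -subr_eq0 -mulrBr => /eqP.
  by move/(iota_lreg yab)/eqP; rewrite subr_eq0 => /eqP.
by case/existsP => i /orP [|]; apply: key.
Qed.

Lemma cz_component a b : b \in component a -> cz z b b = cz z a a.
Proof.
rewrite inE => /connectP [s]; elim: s a => [|c s IH] a /=; first by move=> _ ->.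
by move=> /andP [/orP [] /cz_linked ac /IH E] /E ->.
Qed.

Lemma central_point_expfact : z ^+ n`! = 1.
Proof.
have ca a : (cz z a a) ^+ #|component a| = 1.
  have := zV (component_minor_vanishing a); rewrite rmorphB rmorph1 /= minor_ev -/(cz z).
  move/eqP; rewrite subr_eq0 => /eqP <-.
  rewrite (_ : mxsub _ _ _ = diag_mx (const_mx (cz z a a))).
    by rewrite det_diag (eq_bigr (fun=> cz z a a)) ?prodr_const ?card_ord // => i _;
      rewrite mxE.
  apply/matrixP => c e; rewrite [LHS]mxE [RHS]mxE [const_mx _ _ _]mxE.
  have [->|ce] := eqVneq c e; first by rewrite mulr1n; apply: cz_component; exact: enum_valP.
  by rewrite [LHS]cz_diag ?mulr0n ?(inj_eq enum_val_inj).
have ca1 a : (cz z a a) ^+ n`! = 1.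
  (* The component has between 1 and n elements, so its size divides n!. *)
  have /dvdnP [q ->] : (#|component a| %| n`!)%N.
    apply: dvdn_fact; apply/andP; split;
      last by rewrite -[X in (_ <= X)%N](card_ord n) max_card.
    by apply/card_gt0P; exists a; rewrite inE connect0.
  by rewrite mulnC exprM ca expr1n.
have czX k : cz (z ^+ k) = \matrix_(a, b) ((cz z a a) ^+ k *+ (a == b)).
  elim: k => [|k IH].
    by rewrite expr0 /cz mulmx1 -map_mxM mulmxV // map_mx1; apply/matrixP => a b;
      rewrite !mxE expr0.
  rewrite exprS -mulmxE czM IH; apply/matrixP => a b;
    rewrite !mxE (bigD1 a) //= big1 => [|c ca'].
    by rewrite !mxE addr0 exprS mulrnAr.
  by rewrite cz_diag ?mul0r // eq_sym.
have : cz (z ^+ n`!) = 1%:M.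
  by rewrite czX; apply/matrixP => a b; rewrite [LHS]mxE ca1 mxE.
rewrite /cz => /(congr1 (fun x => map_mx iota (invmx P) *m x *m map_mx iota P)).
rewrite mulmx1 -map_mxM mulVmx // map_mx1 !mulmxA -map_mxM mulVmx // map_mx1 mul1mx.
by rewrite -mulmxA -map_mxM mulVmx // map_mx1 mulmx1.
Qed.
End Point.
End Basis.

Theorem central_point_torsion (S : comNzRingType) (iota : {rmorphism rat -> S}) (z : 'M[S]_n) :
  (forall F, rat_vanishing V F -> rat_ev iota z F = 0) ->
  (forall i, z *m map_mx iota (rep_e V i) = map_mx iota (rep_e V i) *m z) ->
  (forall i, z *m map_mx iota (rep_f V i) = map_mx iota (rep_f V i) *m z) ->
  z ^+ n`! = 1.
Proof.
have [P Pu Pd] := rep_h_codiagonalizable; exact: (central_point_expfact Pu Pd).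
Qed.
End Center.

(** * Congruences between integer matrices *)

Lemma exprZmx (R : comNzRingType) n c (y : 'M[R]_n) k : (c *: y) ^+ k = c ^+ k *: y ^+ k.
Proof.
elim: k => [|k IH]; first by rewrite !expr0 scale1r.
by rewrite !exprS IH -!mulmxE -scalemxAl -scalemxAr scalerA.
Qed.

Section IntegerMatrices.
Variables (n p : nat).
Implicit Types z : 'M[int]_n.

Definition mx_dvd (q : nat) (x : 'M[int]_n) := forall i j, (q%:Z %| x i j)%Z.

Lemma mx_dvdP q x : mx_dvd q x <-> exists y, x = q%:R *: y.
Proof.
split=> [xq|[y ->] i j]; last by rewrite mxE natz dvdz_mulr.
exists (\matrix_(i, j) (x i j %/ q%:Z)%Z); apply/matrixP => i j.
by rewrite !mxE natz mulrC divzK.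
Qed.

Lemma mx_dvdD q x y : mx_dvd q x -> mx_dvd q y -> mx_dvd q (x + y).
Proof. by move=> xq yq i j; rewrite mxE rpredD. Qed.

Lemma mx_dvd_sum q (I : Type) (r : seq I) (P : pred I) F :
  (forall i, P i -> mx_dvd q (F i)) -> mx_dvd q (\sum_(i <- r | P i) F i).
Proof.
move=> Fq; apply: (big_ind (mx_dvd q)) => //; last exact: mx_dvdD.
by move=> i j; rewrite mxE dvdz0.
Qed.

Lemma mx_dvd_trans q q' x : (q' %| q)%N -> mx_dvd q x -> mx_dvd q' x.
Proof. by move=> qq xq i j; apply: dvdz_trans (xq i j). Qed.

Hypotheses (pr : prime p).

(** In the expansion of (1 + p^a y)^p the linear term gains a factor p from the binomial, and the
    later ones contain p^(2a), where 2a is at least a + 1. *)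
Lemma mx_dvd_expp a z : (0 < a)%N -> mx_dvd (p ^ a) (z - 1) ->
  mx_dvd (p ^ a.+1) (z ^+ p - 1).
Proof.
move=> a0 /mx_dvdP [y zy].
have -> : z = (p ^ a)%:R *: y + 1 by rewrite -zy subrK.
rewrite exprD1n; move: pr a0; case: (p) => [|[|q]] // _ a0.
rewrite big_ord_recl expr0 bin0 addrC addrA addNr add0r; apply: mx_dvd_sum => i _.
apply/mx_dvdP; rewrite /= exprZmx -natrX -expnM.
have -> (x : 'M[int]_n) k : x *+ k = k%:R *: x by rewrite scaler_nat.
rewrite scalerA -natrM.
suff /dvdnP [k ->] : (q.+2 ^ a.+1 %| 'C(q.+2, i.+1) * q.+2 ^ (a * i.+1))%N.
  by exists (k%:R *: y ^+ i.+1); rewrite scalerA -natrM mulnC.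
case: i => [[|i]] /= _.
  by rewrite muln1 bin1 expnS.
by apply: dvdn_mull; apply: dvdn_exp2l; lia.
Qed.

Lemma mx_dvd_exppn z m : mx_dvd p (z - 1) -> mx_dvd (p ^ m.+1) (z ^+ (p ^ m) - 1).
Proof.
move=> zp; elim: m => [|m IH]; first by rewrite expr1.
by rewrite [X in z ^+ X]expnSr exprM; apply: mx_dvd_expp.
Qed.

Hypothesis p_ge3 : (3 <= p)%N.

(** This needs p >= 3: for p = 2 the bound fails at i = 2. *)
Lemma logn_le_subn2 i : (2 <= i)%N -> (logn p i <= i - 2)%N.
Proof.
move=> i2; have := @pfactor_dvdnn p i => /dvdn_leq -/(_ (ltnW i2)).
case: (logn p i) => // v; have : (p ^ v.+1 >= v.+3)%N; last by lia.
elim: v => [|v IH]; first by rewrite expn1.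
by rewrite expnS; nia.
Qed.

(** From i C(M, i) = M C(M - 1, i - 1), the valuation of C(M, i) is at least v(M) - v(i), and v(i)
    <= i - 2 leaves room for one more factor p. *)
Lemma logn_bin_exp M b i : (0 < M)%N -> (0 < b)%N -> (2 <= i)%N ->
  (p ^ (b + 1 + logn p M) %| 'C(M, i) * p ^ (b * i))%N.
Proof.
move=> M0 b0 i2; have [iM|iM] := ltnP M i; first by rewrite bin_small.
have C0 : (0 < 'C(M, i))%N by rewrite bin_gt0.
have p0 : (0 < p)%N by lia.
rewrite pfactor_dvdn // ?muln_gt0 ?C0 ?expn_gt0 ?p0 //.
rewrite lognM ?expn_gt0 ?p0 // pfactorK //.
have := logn_le_subn2 i2.
have : (logn p M <= logn p i + logn p 'C(M, i))%N.
  have := mul_bin_diag M i.-1; rewrite prednK; last by lia.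
  move=> E; rewrite -lognM //; last by lia.
  by rewrite -E lognM ?leq_addr // bin_gt0; lia.
by nia.
Qed.

(** Write z = 1 + p^b y. All terms of z^M - 1 beyond M p^b y are divisible by p^(b + 1 + v(M)), so p
    divides y. *)
Lemma mx_dvd_root_step M b z : (0 < M)%N -> (0 < b)%N -> mx_dvd (p ^ b) (z - 1) ->
  mx_dvd (p ^ (b + 1 + logn p M)) (z ^+ M - 1) -> mx_dvd (p ^ b.+1) (z - 1).
Proof.
move=> M0 b0 /mx_dvdP [y zy] zM.
have : mx_dvd (p ^ (b + 1 + logn p M)) ((M * p ^ b)%:R *: y).
  have zE : z = (p ^ b)%:R *: y + 1 by rewrite -zy subrK.
  move: zM; rewrite zE exprD1n; case: M M0 => // M _.
  rewrite big_ord_recl expr0 bin0 addrC addrA addNr add0r big_ord_recl.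
  set T := \sum_(_ < _) _ => H.
  have HT : mx_dvd (p ^ (b + 1 + logn p M.+1)) T.
    apply: mx_dvd_sum => i _; apply/mx_dvdP; rewrite /= exprZmx -natrX -expnM.
    rewrite -scaler_nat scalerA -natrM.
    have /dvdnP [k ->] := @logn_bin_exp M.+1 b i.+2 isT b0 isT.
    by exists (k%:R *: y ^+ i.+2); rewrite scalerA -natrM mulnC.
  move=> i j; have := H i j; rewrite mxE rpredDr; last exact: HT.
  by rewrite /= bin1 expr1 -scaler_nat scalerA -natrM.
move=> yM; rewrite zy => i j; have := yM i j; rewrite !mxE !natz !dvdzE !abszM !absz_nat.
have p0 : (0 < p)%N by lia.
have [->|a0] := posnP `|y i j|%N; first by rewrite !muln0.
rewrite !pfactor_dvdn ?muln_gt0 ?expn_gt0 ?p0 ?M0 //.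
by rewrite !lognM ?muln_gt0 ?expn_gt0 ?p0 ?M0 // !pfactorK //; lia.
Qed.

(** Cancelling [C] costs its valuation; the previous step then raises the precision of z = 1 one
    power at a time. *)
Lemma mx_dvd_root C M j z : (0 < C)%N -> (0 < M)%N -> mx_dvd p (z - 1) ->
  mx_dvd (p ^ (j + 1 + logn p C + logn p M)) (C%:R *: (z ^+ M - 1)) ->
  mx_dvd (p ^ j.+1) (z - 1).
Proof.
move=> C0 M0 zp Cz; have p0 : (0 < p)%N by lia.
have zM : mx_dvd (p ^ (j + 1 + logn p M)) (z ^+ M - 1).
  move: Cz; move: (z ^+ M - 1) => u Cu a b; have := Cu a b.
  rewrite mxE natz !dvdzE abszM !absz_nat.
  have [->|a0] := posnP `|u a b|%N; first by rewrite !dvdn0.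
  rewrite !pfactor_dvdn ?muln_gt0 ?C0 ?p0 //.
  by rewrite lognM //; move: (logn p `|u a b|) => t; lia.
have H k : (k <= j)%N -> mx_dvd (p ^ k.+1) (z - 1).
  elim: k => [|k IH] kj; first by rewrite expn1.
  apply: mx_dvd_root_step M0 _ (IH (ltnW kj)) _ => //.
  by apply: mx_dvd_trans zM; apply: dvdn_exp2l; lia.
exact: H.
Qed.
End IntegerMatrices.

(** * Reductions of p-adic integers *)

Section Padic.
Variables (p : nat) (pr : prime p).

Lemma intr_Zp_eq0 r (k : int) : ((k%:~R : 'Z_(p ^ r.+1)) == 0) = ((p ^ r.+1)%N%:Z %| k)%Z.
Proof.
have P1 : (1 < p ^ r.+1)%N by rewrite -(exp1n r.+1) ltn_exp2r // prime_gt1.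
have natP m : ((m%:R : 'Z_(p ^ r.+1)) == 0) = (p ^ r.+1 %| m)%N.
  by rewrite -val_eqE Zp_nat /= /dvdn [in LHS](Zp_cast P1).
case: k => m; first by rewrite -pmulrn natP dvdzE.
by rewrite NegzE rmorphN oppr_eq0 /= -pmulrn natP dvdzE abszN.
Qed.

(** Level [r] is reduction modulo p^(r+1), so level 0 is reduction modulo p. *)
Definition level r : {rmorphism padic_int p -> 'Z_(p ^ r.+1)} := @invlim_proj _ _ _ _ r.

(** One integer lift serves all levels up to [m], which reduces p-adic congruences to divisibility
    of integer matrices. *)
Lemma level_lift m k l (z : 'M[padic_int p]_(k, l)) : exists y : 'M[int]_(k, l),
  forall s, (s <= m)%N -> map_mx (level s) z = map_mx intr y.
Proof.
exists (map_mx (fun x : padic_int p => (level m x : nat)%:Z) z) => s sm.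
by apply/matrixP => i j; rewrite !mxE /level /= /invlim_proj -(invlimP (z i j) sm).
Qed.

Lemma map_intr_Zp_eq0 n r (y : 'M[int]_n) :
  map_mx (intr : int -> 'Z_(p ^ r.+1)) y = 0 <-> mx_dvd (p ^ r.+1) y.
Proof.
split=> [/matrixP y0 i j|y0]; first by rewrite -intr_Zp_eq0; have := y0 i j; rewrite !mxE => ->.
by apply/matrixP => i j; rewrite !mxE; apply/eqP; rewrite intr_Zp_eq0.
Qed.

Lemma level_le0 s r (x : padic_int p) : (s <= r)%N -> level r x = 0 -> level s x = 0.
Proof. by move=> sr; rewrite /level /= /invlim_proj -(invlimP x sr) => ->; rewrite rmorph0. Qed.

Lemma level_int r (k : int) : level r k%:~R = k%:~R.
Proof. exact: rmorph_int. Qed.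

Lemma level_int_eq0 (k : int) : (forall r, level r k%:~R = 0) -> k = 0.
Proof.
move=> k0; apply/eqP; rewrite -absz_eq0; apply/negPn/negP => kn0.
(* The level |k| is deep enough, as p^(|k| + 1) exceeds |k|. *)
have := k0 `|k|%N; rewrite level_int => /eqP; rewrite intr_Zp_eq0 => /dvdn_leq.
rewrite lt0n kn0 => /(_ isT); rewrite absz_nat leqNgt => /negP; apply.
by apply: ltn_trans (ltn_expl _ (prime_gt1 pr)) _; rewrite ltn_exp2l ?prime_gt1.
Qed.
End Padic.

(** * Points commuting with a congruence subgroup *)

Section IdealQuotient.
Variables (R : comNzRingType) (I : R -> Prop).
Hypotheses (I0 : I 0) (I1 : ~ I 1).
Hypothesis IMD : forall a u v, I u -> I v -> I (a * u + v).

Definition ideal_pred (x : R) : bool := `[< I x >].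

Lemma ideal_pred_closed : idealr_closed (ideal_pred).
Proof.
split; [exact/asboolP|by apply/asboolP|].
by move=> a u v /asboolP Iu /asboolP Iv; apply/asboolP/IMD.
Qed.

HB.instance Definition _ := isIdealr.Build R (ideal_pred) ideal_pred_closed.

Lemma ideal_quotient : exists (S : comNzRingType) (phi : {rmorphism R -> S}),
  forall x, phi x = 0 <-> I x.
Proof.
pose S := {ideal_quot (ideal_pred : idealr R)}.
pose phi : {rmorphism R -> S} := (\pi_S)%qT.
exists S, phi => x; rewrite -(rmorph0 phi).
have E := Quotient.idealrBE (ideal_pred : idealr R) x 0.
split=> [/eqP|Ix]; last by apply/eqP; rewrite -E subr0; apply/asboolP.
by rewrite -E subr0 => /asboolP.
Qed.
End IdealQuotient.

Section IntegralPolynomials.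
Variable n : nat.
Notation pol := {mpoly rat[n * n]}.
Notation ipol := {mpoly int[n * n]}.
Notation ratp := (@map_mpoly (n * n) int rat intr).

Lemma clear_denominators (F : pol) :
  exists C (G : ipol), (0 < C)%N /\ ratp G = C%:R *: F.
Proof.
elim/mpoly_alg_ind: F => [c|k|F1 F2 [C1 [G1 [C1p E1]]] [C2 [G2 [C2p E2]]]|
    F1 F2 [C1 [G1 [C1p E1]]] [C2 [G2 [C2p E2]]]].
- exists `|denq c|%N, (numq c)%:MP; split; first by rewrite absz_gt0 denq_neq0.
  rewrite map_mpolyC ?rmorph0 // -mul_mpolyC -mpolyCM; congr (_%:MP).
  by rewrite [RHS]mulrC pmulrn gez0_abs ?ltW ?denq_gt0 // -numqE.
- by exists 1%N, 'X_k; rewrite map_mpolyX scale1r.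
- exists (C1 * C2)%N, (G1 *+ C2 + G2 *+ C1); split; first by rewrite muln_gt0 C1p.
  rewrite rmorphD !rmorphMn /= E1 E2 -![_ *: _ *+ _]scaler_nat !scalerA -!natrM.
  by rewrite [(C2 * C1)%N]mulnC -scalerDr.
- exists (C1 * C2)%N, (G1 * G2); split; first by rewrite muln_gt0 C1p.
  by rewrite rmorphM /= E1 E2 -scalerAl -scalerAr scalerA -natrM.
Qed.

Lemma rat_ev_ratp (S : comNzRingType) (iota : {rmorphism rat -> S}) z (G : ipol) :
  rat_ev iota z (ratp G) = mx_eval G z.
Proof.
elim/mpoly_alg_ind: G => [c|k|F1 F2 E1 E2|F1 F2 E1 E2].
- by rewrite map_mpolyC ?rmorph0 // rat_evC /mx_eval mmapC rmorph_int.
- by rewrite map_mpolyX /rat_ev /mx_eval !mmapX.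
- by rewrite !rmorphD /= E1 E2 mx_evE mx_evE -rmorphD.
- by rewrite !rmorphM /= E1 E2 mx_evE mx_evE -rmorphM.
Qed.

Lemma ratp_generic : map_mx ratp (generic_mx n) = gen_mx n.
Proof. by apply/matrixP => i j; rewrite !mxE map_mpolyX. Qed.

Lemma ratp_inj : injective ratp.
Proof.
move=> F G /mpolyP FG; apply/mpolyP => m; have := FG m.
by rewrite !mcoeff_map_mpoly => /intr_inj.
Qed.

Lemma mxOver_intP m k (x : 'M[rat]_(m, k)) : x \is a mxOver Num.int ->
  exists y : 'M[int]_(m, k), x = map_mx intr y.
Proof.
move=> /mxOverP xi; exists (\matrix_(i, j) Num.floor (x i j)).
by apply/matrixP => i j; rewrite !mxE floorK.
Qed.
End IntegralPolynomials.

Lemma map_mxX (R S : comNzRingType) (f : {rmorphism R -> S}) n (x : 'M[R]_n) k :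
  map_mx f (x ^+ k) = (map_mx f x) ^+ k.
Proof.
elim: k => [|k IH]; first by rewrite !expr0 map_mx1.
by rewrite !exprS -!mulmxE map_mxM IH.
Qed.

(** The commutator of [z] with exp(t x) is a polynomial in t of degree less than n which vanishes at
    the n distinct rationals t = q a, a < n. Inverting their Vandermonde matrix over Q kills its
    coefficients, in particular the linear one. *)
Lemma commute_expmx (S : comNzRingType) (iota : {rmorphism rat -> S}) n
    (z : 'M[S]_n) (x : 'M[rat]_n) (q : rat) : q != 0 -> x ^+ n = 0 ->
  (forall a : nat, z *m map_mx iota (expmx ((q * a%:R) *: x))
     = map_mx iota (expmx ((q * a%:R) *: x)) *m z) ->
  z *m map_mx iota x = map_mx iota x *m z.
Proof.
move=> q0 xn zx.
pose c k := z *m map_mx iota (k`!%:R^-1 *: x ^+ k) - map_mx iota (k`!%:R^-1 *: x ^+ k) *m z.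
have expE t : map_mx iota (expmx (t *: x))
   = \sum_(k < n) iota (t ^+ k) *: map_mx iota (k`!%:R^-1 *: x ^+ k).
  rewrite /expmx map_mx_sum; apply: eq_bigr => k _.
  by rewrite exprZmx -map_mxZ !scalerA mulrC.
pose v : 'rV[rat]_n := \row_a (q * a%:R).
pose W := Vandermonde n v.
have Wu : W \in unitmx.
  rewrite unitmxE det_Vandermonde unitfE; apply/prodf_neq0 => i _.
  apply/prodf_neq0 => j ij; rewrite !mxE subr_eq0 (inj_eq (mulfI q0)) eqr_nat.
  by rewrite neq_ltn ij orbT.
have c0 k : (k < n)%N -> c k = 0.
  move=> kn; apply/matrixP => s t; rewrite [RHS]mxE.
  pose r : 'rV[S]_n := \row_(k < n) c k s t.
  have rW : r *m map_mx iota W = 0.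
    apply/rowP => a; rewrite [RHS]mxE mxE.
    have := congr1 (fun m : 'M[S]_n => m s t) (zx a); rewrite expE mulmx_sumr mulmx_suml.
    move/eqP; rewrite -subr_eq0 !summxE -sumrB => /eqP; apply: etrans.
    apply: eq_bigr => k' _; rewrite -scalemxAl -scalemxAr !mxE -mulrBr mulrC.
    by rewrite /c [RHS]mulrC [in RHS]mulrC; congr (_ * _); rewrite !mxE.
  have : r *m map_mx iota W *m map_mx iota (invmx W) = 0 by rewrite rW mul0mx.
  rewrite -mulmxA -map_mxM mulmxV // map_mx1 mulmx1 => /rowP/(_ (Ordinal kn)).
  by rewrite !mxE.
have [n1|n1] := ltnP 1 n.
  have := c0 1%N n1; rewrite /c expr1 (_ : 1`! = 1%N) // invr1 scale1r => /eqP.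
  by rewrite subr_eq0 => /eqP.
(* For n <= 1 the truncated series has no linear term, but then the nilpotent [x] is 0. *)
suff -> : x = 0 by rewrite map_mx0 mulmx0 mul0mx.
case: (n) n1 x xn {zx c expE v W Wu c0} => [|[|//]] _ x; last by rewrite expr1.
by move=> _; apply/matrixP => -[].
Qed.

Lemma cartan_diag X i : cartan X i i = 2.
Proof. by rewrite mxE /cartan_entry eqxx. Qed.

Section CongruenceCentralizer.
Variables (X : cartan_type) (G : sc_chevalley_group X) (p : nat).
Hypotheses (pr : prime p) (p_ge3 : (3 <= p)%N) (Xp : proper_type X).
Let n := chev_dim G.
Let V := chev_rep G.
Notation pol := {mpoly rat[n * n]}.
Notation ipol := {mpoly int[n * n]}.
Notation ratp := (@map_mpoly (n * n) int rat intr).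
Notation Zp := (padic_int p).
Notation H := (congruence_kernel G p).

(** The congruence subgroup modulo p^(r+1); at level 0 it is all of G(1). *)
Definition in_level r (g : H) := map_mx (level p r) (ck_mx g) = 1.

Lemma level_ck0 (g : H) : in_level 0 g.
Proof. by have /eqP/(congr1 val) := valP g. Qed.

Lemma root_vectorZ c x : root_vector V x -> root_vector V (c *: x).
Proof.
move=> [xL [alpha a0 xa]]; split; last first.
  exists alpha => // i; have := xa i; rewrite /lie_bracket -!mulmxE => xai.
  by rewrite -scalemxAr -scalemxAl -scalerBr xai !scalerA mulrC.
have -> : c *: x = (c - 1) *: x + x by rewrite scalerBl scale1r subrK.
exact: lie_lin.
Qed.

Lemma root_vector_e i : root_vector V (rep_e V i).
Proof.
split; first exact: lie_e.
exists (\row_j cartan X j i) => [|j]; last by rewrite mxE rep_he.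
by apply/eqP => /rowP/(_ i); rewrite !mxE /cartan_entry eqxx.
Qed.

Lemma root_vector_f i : root_vector V (rep_f V i).
Proof.
split; first exact: lie_f.
exists (\row_j - cartan X j i) => [|j]; last by rewrite mxE rep_hf rmorphN.
by apply/eqP => /rowP/(_ i); rewrite !mxE /cartan_entry eqxx.
Qed.

Section RootElement.
Variables (x : 'M[rat]_n) (j a : nat).
Hypothesis xr : root_vector V x.
Hypothesis xi : forall m, m`!%:R^-1 *: x ^+ m \is a mxOver Num.int.

(** Integral divided powers make exp(p^(j+1) a x) an integer matrix congruent to 1. The integral
    equations of the group hold for it over Q, hence over the integers and over the p-adic
    integers. *)
Lemma root_element : exists (u : 'M[int]_n) (g : H),
  [/\ map_mx intr u = expmx (((p ^ j.+1)%:R * a%:R) *: x),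
      ck_mx g = map_mx intr u & in_level j g].
Proof.
pose q := (p ^ j.+1 * a)%N.
have /choice [B BE] m := mxOver_intP (xi m).
pose u := \sum_(m < n) (q ^ m)%:R *: B m.
have uE : map_mx intr u = expmx ((((p ^ j.+1)%:R * a%:R) : rat) *: x).
  rewrite /u map_mx_sum /expmx; apply: eq_bigr => m _.
  by rewrite map_mxZ -BE exprZmx -natrM !scalerA mulrC -natrX rmorph_nat.
have uP : is_point V (map_mx (intr : int -> Zp) u).
  move=> F F0; rewrite -(rmorph_mx_eval (intmul 1));
    have : mx_eval F (expmx ((((p ^ j.+1)%:R * a%:R) : rat) *: x)) = 0.
    by apply: F0; apply: elementary_expmx; apply: root_vectorZ.
  by rewrite -uE -(rmorph_mx_eval (intmul 1)) => /eqP; rewrite intr_eq0 => /eqP ->;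
    rewrite rmorph0.
have u1 : mx_dvd (p ^ j.+1) (u - 1).
  (* The subtracted sum is the series at parameter 0, that is, the identity. *)
  have : mx_dvd (p ^ j.+1) (u - \sum_(m < n) (0 ^+ m)%:R *: B m).
    rewrite /u -sumrB; apply: mx_dvd_sum => m _; rewrite -scalerBl.
    case: (nat_of_ord m) => [|k]; first by rewrite subrr scale0r => s t; rewrite mxE dvdz0.
    rewrite expr0n subr0 => s t; rewrite mxE natz dvdz_mulr //.
    by rewrite dvdzE !absz_nat [X in (_ %| X)%N]expnS; apply: dvdn_mulr; apply: dvdn_mulr.
  suff -> : \sum_(m < n) (0 ^+ m)%:R *: B m = 1 by [].
  have iI : injective (map_mx (intr : int -> rat) : 'M_n -> 'M_n).
    by move=> s t /matrixP st; apply/matrixP => k l; have := st k l; rewrite !mxE => /intr_inj.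
  apply: iI; rewrite map_mx_sum map_mx1 -[1%:M]/(1 : 'M[rat]_n) -(expmx_sum0 x);
    apply: eq_bigr => m _.
  rewrite map_mxZ -BE scalerA; congr (_ *: _); rewrite rmorph_nat natrX.
  by [].
have ulev s : (s <= j)%N -> map_mx (level p s) (map_mx (intr : int -> Zp) u) = 1.
  move=> sj; have : map_mx (intr : int -> 'Z_(p ^ s.+1)) (u - 1) = 0.
    by apply/(map_intr_Zp_eq0 pr); apply: mx_dvd_trans u1; apply: dvdn_exp2l.
  rewrite map_mxB map_mx1 => /eqP; rewrite subr_eq0 => /eqP E; rewrite -[RHS]/(1%:M) -E.
  by apply/matrixP => k l; rewrite !mxE level_int.
have gK : in_congruence_kernel (ChevalleyPoint (asboolT uP)).
  by apply/eqP/val_inj; exact: (ulev 0%N (leq0n j)).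
by exists u, (CongruenceKernel gK); split => //; exact: (ulev j (leqnn j)).
Qed.
End RootElement.

Variable j : nat.

Definition commutes_level r (z : chevalley_point V Zp) := forall g : H, in_level j g ->
  map_mx (level p r) (point_mx z *m ck_mx g - ck_mx g *m point_mx z) = 0.

(** The multiplier [C] depends neither on the point nor on the level; this uniformity turns an
    identity over the quotient into a bound valid at every level. *)
Definition almost_central_ideal (F : pol) := exists C (K : ipol),
  [/\ (0 < C)%N, ratp K = C%:R *: F &
   forall z r, commutes_level r z -> level p r (mx_eval K (point_mx z)) = 0].

Lemma almost_central_ideal0 : almost_central_ideal 0.
Proof.
exists 1%N, 0; rewrite rmorph0 scaler0; split=> // z r _.
by rewrite mx_evE !rmorph0.
Qed.

(** The identity commutes at all levels, so a positive integer [C] would be divisible by all powers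
    of p. *)
Lemma almost_central_ideal1 : ~ almost_central_ideal 1.
Proof.
move=> [C [K [C0 KE Kz]]].
have E (S : comNzRingType) : mx_eval K (1 : 'M[S]_n) = (mx_eval K (1 : 'M[int]_n))%:~R.
  by rewrite (rmorph_mx_eval (intmul 1)) map_mx1.
have KC : mx_eval K (1 : 'M[int]_n) = C%:Z.
  apply: (@intr_inj rat); rewrite -E -(rat_ev_ratp idfun) KE -mul_mpolyC mulr1.
  by rewrite rat_evC pmulrn.
have : C%:Z = 0.
  apply: (@level_int_eq0 p pr) => r; rewrite -KC -E; apply: (Kz 1%g) => g _.
  by rewrite /= mulmx1 mul1mx subrr map_mx0.
by move/eqP; rewrite eqz_nat eqn0Ngt C0.
Qed.

Lemma almost_central_idealMD a F K : almost_central_ideal F ->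
  almost_central_ideal K -> almost_central_ideal (a * F + K).
Proof.
move=> [C1 [F1 [C1p E1 z1]]] [C2 [K2 [C2p E2 z2]]].
have [C [A [Cp E]]] := clear_denominators a.
exists (C * C1 * C2)%N, ((A * F1) *+ C2 + K2 *+ (C * C1)); split.
- by rewrite !muln_gt0 Cp C1p.
- rewrite rmorphD !rmorphMn rmorphM /= E E1 E2 -scalerAl -scalerAr.
  by rewrite -!scaler_nat !scalerA -!natrM scalerDr; congr (_%:R *: _ + _%:R *: _); nia.
move=> z r zr; have -> : mx_eval (A * F1 *+ C2 + K2 *+ (C * C1)) (point_mx z)
    = mx_eval A (point_mx z) * mx_eval F1 (point_mx z) *+ C2
      + mx_eval K2 (point_mx z) *+ (C * C1).
  by rewrite mx_evE rmorphD !rmorphMn rmorphM.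
by rewrite rmorphD !rmorphMn rmorphM z1 // z2 // mulr0 !mul0rn addr0.
Qed.

Lemma almost_central_torsion : exists C, (0 < C)%N /\
  forall z r, commutes_level r z ->
    map_mx (level p r) (C%:R *: (point_mx z ^+ n`! - 1)) = 0.
Proof.
(* In the quotient [S] of Q[x_ij] the generic matrix becomes a point [z] to which
   [central_point_torsion] applies. *)
have [S [phi phi0]] := ideal_quotient almost_central_ideal0 almost_central_ideal1
  almost_central_idealMD.
pose iota : {rmorphism rat -> S} := phi \o (@mpolyC (n * n) rat).
pose z := map_mx phi (gen_mx n).
have evE F : rat_ev iota z F = phi F.
  by rewrite -(rat_ev_unique (g := phi) (iota := iota) (z := z)).
have [d dP] := cartan_height Xp.
have zV F : rat_vanishing V F -> rat_ev iota z F = 0.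
  move=> F0; rewrite evE; apply/phi0.
  have [C [K [Cp KE]]] := clear_denominators F.
  exists C, K; split=> // w r _; rewrite (pointP w) ?rmorph0 // => g gE.
  by rewrite -(rat_ev_ratp idfun) KE -mul_mpolyC rmorphM /= (F0 g gE) mulr0.
(* The points in question commute with the root elements exp(p^(j+1) a x), so these commutators lie
   in the ideal; hence [z] commutes with the exponentials and with [x] itself. *)
have zcomm (x : 'M[rat]_n) : root_vector V x ->
    (forall m, m`!%:R^-1 *: x ^+ m \is a mxOver Num.int) ->
    z *m map_mx iota x = map_mx iota x *m z.
  move=> xr xi; apply: (@commute_expmx _ _ _ _ _ (p ^ j.+1)%:R).
  - by rewrite pnatr_eq0 expn_eq0 negb_and eqn0Ngt prime_gt0.
  - exact: root_vector_nilp xr.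
  move=> a; have [u [g [uE gE gj]]] := root_element j a xr xi; rewrite -uE.
  pose U : 'M[pol]_n := map_mx (@mpolyC (n * n) rat) (map_mx intr u).
  have UE : map_mx iota (map_mx intr u) = map_mx phi U by apply/matrixP => s t; rewrite !mxE.
  apply/eqP; rewrite -subr_eq0 UE -!map_mxM -map_mxB; apply/eqP/matrixP => s t.
  rewrite [LHS]mxE [RHS]mxE; apply/phi0.
  pose Ui : 'M[ipol]_n := map_mx (@mpolyC (n * n) int) u.
  have UiE : map_mx ratp Ui = U.
    by apply/matrixP => k l; rewrite !mxE map_mpolyC ?rmorph0.
  exists 1%N, ((generic_mx n *m Ui - Ui *m generic_mx n) s t); split=> //.
    rewrite scale1r -UiE -(ratp_generic n) -!map_mxM -map_mxB.
    by rewrite [RHS]mxE.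
  move=> w r /(_ g gj)/matrixP/(_ s t); rewrite gE [RHS]mxE [LHS]mxE => <-; congr (level p r _).
  have wE : mx_ev (point_mx w) ((generic_mx n *m Ui - Ui *m generic_mx n) s t)
      = map_mx (mx_ev (point_mx w)) (generic_mx n *m Ui - Ui *m generic_mx n) s t.
    by rewrite [RHS]mxE.
  have UiE' : map_mx (mx_ev (point_mx w)) Ui = map_mx intr u.
    by apply/matrixP => k l; rewrite !mxE /mx_ev /mx_eval mmapC.
  by rewrite mx_evE wE map_mxB !map_mxM map_generic_mx UiE'.
have zM : z ^+ n`! = 1.
  apply: (central_point_torsion (V := V) (@cartan_diag X) dP zV) => i; apply: zcomm.
  - exact: root_vector_e.
  - by move=> m; case: (chev_admissible G i m).
  - exact: root_vector_f.
  - by move=> m; case: (chev_admissible G i m).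
have /choice [CK CKE] (st : 'I_n * 'I_n) : exists C,
  (0 < C)%N /\ forall w r, commutes_level r w ->
    level p r (C%:R * (point_mx w ^+ n`! - 1) st.1 st.2) = 0.
  have : almost_central_ideal ((gen_mx n ^+ n`! - 1) st.1 st.2).
    apply/phi0; have : map_mx phi (gen_mx n ^+ n`! - 1) = 0.
      by rewrite map_mxB map_mxX zM map_mx1 subrr.
    by move/matrixP/(_ st.1 st.2); rewrite [LHS]mxE [RHS]mxE.
  move=> [C [K [Cp KE Kz]]]; exists C; split=> // w r wr; rewrite -(Kz w r wr).
  have -> : K = C%:R *: (generic_mx n ^+ n`! - 1) st.1 st.2.
    apply: ratp_inj; rewrite KE map_mpolyZ rmorph_nat; congr (_ *: _).
    rewrite -(ratp_generic n) -map_mxX.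
    have -> : map_mx ratp (generic_mx n ^+ n`!) - 1 = map_mx ratp (generic_mx n ^+ n`! - 1).
      by rewrite map_mxB map_mx1.
    by rewrite [LHS]mxE.
  congr (level p r _); rewrite scaler_nat mx_evE rmorphMn /= mulr_natl; congr (_ *+ _).
  have -> : mx_ev (point_mx w) ((generic_mx n ^+ n`! - 1) st.1 st.2)
      = map_mx (mx_ev (point_mx w)) (generic_mx n ^+ n`! - 1) st.1 st.2 by rewrite [RHS]mxE.
  by rewrite map_mxB map_mxX map_mx1 map_generic_mx.
(* The product of the multipliers of the entries serves all entries at once. *)
exists (\prod_st CK st)%N; split; first by apply: prodn_gt0 => st; case: (CKE st).
move=> w r wr; apply/matrixP => s t; rewrite [RHS]mxE [LHS]mxE [X in level p r X]mxE.
rewrite (bigD1 (s, t)) // natrM mulrAC rmorphM.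
have E : level p r ((CK (s, t))%:R * (point_mx w ^+ n`! - 1) s t) = 0.
  by case: (CKE (s, t)) => _; apply.
by rewrite [X in X * _]E mul0r.
Qed.

Theorem congruence_centralizer : exists m, forall z : H,
  (forall g : H, in_level j g ->
     map_mx (level p m) (ck_mx z *m ck_mx g - ck_mx g *m ck_mx z) = 0) ->
  in_level j z.
Proof.
have [C [C0 Cz]] := almost_central_torsion.
(* The extra precision pays for cancelling [C] and for extracting the root of order n!. *)
exists (j + logn p C + logn p n`!)%N => z zg.
set m := (_ + _)%N in zg; have jm : (j <= m)%N by rewrite /m; lia.
have := Cz (ck_val z) m zg; rewrite -/(ck_mx z).
have [y yE] := level_lift m (ck_mx z).
have := level_ck0 z; rewrite /in_level.
rewrite (yE 0%N) // (yE j) // => y0 H.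
have {}y0 : mx_dvd p (y - 1).
  rewrite -[p]expn1; apply/(map_intr_Zp_eq0 pr); rewrite map_mxB map_mx1 y0.
  by rewrite subrr.
have Hm : mx_dvd (p ^ (j + 1 + logn p C + logn p n`!)) (C%:R *: (y ^+ n`! - 1)).
  rewrite (_ : (j + 1 + logn p C + logn p n`! = m.+1)%N); last by rewrite /m; lia.
  apply/(map_intr_Zp_eq0 pr); rewrite -{}H !map_mxZ !map_mxB !map_mxX !map_mx1 yE //.
  by rewrite !rmorph_nat.
have := mx_dvd_root pr p_ge3 C0 (fact_gt0 n) y0 Hm.
move/(map_intr_Zp_eq0 pr); rewrite map_mxB map_mx1 => /eqP; rewrite subr_eq0 => /eqP ->.
by [].
Qed.
End CongruenceCentralizer.

(** * Class functions on p-groups *)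

Section OrbitSum.
Variables (p : nat) (pr : prime p) (K : groupType) (D : K -> Prop) (Q : choiceType).
Variable act : K -> Q -> Q.
Hypotheses (D1 : D 1%g) (DM : forall g h, D g -> D h -> D (g * h)%g).
Hypothesis act1 : forall q, act 1%g q = q.
Hypothesis actM : forall g h q, act (g * h)%g q = act h (act g q).
Hypothesis act_tors : forall g, D g -> exists k, forall q, act (g ^+ (p ^ k))%g q = q.
Variables (S : {fset Q}) (a : Q -> 'F_p).
Hypothesis S_stable : forall g q, D g -> q \in S -> act g q \in S.
Hypothesis a_inv : forall g q, D g -> a (act g q) = a q.
Hypothesis no_fix : forall q, q \in S -> a q != 0 -> exists2 g, D g & act g q != q.

(** [D] acts on [S] through a finite p-group. Each set where [a] takes a given nonzero value is
    stable and has no fixed point, so its size is divisible by p. *)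
Lemma orbit_sum_eq0 : \sum_(q <- S) a q = 0.
Proof.
pose G := [set s : {perm S} | `[< exists2 g, D g & forall q : S, val (s q) = act g (val q) >]].
have GP (s : {perm S}) :
    reflect (exists2 g, D g & forall q : S, val (s q) = act g (val q)) (s \in G).
  by rewrite inE; exact: asboolP.
have gG : group_set G.
  apply/group_setP; split; first by apply/GP; exists 1%g => // q; rewrite perm1 act1.
  move=> s t /GP [g Dg sg] /GP [h Dh th]; apply/GP; exists (g * h)%g; first exact: DM.
  by move=> q; rewrite permM th sg actM.
have permG g : D g -> exists2 s : {perm S}, s \in G & forall q : S, val (s q) = act g (val q).
  move=> Dg; pose f (q : S) : S := [` S_stable Dg (valP q)]%fset.
  have fI : injective f.
    move=> q q' /(congr1 val) /= E; apply: val_inj.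
    by rewrite -[LHS]act1 -[RHS]act1 -(mulgV g) !actM E.
  by exists (perm fI) => [|q]; [apply/GP; exists g => // q|]; rewrite permE.
(* By Cauchy's theorem a prime divisor of the order is the order of an element, and element orders
   divide powers of p. *)
have pG : (p.-group (Group gG))%g.
  apply/pgroupP => q prq /(Cauchy prq) [s sG os].
  have /GP [g Dg sg] := sG; have [k gk] := act_tors Dg.
  have sX m (q' : S) : val ((s ^+ m)%g q') = act (g ^+ m)%g (val q').
    elim: m q' => [|m IH] q'; first by rewrite !expg0 perm1 act1.
    by rewrite !expgSr permM sg IH actM.
  have : (s ^+ (p ^ k) = 1)%g by apply/permP => q'; apply: val_inj; rewrite sX gk perm1.
  move/eqP; rewrite -order_dvdn os ; rewrite (Euclid_dvdX _ _ prq) => /andP [+ _].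
  by rewrite dvdn_prime2 // => /eqP ->; rewrite inE.
rewrite big_seq_fsetE /= (partition_big (fun q : S => a (val q)) predT) //=.
rewrite big1 // => c _; rewrite (eq_bigr (fun=> c)) => [|q /eqP //].
have [->|c0] := eqVneq c 0; first by rewrite big1.
pose Sc := [set q : S | a (val q) == c].
have -> : \sum_(q : S | a (val q) == c) c = c *+ #|Sc|.
  by rewrite -sumr_const; apply: eq_bigl => q; rewrite inE.
have Sact : [acts Group gG, on Sc | 'P]%g.
  apply/actsP => s /GP [g Dg sg] q; rewrite !inE /= /aperm sg.
  by rewrite a_inv.
have := pgroup_fix_mod pG Sact.
have -> : ('Fix_(Sc | 'P)(Group gG))%g = finset.set0.
  apply/setP => q; rewrite finset.in_set0; apply/negP => /finset.setIP [+ /afixP fq].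
  rewrite inE => /eqP aq.
  have aq0 : a (val q) != 0 by rewrite aq.
  have [g Dg /eqP] := no_fix (valP q) aq0; apply.
  have [s sG sg] := permG g Dg; rewrite -sg.
  by congr val; exact: fq.
rewrite cards0 mod0n => /eqP/dvdnP [m ->].
have ch : p \in [pchar ('F_p : nzRingType)] := pchar_Fp pr.
by rewrite mulnC mulrnA (mulrn_pchar ch) mul0rn.
Qed.
End OrbitSum.

Lemma cosetgJ (K : groupType) (N : normal_subgroup K) (x y : K) :
  cosetg N (x ^ y)%g = (cosetg N x ^ cosetg N y)%g.
Proof.
have invE (z : K) : cosetg N (z^-1)%g = ((cosetg N z)^-1)%g := cosetgV N z.
have mulE (z t : K) : cosetg N (z * t)%g = (cosetg N z * cosetg N t)%g := cosetgM N z t.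
by rewrite !conjgE !mulE invE.
Qed.

(** * Coefficients in group algebras *)

Section GroupAlgebraCoef.
Variables (R : nzRingType) (Q Q' : groupType).

Lemma gcoefD x : {morph @gcoef R Q x : a b / a + b}.
Proof. by move=> a b; exact: monalg.mcoeffD. Qed.

Lemma gcoef0 x : gcoef x (0 : galg R Q) = 0.
Proof. exact: monalg.mcoeff0. Qed.

Lemma gcoef_neq0 x (a : galg R Q) : (x \in gsupp a) = (gcoef x a != 0).
Proof. by rewrite /gsupp /gcoef monalg.mcoeff_neq0. Qed.

Lemma gcoef_mul_gmono x y (a : galg R Q) :
  gcoef x (a * gmono 1 y) = gcoef (x * y^-1)%g a.
Proof.
apply: (eq_gadd (f := fun a => gcoef x (a * gmono 1 y)) (g := gcoef (x * y^-1)%g)) =>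
  [|u v||u v|c k].
- by rewrite mul0r gcoef0.
- by rewrite mulrDl gcoefD.
- exact: gcoef0.
- exact: gcoefD.
rewrite gmonoM mulr1 !gcoef_gmono; congr (_ *+ nat_of_bool _).
by apply/eqP/eqP => [<-|->]; rewrite ?mulgK ?mulgKV.
Qed.

Lemma gcoef_gmono_mul x y (a : galg R Q) :
  gcoef x (gmono 1 y * a) = gcoef (y^-1 * x)%g a.
Proof.
apply: (eq_gadd (f := fun a => gcoef x (gmono 1 y * a)) (g := gcoef (y^-1 * x)%g)) =>
  [|u v||u v|c k].
- by rewrite mulr0 gcoef0.
- by rewrite mulrDr gcoefD.
- exact: gcoef0.
- exact: gcoefD.
rewrite gmonoM mul1r !gcoef_gmono; congr (_ *+ nat_of_bool _).
by apply/eqP/eqP => [<-|->]; rewrite ?mulKg ?mulKVg.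
Qed.

Lemma gcoef_map (phi : Q -> Q') y (a : galg R Q) :
  gcoef y (galg_map phi a) = \sum_(x <- gsupp a) gcoef x a *+ (phi x == y).
Proof. by rewrite /galg_map gcoef_sum; apply: eq_bigr => x _; rewrite gcoef_gmono. Qed.
End GroupAlgebraCoef.

(** * The p-adic topology and the congruence subgroups *)

Section PadicTopology.
Local Open Scope classical_set_scope.
Variable p : nat.

Lemma padic_nbhs_level (x : padic_int p) r : nbhs x [set y | level p r y = level p r x].
Proof.
apply: open_nbhs_nbhs; split=> //.
exists (proj r @^-1` [set (x r : discrete_topology 'Z_(p ^ r.+1))]) => //.
by apply: open_comp => [f _|]; [exact: proj_continuous | exact: discrete_open].
Qed.

Lemma padic_nbhsP (x : padic_int p) (U : set (padic_int p)) : nbhs x U ->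
  exists r, forall y, level p r y = level p r x -> U y.
Proof.
move=> [_ [[B oB <-] Bx BU]].
(* The filter of cylinders around the image of [x] converges in each coordinate, hence in the
   product, so every neighbourhood contains a cylinder. *)
pose F := filter_from [set: nat] (fun m =>
  [set f : prod_topology (fun n => discrete_topology 'Z_(p ^ n.+1)) |
  forall k, (k <= m)%N -> f k = padic_to_prod x k]).
have FF : Filter F.
  apply: filter_from_filter; first by exists 0%N.
  move=> i j _ _; exists (maxn i j) => // f fm; split=> k ki; apply: fm.
    by rewrite leq_max ki.
  by rewrite leq_max ki orbT.
have Fx : F --> padic_to_prod x.
  apply/cvg_sup => i U' [V] [[W] oW <-] WfN WU.
  by apply: (filterS WU); exists i => // f; rewrite /= => ->.
have : F B by apply: Fx; apply: open_nbhs_nbhs.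
move=> [m _ mB]; exists m => y ym; apply: BU; apply: mB => k km.
rewrite /padic_to_prod -(invlimP y km) -(invlimP x km).
by congr (Zred _ _); exact: ym.
Qed.
End PadicTopology.

Section LevelSubgroups.
Local Open Scope classical_set_scope.
Variables (X : cartan_type) (G : sc_chevalley_group X) (p : nat).
Notation H := (congruence_kernel G p).
Definition lev r (g : H) := map_mx (level p r) (ck_mx g).

Lemma ck_mxM (g h : H) : ck_mx (g * h)%g = ck_mx g *m ck_mx h.
Proof. by []. Qed.

Lemma ck_mx1 : ck_mx (1%g : H) = 1%:M.
Proof. by []. Qed.

Lemma lev1 r : lev r 1%g = 1%:M.
Proof. by rewrite /lev ck_mx1 map_mx1. Qed.

Lemma levM r (g h : H) : lev r (g * h)%g = lev r g *m lev r h.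
Proof. by rewrite /lev ck_mxM map_mxM. Qed.

Lemma in_levelP r (g : H) : in_level r g <-> lev r g = 1%:M.
Proof. by []. Qed.

Lemma in_level1 r : in_level r (1%g : H).
Proof. exact: lev1. Qed.

Lemma in_levelM r (g h : H) : in_level r g -> in_level r h -> in_level r (g * h)%g.
Proof. by move=> /in_levelP g1 /in_levelP h1; apply/in_levelP; rewrite levM g1 h1 mulmx1. Qed.

Lemma in_levelV r (g : H) : in_level r g -> in_level r (g^-1)%g.
Proof.
move=> /in_levelP g1; apply/in_levelP.
by rewrite -[LHS]mulmx1 -g1 -levM mulVg lev1.
Qed.

Lemma in_levelJ r (g h : H) : in_level r g -> in_level r (g ^ h)%g.
Proof.
move=> /in_levelP g1; apply/in_levelP.
by rewrite conjgE !levM g1 mul1mx -levM mulVg lev1.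
Qed.

Definition level_subgroup r : normal_subgroup H :=
  NormalSubgroup (in_level1 r) (@in_levelM r) (@in_levelV r) (@in_levelJ r).

Lemma level_subgroup_open r : open (level_subgroup r : set H).
Proof.
exists [set M : 'M[padic_int p]_(chev_dim G) | map_mx (level p r) M = 1%:M]; last by [].
rewrite openE => M /= M1; exists (fun i j => [set y | level p r y = level p r (M i j)]).
  by move=> i j; exact: padic_nbhs_level.
move=> N NM /=; rewrite -M1; apply/matrixP => i j; rewrite !mxE.
exact: NM.
Qed.

Lemma in_level_le a b (g : H) : (a <= b)%N -> in_level b g -> in_level a g.
Proof.
move=> ab /in_levelP gb; apply/in_levelP.
have /matrixP E : lev b g = lev b 1%g by rewrite gb lev1.
rewrite -(lev1 a); apply/matrixP => i j; rewrite [LHS]mxE [RHS]mxE.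
apply/eqP; rewrite -subr_eq0 -rmorphB; apply/eqP; apply: (level_le0 ab).
by rewrite rmorphB; move: (E i j); rewrite [LHS]mxE [X in _ = X]mxE => ->; rewrite subrr.
Qed.

Definition open_level_subgroup r := OpenNormalSubgroup (level_subgroup_open r).

Lemma open_subgroup_level (N : open_normal_subgroup H) : exists r,
  forall g, in_level r g -> N g.
Proof.
have [B oB BN] := ons_open N.
have B1 : B (ck_mx (1%g : H)).
  by have : (N : set H) 1%g := nsub1 N; rewrite -BN.
move: oB; rewrite openE => /(_ _ B1) [P Pn PB].
have /choice [f fP] (ij : 'I_(chev_dim G) * 'I_(chev_dim G)) := padic_nbhsP (Pn ij.1 ij.2).
exists (\max_ij f ij)%N => g /in_levelP gr.
suff : (@ck_mx X G p @^-1` B) g by rewrite BN.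
apply: PB => i j; apply: (fP (i, j)).
have le : (f (i, j) <= \max_ij f ij)%N by exact: leq_bigmax.
have /matrixP/(_ i j) : lev (f (i, j)) g = lev (f (i, j)) 1%g.
  by rewrite lev1; apply/in_levelP; apply: in_level_le le gr.
by rewrite [LHS]mxE [X in _ = X]mxE.
Qed.

(** Quotients of G(1) by congruence subgroups thus have p-power torsion, as [orbit_sum_eq0]
    requires. *)
Lemma level_expp (pr : prime p) m (g : H) : in_level m (g ^+ (p ^ m))%g.
Proof.
have expM k : ck_mx (g ^+ k)%g = ck_mx g ^+ k.
  by elim: k => [|k IH]; rewrite ?expg0 ?expr0 // expgS ck_mxM IH exprS mulmxE.
have [y yE] := level_lift m (ck_mx g).
have := level_ck0 g; rewrite /in_level (yE 0%N) // => y0.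
have {}y0 : mx_dvd p (y - 1).
  rewrite -[p]expn1; apply/(map_intr_Zp_eq0 pr); rewrite map_mxB map_mx1 y0.
  by rewrite subrr.
have := mx_dvd_exppn pr m y0; move/(map_intr_Zp_eq0 pr).
rewrite map_mxB map_mx1 map_mxX -yE // -map_mxX -expM => /eqP.
by rewrite subr_eq0 => /eqP.
Qed.
End LevelSubgroups.

(** * Central elements of the Iwasawa algebra *)

Section CentralElements.
Variables (k : nzRingType) (H : preTopologicalGroupType).

Program Definition group_like (g : H) : iwasawa k H :=
  @InvLim _ _ _ _ (fun N => gmono 1 (cosetg N g)) _.
Next Obligation.
by move=> g; apply/asboolP => N N' h; rewrite /= /iwasawa_tr galg_map_gmono quotg_mapE.
Qed.

Lemma central_gcoefJ (r : iwasawa k H) (N : open_normal_subgroup H) g x :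
  (forall s, r * s = s * r) -> gcoef (x ^ cosetg N g)%g (r N) = gcoef x (r N).
Proof.
move=> rC; set y : quotg N := cosetg N g.
have E : r N * gmono 1 y = gmono 1 y * r N :> galg k (quotg N).
  exact: (congr1 (fun s : iwasawa k H => s N) (rC (group_like g))).
apply: etrans (esym (gcoef_gmono_mul (x * y)%g y (r N))) _; rewrite -E.
by apply: etrans (gcoef_mul_gmono _ _ _) _; rewrite mulgK.
Qed.
End CentralElements.

Theorem proposition6p1 (p : nat) (X : cartan_type) (G : sc_chevalley_group X)
    (p_prime : prime p) (p_ge3 : (3 <= p)%N) (X_proper : proper_type X)
    (r : iwasawa 'F_p (congruence_kernel G p))
    (r_central : forall s : iwasawa 'F_p (congruence_kernel G p), r * s = s * r) :
  exists c : 'F_p, r = iwasawa_scalar (congruence_kernel G p) c.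
Proof.
pose H := congruence_kernel G p.
have off1 (N : open_normal_subgroup H) y : y != 1%g -> gcoef y (r N) = 0.
  move=> y1; have [j jN] := open_subgroup_level N.
  have [m mj] := congruence_centralizer G p_prime p_ge3 X_proper j.
  (* [L] is contained in [N] and is deep enough for the bound on the centralizer. *)
  pose L := open_level_subgroup G p (maxn j m).
  have LN : (L `<=` N)%classic.
    by move=> g /= gL; apply: jN; apply: in_level_le gL; exact: leq_maxl.
  have rLN : galg_map (@quotg_map H L N) (r L) = r N := invlimP r LN.
  rewrite -rLN gcoef_map.
  (* The summand is cut off outside the fibre over [y]. It is invariant since [N] contains the
     congruence subgroup of level [j], which therefore acts trivially on the quotient by [N]. *)
  apply: (@orbit_sum_eq0 p p_prime H (@in_level X G p j) _ (fun g q => (q ^ cosetg L g)%g)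
    _ _ _ _ _ _ (fun x => gcoef x (r L) *+ (quotg_map N x == y))).
  - exact: in_level1.
  - by move=> g h; exact: in_levelM.
  - by move=> q; rewrite (_ : cosetg L 1%g = 1%g) ?conjg1.
  - by move=> g h q; rewrite cosetgM conjgM.
  - move=> g _; exists (maxn j m) => q.
    have -> : cosetg L (g ^+ (p ^ maxn j m))%g = 1%g.
      apply/cosetg_eq; rewrite mulg1; apply: in_levelV.
      exact: level_expp.
    exact: conjg1.
  - by move=> g q gj; rewrite !gcoef_neq0 central_gcoefJ.
  - move=> g q gj; rewrite /= (central_gcoefJ g q r_central).
    have -> : quotg_map N (q ^ cosetg L g)%g = quotg_map N q.
      have [x ->] := cosetgP q; rewrite -cosetgJ !quotg_mapE //; apply/cosetg_eq.
      have -> : ((x ^ g)^-1 * x = g^-1 * g ^ x)%g.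
        by rewrite !conjgE !invgM invgK !mulgA.
      by apply: nsubM; [apply: nsubV; exact: jN | apply: nsubJ; exact: jN].
    by [].
  (* A fixed class is represented by some [x] commuting at level [m] with the subgroup of level [j].
     Then [x] has level [j] and lies in [N], so the fibre is the one over 1, against [y1]. *)
  move=> q qS aq; apply: contrapT => nofix.
  have [x qx] := cosetgP q.
  have xj : in_level j x.
    apply: mj => g gj.
    have : (q ^ cosetg L g)%g = q.
      by apply: contrapT => E; apply: nofix; exists g => //; apply/eqP.
    rewrite qx -cosetgJ => /cosetg_eq xg.
    have {xg} : in_level m ((x ^ g)^-1 * x)%g by apply: in_level_le xg; exact: leq_maxr.
    move=> /in_levelP xg.
    have E : lev m (x ^ g)%g = lev m x by rewrite -[LHS]mulmx1 -xg -levM mulKVg.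
    have {}E : lev m (x * g)%g = lev m (g * x)%g.
      by rewrite (conjgC x g) (levM m g (x ^ g)%g) E levM.
    by rewrite map_mxB; apply/eqP; rewrite subr_eq0; apply/eqP; exact: E.
  move: aq; rewrite qx quotg_mapE //.
  have -> : cosetg N x = 1%g by apply/cosetg_eq; rewrite mulg1; apply: nsubV; apply: jN.
  by rewrite [1%g == y]eq_sym (negPf y1) mulr0n eqxx.
(* [N0] is all of G(1), so it contains every [N], and comparison with the component at [N0] shows
   that the scalar is the same for all [N]. *)
pose N0 := open_level_subgroup G p 0.
exists (gcoef 1%g (r N0)); apply: eq_invlim => N /=.
have rE (M : open_normal_subgroup H) : r M = gmono (gcoef 1%g (r M)) 1%g.
  apply/gcoefP => y; rewrite gcoef_gmono; have [<-|y1] := eqVneq 1%g y; first by rewrite mulr1n.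
  by rewrite off1 // eq_sym.
have sN : (N `<=` N0)%classic by move=> g _; exact: level_ck0.
have tN : galg_map (@quotg_map H N N0) (r N) = r N0 := invlimP r sN.
have E : r N0 = gmono (gcoef 1%g (r N)) 1%g.
  apply: etrans (esym tN) _; apply: etrans (congr1 (galg_map _) (rE N)) _.
  by rewrite galg_map_gmono (quotg_map1 sN).
have cE : gcoef 1%g (r N) = gcoef 1%g (r N0) by rewrite E gcoef_gmono eqxx.
exact: etrans (rE N) (congr1 (fun c => gmono c 1%g) cE).
Qed.
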